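(* The following problem is decidable in 2ExpTime: given $\mathcal{ALC}$ KBs $\mathcal{K}_1,\mathcal{K}_2$ and a signature $\Sigma$, decide whether $\mathcal{K}_1$ $\Sigma$-UCQ entails $\mathcal{K}_2$.
   Context: $\mathcal{ALC}$ concepts are built from concept names and $\top$ using $\neg$, $\sqcap$, $\exists R.C$; a KB is $\mathcal{K}=(\mathcal{T},\mathcal{A})$ with $\mathcal{T}$ a finite set of inclusions $C\sqsubseteq D$ and $\mathcal{A}$ a finite set of assertions $A(a)$, $R(a,b)$; $\mathsf{ind}(\mathcal{K})$ its individuals; interpretations satisfy $a^{\mathcal{I}}=a$. A UCQ is a disjunction of CQs $\exists\vec y\,\varphi(\vec x,\vec y)$ (conjunctions of atoms $A(z)$, $R(z,z')$) with the same answer variables $\vec x$; $\mathcal{K}\models q(\vec a)$ means all models of $\mathcal{K}$ satisfy $q(\vec a)$. For consistent KBs, $\mathcal{K}_1$ $\Sigma$-UCQ entails $\mathcal{K}_2$ if for every UCQ $q(\vec x)$ using only names in $\Sigma$ and tuple $\vec a$ from $\mathsf{ind}(\mathcal{K}_2)$, $\mathcal{K}_2\models q(\vec a)$ implies $\vec a\subseteq\mathsf{ind}(\mathcal{K}_1)$ and $\mathcal{K}_1\models q(\vec a)$. *)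

(* Defs.v *)
From Stdlib Require List.
From mathcomp Require Import all_boot ssralg poly.

Set Implicit Arguments.
Unset Strict Implicit.
Unset Printing Implicit Defensive.

(* The three countably infinite sets of names are copies of the set of bit
   strings, so that the length of a name is its contribution to the size of an
   input. *)
Definition cname := seq bool.
Definition rname := seq bool.
Definition iname := seq bool.

Inductive concept : Type :=
| CName of cname
| CTop
| CNot of concept
| CAnd of concept & concept
| CEx of rname & concept.

Inductive assertion : Type :=
| AConcept of cname & iname
| ARole of rname & iname & iname.

(* The finite sets of inclusions [(C, D)], read C ⊑ D, and of assertions are
   given by lists. *)
Record kb : Type := KB {
  tbox : seq (concept * concept);
  abox : seq assertion
}.

Definition ind_assertion (al : assertion) : seq iname :=
  match al with
  | AConcept _ a => [:: a]
  | ARole _ a b => [:: a; b]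
  end.

(* ALC inclusions contain no individual names. *)
Definition ind (K : kb) : seq iname := flatten (map ind_assertion (abox K)).

(* [ind_of] identifies every individual name with an element of the domain;
   injectivity makes this the standard name assumption a^I = a, up to renaming
   domain elements. *)
Record interpretation : Type := Interpretation {
  dom : Type;
  ind_of : iname -> dom;
  ind_of_inj : injective ind_of;
  cint : cname -> dom -> Prop;
  rint : rname -> dom -> dom -> Prop
}.

Fixpoint ext (I : interpretation) (C : concept) (d : dom I) : Prop :=
  match C with
  | CName A => cint A d
  | CTop => True
  | CNot C1 => ~ ext C1 d
  | CAnd C1 C2 => ext C1 d /\ ext C2 d
  | CEx R C1 => exists2 e, rint R d e & ext C1 e
  end.

Definition sat_inclusion (I : interpretation) (ax : concept * concept) : Prop :=
  forall d : dom I, ext ax.1 d -> ext ax.2 d.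

Definition sat_assertion (I : interpretation) (al : assertion) : Prop :=
  match al with
  | AConcept A a => cint A (ind_of I a)
  | ARole R a b => rint R (ind_of I a) (ind_of I b)
  end.

Definition model (I : interpretation) (K : kb) : Prop :=
  List.Forall (sat_inclusion I) (tbox K) /\
  List.Forall (sat_assertion I) (abox K).

Definition consistent (K : kb) : Prop := exists I, model I K.

(* [Ans i] is the i-th answer variable; all the variables [Ex j] are
   existentially quantified. *)
Inductive qvar (n : nat) : Type :=
| Ans of 'I_n
| Ex of nat.

Inductive qatom (n : nat) : Type :=
| QConcept of cname & qvar n
| QRole of rname & qvar n & qvar n.

(* Conjunctions and disjunctions are given by lists, which [ucq_wf] requires to
   be nonempty: neither ⊤ nor ⊥ is a query. An answer variable need not occur
   in every disjunct. *)
Definition cq (n : nat) := seq (qatom n).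
Definition ucq (n : nat) := seq (cq n).

Definition ucq_wf n (q : ucq n) : bool :=
  (0 < size q) && all (fun p : cq n => 0 < size p) q.

Record signature : Type := Signature {
  sig_c : seq cname;
  sig_r : seq rname
}.

Definition atom_over (S : signature) n (at_ : qatom n) : bool :=
  match at_ with
  | QConcept A _ => A \in sig_c S
  | QRole R _ _ => R \in sig_r S
  end.

Definition ucq_over (S : signature) n (q : ucq n) : bool :=
  all (all (@atom_over S n)) q.

Section QuerySemantics.

Variables (I : interpretation) (n : nat) (a : n.-tuple iname).

Definition qvar_val (f : nat -> dom I) (v : qvar n) : dom I :=
  match v with
  | Ans i => ind_of I (tnth a i)
  | Ex j => f j
  end.

Definition sat_atom (f : nat -> dom I) (at_ : qatom n) : Prop :=
  match at_ with
  | QConcept A z => cint A (qvar_val f z)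
  | QRole R z z' => rint R (qvar_val f z) (qvar_val f z')
  end.

Definition sat_cq (p : cq n) : Prop :=
  exists f : nat -> dom I, List.Forall (sat_atom f) p.

Definition sat_ucq (q : ucq n) : Prop := List.Exists sat_cq q.

End QuerySemantics.

Definition entails (K : kb) n (q : ucq n) (a : n.-tuple iname) : Prop :=
  forall I, model I K -> sat_ucq I a q.

(* Only meaningful for consistent [K1] and [K2]. *)
Definition ucq_entails (S : signature) (K1 K2 : kb) : Prop :=
  forall n (q : ucq n) (a : n.-tuple iname),
    ucq_wf q -> ucq_over S q -> {subset a <= ind K2} ->
    entails K2 q a ->
    {subset a <= ind K1} /\ entails K1 q a.

Definition enc_list T (e : T -> seq bool) (s : seq T) : seq bool :=
  foldr (fun x r => true :: e x ++ r) [:: false] s.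

Definition enc_name : seq bool -> seq bool := enc_list (fun b => [:: b]).

Fixpoint enc_concept (C : concept) : seq bool :=
  match C with
  | CName A => [:: false; false; false] ++ enc_name A
  | CTop => [:: false; false; true]
  | CNot C1 => [:: false; true; false] ++ enc_concept C1
  | CAnd C1 C2 => [:: false; true; true] ++ enc_concept C1 ++ enc_concept C2
  | CEx R C1 => [:: true; false; false] ++ enc_name R ++ enc_concept C1
  end.

Definition enc_inclusion (ax : concept * concept) : seq bool :=
  enc_concept ax.1 ++ enc_concept ax.2.

Definition enc_assertion (al : assertion) : seq bool :=
  match al with
  | AConcept A a => false :: enc_name A ++ enc_name a
  | ARole R a b => true :: enc_name R ++ enc_name a ++ enc_name b
  end.

Definition enc_kb (K : kb) : seq bool :=
  enc_list enc_inclusion (tbox K) ++ enc_list enc_assertion (abox K).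

Definition enc_signature (S : signature) : seq bool :=
  enc_list enc_name (sig_c S) ++ enc_list enc_name (sig_r S).

Definition enc_input (K1 K2 : kb) (S : signature) : seq bool :=
  enc_kb K1 ++ enc_kb K2 ++ enc_signature S.

Definition prefix_code T (e : T -> seq bool) : Prop :=
  forall x y r s, e x ++ r = e y ++ s -> x = y /\ r = s.

Lemma enc_list_prefix T (e : T -> seq bool) :
  prefix_code e -> prefix_code (enc_list e).
Proof.
move=> He; elim=> [|x u IH] [|y v] r s //=; first by case.
case; rewrite -!catA => /He [<- /IH [<- <-]]; by [].
Qed.

Lemma enc_name_prefix : prefix_code enc_name.
Proof. by apply: enc_list_prefix => x y r s /= [-> ->]. Qed.

Lemma enc_concept_prefix : prefix_code enc_concept.
Proof.
elim=> [A||C IH|C IHC D IHD|R C IH] [A'||C'|C' D'|R' C'] r s //=.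
- by case=> /enc_name_prefix [-> ->].
- by case=> ->.
- by case=> /IH [-> ->].
- by rewrite -!catA; case=> /IHC [-> /IHD [-> ->]].
- by rewrite -!catA; case=> /enc_name_prefix [-> /IH [-> ->]].
Qed.

Lemma enc_kb_prefix : prefix_code enc_kb.
Proof.
have incl_prefix : prefix_code enc_inclusion.
  move=> [C D] [C' D'] r s; rewrite /enc_inclusion /= -!catA.
  by case/enc_concept_prefix=> -> /enc_concept_prefix [-> ->].
have assert_prefix : prefix_code enc_assertion.
  case=> [A a|R a b] [A' a'|R' a' b'] r s //=; rewrite -!catA; case.
    by case/enc_name_prefix=> -> /enc_name_prefix [-> ->].
  by case/enc_name_prefix=> -> /enc_name_prefix [-> /enc_name_prefix [-> ->]].
move=> [T A] [T' A'] r s; rewrite /enc_kb /= -!catA.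
case/(enc_list_prefix incl_prefix)=> ->.
by case/(enc_list_prefix assert_prefix)=> -> ->.
Qed.

Lemma enc_input_inj K1 K2 S K1' K2' S' :
  enc_input K1 K2 S = enc_input K1' K2' S' -> [/\ K1 = K1', K2 = K2' & S = S'].
Proof.
case/enc_kb_prefix=> -> /enc_kb_prefix [->]; case: S S' => [c r] [c' r'].
rewrite /enc_signature /= => /(enc_list_prefix enc_name_prefix) [->].
rewrite -[LHS]cats0 -[RHS]cats0.
by case/(enc_list_prefix enc_name_prefix)=> ->.
Qed.

Inductive direction : Type := MoveLeft | Stay | MoveRight.

(* A deterministic Turing machine with [tm_tapes.+1] two-way infinite tapes and
   input alphabet [bool]. A tape cell is blank ([None]) or contains an input
   symbol or one of the further symbols [tm_work]. *)
Record TM : Type := MkTM {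
  tm_state : finType;
  tm_work : finType;
  tm_tapes : nat;
  tm_start : tm_state;
  tm_accept : tm_state;
  tm_reject : tm_state;
  tm_trans :
    tm_state -> {ffun 'I_tm_tapes.+1 -> option (bool + tm_work)} ->
    tm_state * {ffun 'I_tm_tapes.+1 -> option (bool + tm_work)}
             * ('I_tm_tapes.+1 -> direction);
  tm_accept_reject : tm_accept != tm_reject
}.

Section TMSemantics.

Variable M : TM.

Definition tm_symbol : finType := option (bool + tm_work M).

(* [left] lists the cells to the left of the head, nearest first, [right] those
   to its right; all cells beyond the two lists are blank. *)
Record tape : Type := Tape {
  left : seq tm_symbol;
  cur : tm_symbol;
  right : seq tm_symbol
}.

Definition move_tape (d : direction) (t : tape) : tape :=
  match d with
  | MoveLeft => Tape (behead (left t)) (head None (left t)) (cur t :: right t)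
  | Stay => t
  | MoveRight => Tape (cur t :: left t) (head None (right t)) (behead (right t))
  end.

Definition write_tape (x : tm_symbol) (t : tape) : tape :=
  Tape (left t) x (right t).

Record config : Type := Config {
  c_state : tm_state M;
  c_tape : 'I_(tm_tapes M).+1 -> tape
}.

Definition step (c : config) : config :=
  if c_state c \in [:: tm_accept M; tm_reject M] then c else
  let: (q, wr, mv) := tm_trans (c_state c) [ffun i => cur (c_tape c i)] in
  Config q (fun i => move_tape (mv i) (write_tape (wr i) (c_tape c i))).

(* The head of tape 0 is on the first input symbol; the other tapes are blank. *)
Definition init (w : seq bool) : config :=
  let s := [seq Some (inl b) : tm_symbol | b <- w] in
  Config (tm_start M) (fun i =>
    if i == ord0 then Tape [::] (head None s) (behead s)
    else Tape [::] None [::]).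

Definition state_at (w : seq bool) (t : nat) : tm_state M :=
  c_state (iter t step (init w)).

Definition decides_in_time (L : seq bool -> Prop) (T : nat -> nat) : Prop :=
  forall w, exists2 t, t <= T (size w) &
    (L w /\ state_at w t = tm_accept M) \/ (~ L w /\ state_at w t = tm_reject M).

End TMSemantics.

Definition in_2EXPTIME (L : seq bool -> Prop) : Prop :=
  exists (M : TM) (p : {poly nat}),
    decides_in_time M L (fun n => 2 ^ (2 ^ horner p n)).

(* Main.v *)
(** Suppose that every individual of K2 occurs in K1. Then K1 does not Σ-UCQ entail K2 iff
some model I of K1 and some k are such that no forest-shaped model of K2 maps into I up to
depth k, in the sense of k-round simulations that preserve the names in Σ, map individuals to
themselves and may restart anywhere in I along a role outside Σ. Given such I and k, a query
is the disjunction of all sets of Σ-atoms over the forest nodes of depth at most k that fail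
in I; conversely, if for every k there is a forest model that maps into I up to depth k, a
diagonal argument yields a forest model all of whose finite parts map into I, so that every
Σ-UCQ entailed by K2 holds in I.

The existence of (I, k) is the existence of a forest-shaped model of K1 whose nodes are
labelled by a type, and for each type t of K2 by a rank, the number of rounds after which the
simulation of t fails there, and by an existential restriction of t that makes it fail. Only
the order of the ranks matters, and they can be compressed below 2^(2^O(n)). This leaves
doubly exponentially many labels, and the labels that are realizable form a greatest fixpoint.

The criterion is a formula of first-order logic over the numbers below N = 2^(2^(10n+10)) with
an N-fold iteration operator, in which arithmetic on these numbers is definable by recursion.
Such a formula is evaluated in time polynomial in N. *)

Require Import Defs.
From mathcomp Require Import all_boot ssralg poly zify boolp.

Set Implicit Arguments.
Unset Strict Implicit.
Unset Printing Implicit Defensive.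

(** * While programs on Turing machines *)

(** A function from types to ranks, or an array of labels indexed by the names of the input, is a
    single number below N that is read digit by digit. With n the length of the input there are
    2^(2n) candidate types and ranks are kept below 2^(2^(6n+6)), so a rank function is a number
    below 2^(2^(8n+6)), and an array of n+1 of them still fits below N; this fixes the exponent
    10n+10, with some slack. Every object of the criterion is thus first-order, and the alternation
    between a labelling for K1 and all type assignments for K2 costs nothing extra, the formula
    being fixed.

    The obstacle is the compression of ranks. Infinitely many nodes share one scale, so sorting the
    ranks that occur gives no bound. Only two kinds of comparison have to survive: along the edges
    of the model and, because of restarts, with the rank at which a type has failed everywhere.
    Ranks of the second kind are finitely many and cut the scale into phases; inside a phase a node
    may be exchanged for the one that does best among those with the same finite description. *)

Definition sym : Type := option (bool + unit).
Definition mrk : sym := Some (inr tt).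
Definition sym1 : sym := Some (inl true).
Definition sym0 : sym := Some (inl false).

Inductive prog : Type :=
| Wr of nat & sym
| MvL of nat
| MvR of nat
| Seq of prog & prog
| If of nat & sym & prog & prog
| Until of nat & sym & prog.

(* Tape cells are numbered from 0; no tape is visited to the left of cell 0. *)
Record st : Type := St { ct : nat -> nat -> sym; hd : nat -> nat }.

Definition upd T (f : nat -> T) (i : nat) (x : T) : nat -> T :=
  fun j => if j == i then x else f j.

Definition cursym (s : st) (i : nat) : sym := ct s i (hd s i).
Arguments cursym : simpl never.

(** Costs equal the number of compiled instructions executed: the first branch of an [If] ends with
    a jump over the second, and each round of [Until] pays for its test and for the jump back. A
    left move from cell 0 has no execution. *)
Inductive exec : prog -> st -> nat -> st -> Prop :=
| EWr i a s :
    exec (Wr i a) s 1 (St (upd (ct s) i (upd (ct s i) (hd s i) a)) (hd s))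
| EMvL i s h : hd s i = h.+1 -> exec (MvL i) s 1 (St (ct s) (upd (hd s) i h))
| EMvR i s : exec (MvR i) s 1 (St (ct s) (upd (hd s) i (hd s i).+1))
| ESeq p q s1 s2 s3 m n :
    exec p s1 m s2 -> exec q s2 n s3 -> exec (Seq p q) s1 (m + n) s3
| EIfT i a p q s s' n :
    cursym s i = a -> exec p s n s' -> exec (If i a p q) s n.+2 s'
| EIfF i a p q s s' n :
    cursym s i <> a -> exec q s n s' -> exec (If i a p q) s n.+1 s'
| EUntilT i a p s : cursym s i = a -> exec (Until i a p) s 1 s
| EUntilF i a p s1 s2 s3 m n :
    cursym s1 i <> a -> exec p s1 m s2 -> exec (Until i a p) s2 n s3 ->
    exec (Until i a p) s1 (m.+2 + n) s3.

Inductive instr : Type :=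
| IWr of nat & sym
| IMv of nat & direction
| IBr of nat & sym & nat & nat.

Definition IGoto (pc : nat) : instr := IBr 0 None pc pc.

Fixpoint compile (p : prog) (pc : nat) : seq instr :=
  match p with
  | Wr i a => [:: IWr i a]
  | MvL i => [:: IMv i MoveLeft]
  | MvR i => [:: IMv i MoveRight]
  | Seq p1 p2 => let c := compile p1 pc in c ++ compile p2 (pc + size c)
  | If i a p1 p2 =>
      let c1 := compile p1 pc.+1 in
      let pc2 := (pc + size c1).+2 in
      let c2 := compile p2 pc2 in
      IBr i a pc.+1 pc2 :: c1 ++ IGoto (pc2 + size c2) :: c2
  | Until i a p1 =>
      let c1 := compile p1 pc.+1 in
      IBr i a (pc + size c1).+2 pc.+1 :: c1 ++ [:: IGoto pc]
  end.

Fixpoint tapes_le (K : nat) (p : prog) : bool :=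
  match p with
  | Wr i _ | MvL i | MvR i => i <= K
  | Seq p q => tapes_le K p && tapes_le K q
  | If i _ p q => [&& i <= K, tapes_le K p & tapes_le K q]
  | Until i _ p => (i <= K) && tapes_le K p
  end.

(** * Compilation to a multitape Turing machine *)

Section Machine.

Variables (code : seq instr) (K flag : nat).

Let state : finType := 'I_(size code).+3.
Let symf : finType := option (bool + unit).

(** State [size code] is the exit of the program: there the machine reads the flag tape and enters
    one of the two following states, accepting or rejecting. *)
Definition mtrans (q : state) (f : {ffun 'I_K.+1 -> symf}) :
    state * {ffun 'I_K.+1 -> symf} * ('I_K.+1 -> direction) :=
  if (q < size code)%N then
    match nth (IGoto 0) code q with
    | IWr i a => (inord q.+1, [ffun j : 'I_K.+1 => if j == i :> nat then a else f j],
                  fun=> Stay)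
    | IMv i d => (inord q.+1, f, fun j : 'I_K.+1 => if j == i :> nat then d else Stay)
    | IBr i a pc1 pc2 => (inord (if f (inord i) == a then pc1 else pc2), f, fun=> Stay)
    end
  else
    (inord (if f (inord flag) == sym1 then (size code).+1 else (size code).+2),
     f, fun=> Stay).

Lemma macc_neq_mrej :
  inord (size code).+1 != inord (size code).+2 :> state.
Proof. by rewrite -val_eqE /= !inordK // neq_ltn ltnSn. Qed.

Definition machine : TM :=
  @MkTM state unit K ord0 (inord (size code).+1) (inord (size code).+2)
        mtrans macc_neq_mrej.

Definition tape_rep (t : tape machine) (f : nat -> sym) (h : nat) : Prop :=
  [/\ forall i, i < h -> nth None (left t) i = f (h - i.+1),
      cur t = f h
    & forall i, nth None (right t) i = f (h + i.+1)].

Definition conf_rep (c : config machine) (pc : nat) (s : st) : Prop :=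
  c_state c = pc :> nat /\
  forall i : 'I_K.+1, tape_rep (c_tape c i) (ct s i) (hd s i).

Lemma tape_rep_write t f h a :
  tape_rep t f h -> tape_rep (write_tape a t) (upd f h a) h.
Proof.
case=> Hl Hc Hr; split=> [i lt_ih||i] /=.
- by rewrite Hl // /upd; case: eqP => // E; lia.
- by rewrite /upd eqxx.
- by rewrite Hr /upd; case: eqP => // E; lia.
Qed.

Lemma tape_rep_id t f h : tape_rep t f h -> tape_rep (write_tape (cur t) t) f h.
Proof. by case: t. Qed.

Lemma tape_rep_right t f h : tape_rep t f h -> tape_rep (move_tape MoveRight t) f h.+1.
Proof.
case=> Hl Hc Hr; split=> [[|i] lt_ih||i] /=.
- by rewrite subn1.
- by rewrite Hl ?subSS.
- by rewrite -nth0 Hr addn1.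
- by rewrite nth_behead Hr; congr f; lia.
Qed.

Lemma tape_rep_left t f h : tape_rep t f h.+1 -> tape_rep (move_tape MoveLeft t) f h.
Proof.
case=> Hl Hc Hr; split=> [i lt_ih||[|i]] /=.
- by rewrite nth_behead Hl //; congr f; lia.
- by rewrite -nth0 Hl // subn1.
- by rewrite Hc addn1.
- by rewrite Hr; congr f; lia.
Qed.

Lemma step_running (c : config machine) : c_state c < size code ->
  step c = let: (q, wr, mv) :=
      (mtrans (c_state c) [ffun i => cur (c_tape c i)] :
        tm_state machine * {ffun 'I_K.+1 -> tm_symbol machine} * _) in
    Config q (fun i => move_tape (mv i) (write_tape (wr i) (c_tape c i))).
Proof.
move=> lt_c; rewrite /step; case: ifP => //.
by rewrite !inE /= -!val_eqE /= !inordK //; lia.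
Qed.

Lemma step_instr c pc s ins : conf_rep c pc s -> pc < size code ->
  nth (IGoto 0) code pc = ins ->
  match ins with
  | IWr i a => i <= K ->
      conf_rep (step c) pc.+1 (St (upd (ct s) i (upd (ct s i) (hd s i) a)) (hd s))
  | IMv i MoveRight => i <= K ->
      conf_rep (step c) pc.+1 (St (ct s) (upd (hd s) i (hd s i).+1))
  | IMv i MoveLeft => i <= K -> forall h, hd s i = h.+1 ->
      conf_rep (step c) pc.+1 (St (ct s) (upd (hd s) i h))
  | IMv i Stay => True
  | IBr i a pc1 pc2 => i <= K -> pc1 <= size code -> pc2 <= size code ->
      conf_rep (step c) (if cursym s i == a then pc1 else pc2) s
  end.
Proof.
move=> [Hpc Ht] lt_pc Hins; rewrite step_running ?Hpc // /mtrans.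
rewrite Hpc lt_pc Hins; case: ins Hins => [i a|i d|i a pc1 pc2] Hins.
- move=> le_i; split=> [|j] /=; first by rewrite inordK //; lia.
  rewrite !ffunE /upd; case: (eqVneq (j : nat) i) => [<-|ne].
    exact: tape_rep_write.
  exact: tape_rep_id.
- case: d {Hins} => // le_i.
    move=> h Hh; split=> [|j] /=; first by rewrite inordK //; lia.
    rewrite !ffunE /upd; case: (eqVneq (j : nat) i) => [E|ne]; last exact: tape_rep_id.
    by apply: tape_rep_left; apply: tape_rep_id; rewrite -Hh -E.
  split=> [|j] /=; first by rewrite inordK //; lia.
  rewrite !ffunE /upd; case: (eqVneq (j : nat) i) => [E|ne]; last exact: tape_rep_id.
  by apply: tape_rep_right; apply: tape_rep_id; rewrite -E.
- move=> le_i le1 le2; split=> [|j] /=; last by rewrite ffunE; exact: tape_rep_id.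
  rewrite ffunE; case: (Ht (inord i)) => _ -> _.
  have -> : (inord i : 'I_K.+1) = i :> nat by rewrite inordK.
  by rewrite inordK //; case: ifP; lia.
Qed.

Definition code_at (pc : nat) (c : seq instr) : Prop :=
  pc + size c <= size code /\
  forall k, k < size c -> nth (IGoto 0) code (pc + k) = nth (IGoto 0) c k.

Lemma code_at_cat pc c1 c2 :
  code_at pc (c1 ++ c2) -> code_at pc c1 /\ code_at (pc + size c1) c2.
Proof.
rewrite /code_at size_cat => -[le_sz H]; split; split=> [|k lt_k]; try lia.
- by rewrite H ?nth_cat ?lt_k //; lia.
- rewrite -addnA H ?nth_cat; last lia.
  by rewrite ltnNge leq_addr /= addKn.
Qed.

Lemma code_at_cons pc ins c :
  code_at pc (ins :: c) ->
  [/\ pc < size code, nth (IGoto 0) code pc = ins & code_at pc.+1 c].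
Proof.
rewrite -cat1s => /code_at_cat /= [[le_sz H] Hc]; rewrite addn1 in Hc le_sz.
by split=> //; rewrite -[pc]addn0 H.
Qed.

Lemma compile_correct p s n s' : exec p s n s' -> tapes_le K p ->
  forall pc c, code_at pc (compile p pc) -> conf_rep c pc s ->
  conf_rep (iter n (@step machine) c) (pc + size (compile p pc)) s'.
Proof.
elim=> {p s n s'}.
- move=> i a s le_i pc c /code_at_cons[lt_pc Hn _] Hr /=; rewrite addn1.
  exact: (step_instr Hr lt_pc Hn).
- move=> i s h Hh le_i pc c /code_at_cons[lt_pc Hn _] Hr /=; rewrite addn1.
  exact: (step_instr Hr lt_pc Hn).
- move=> i s le_i pc c /code_at_cons[lt_pc Hn _] Hr /=; rewrite addn1.
  exact: (step_instr Hr lt_pc Hn).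
- move=> p q s1 s2 s3 m n _ IHp _ IHq /= /andP[wp wq] pc c.
  move=> /code_at_cat[Hp Hq] Hr; rewrite addnC iterD size_cat addnA.
  exact: IHq wq _ _ Hq (IHp wp _ _ Hp Hr).
- move=> i a p q s s' n Hcur _ IHp /= /and3P[le_i wp wq] pc c.
  move=> Hc Hr; have Hle := proj1 Hc; rewrite /= size_cat /= in Hle.
  have [lt_pc Hn /code_at_cat[Hp /code_at_cons[lt2 Hn2 _]]] := code_at_cons Hc.
  have Hr1 := step_instr Hr lt_pc Hn le_i _ _.
  rewrite Hcur eqxx in Hr1; have {}Hr1 := Hr1 ltac:(lia) ltac:(lia).
  have Hr2 := IHp wp _ _ Hp Hr1; rewrite -iterSr in Hr2.
  have := step_instr Hr2 lt2 Hn2 (leq0n K) ltac:(lia) ltac:(lia).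
  rewrite if_same -iterS; congr conf_rep; rewrite size_cat /=; lia.
- move=> i a p q s s' n Hcur _ IHq /= /and3P[le_i wp wq] pc c.
  move=> Hc Hr; have Hle := proj1 Hc; rewrite /= size_cat /= in Hle.
  have [lt_pc Hn /code_at_cat[_ /code_at_cons[_ _ Hq]]] := code_at_cons Hc.
  have Hr1 := step_instr Hr lt_pc Hn le_i _ _.
  rewrite (introF eqP Hcur) in Hr1; have {}Hr1 := Hr1 ltac:(lia) ltac:(lia).
  rewrite addSn in Hq; have := IHq wq _ _ Hq Hr1.
  rewrite -iterSr; congr conf_rep; rewrite size_cat /=; lia.
- move=> i a p s Hcur /= /andP[le_i wp] pc c Hc Hr.
  have Hle := proj1 Hc; rewrite /= size_cat /= in Hle.
  have [lt_pc Hn _] := code_at_cons Hc.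
  have := step_instr Hr lt_pc Hn le_i ltac:(lia) ltac:(lia).
  rewrite Hcur eqxx; congr conf_rep; rewrite size_cat /=; lia.
- move=> i a p s1 s2 s3 m n Hcur _ IHp _ IHw /[dup] w /= /andP[le_i wp] pc c.
  move=> Hc Hr; have Hle := proj1 Hc; rewrite /= size_cat /= in Hle.
  have [lt_pc Hn /code_at_cat[Hp /code_at_cons[lt2 Hn2 _]]] := code_at_cons Hc.
  have Hr1 := step_instr Hr lt_pc Hn le_i _ _.
  rewrite (introF eqP Hcur) in Hr1; have {}Hr1 := Hr1 ltac:(lia) ltac:(lia).
  have Hr2 := IHp wp _ _ Hp Hr1; rewrite -iterSr in Hr2.
  have := step_instr Hr2 lt2 Hn2 (leq0n K) ltac:(lia) ltac:(lia).
  rewrite if_same -iterS => Hr3; have := IHw w _ _ Hc Hr3.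
  by rewrite -iterD addnC.
Qed.

End Machine.

Definition inp (w : seq bool) (j : nat) : sym :=
  nth None [seq Some (inl b) : sym | b <- w] j.

(** On tape 0 the head starts on cell 1, the first input symbol, which leaves the blank cell 0 free
    for the mark at the left end. *)
Definition starts_on (K : nat) (w : seq bool) (s : st) : Prop :=
  forall i, i <= K ->
    (forall j, ct s i j = if (i == 0) && (0 < j) then inp w j.-1 else None) /\
    hd s i = (i == 0).

Lemma machine_decides (p : prog) (K flag : nat) (L : seq bool -> Prop) (T : nat -> nat) :
  tapes_le K p -> flag <= K ->
  (forall w, exists s0 n s, [/\ starts_on K w s0, exec p s0 n s, n < T (size w)
                               & cursym s flag = sym1 <-> L w]) ->
  decides_in_time (machine (compile p 0) K flag) L T.
Proof.
move=> wp le_flag H w; have [s0 [n [s [H0 He lt_n HL]]]] := H w.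
set M := machine _ _ _.
have Hr0 : conf_rep (init M w) 0 s0.
  split=> // i; have [Hc0 Hh0] := H0 i (ltn_ord i); rewrite Hh0 /tape_rep !Hc0.
  rewrite [c_tape _ _]/= -val_eqE /=; case: ((i : nat) == 0) Hc0 => /= Hc0.
    by split=> [[|[]] //||j] /=; rewrite ?Hc0 /= /inp ?nth_behead.
  by split=> [j||j] //=; rewrite ?Hc0 ?nth_nil.
have Hc : code_at (compile p 0) 0 (compile p 0) by [].
have [Hs Ht] := compile_correct He wp Hc Hr0.
exists n.+1 => //.
have Hfin : state_at M w n.+1 =
    inord (if cursym s flag == sym1 then (size (compile p 0)).+1
           else (size (compile p 0)).+2) :> tm_state M.
  rewrite /state_at iterS; set c := iter n _ _ in Hs Ht *.
  rewrite /step; case: ifP => [|_].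
    by rewrite !inE /= -!val_eqE /= !inordK // Hs add0n; lia.
  rewrite /= /mtrans Hs add0n ltnn /= ffunE.
  case: (Ht (inord flag)) => _ -> _.
  have -> : (inord flag : 'I_K.+1) = flag :> nat by rewrite inordK.
  by [].
rewrite Hfin; case: eqP => E; first by left; split=> //; apply/HL.
by right; split=> // /HL.
Qed.

(** * A program logic with time bounds *)

Definition wp (p : prog) (c : nat) (Q : st -> Prop) (s : st) : Prop :=
  exists n s', [/\ exec p s n s', n <= c & Q s'].

Lemma wp_mono p c c' (Q Q' : st -> Prop) s :
  wp p c Q s -> c <= c' -> (forall s', Q s' -> Q' s') -> wp p c' Q' s.
Proof. by move=> [n [s' [He le_n HQ]]] le_c HQQ; exists n, s'; split; [|lia|exact: HQQ]. Qed.

Lemma wp_cost p c c' (Q : st -> Prop) s : wp p c Q s -> c <= c' -> wp p c' Q s.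
Proof. by move=> H le_c; apply: wp_mono H le_c _. Qed.

Lemma wp_wr i a (Q : st -> Prop) s :
  Q (St (upd (ct s) i (upd (ct s i) (hd s i) a)) (hd s)) -> wp (Wr i a) 1 Q s.
Proof. by move=> HQ; do 2!eexists; split; [exact: EWr|..]. Qed.

Lemma wp_mvl i (Q : st -> Prop) s : 0 < hd s i ->
  Q (St (ct s) (upd (hd s) i (hd s i).-1)) -> wp (MvL i) 1 Q s.
Proof.
by move=> h_gt0 HQ; do 2!eexists; split; [apply: EMvL; exact: esym (prednK h_gt0)|..].
Qed.

Lemma wp_mvr i (Q : st -> Prop) s :
  Q (St (ct s) (upd (hd s) i (hd s i).+1)) -> wp (MvR i) 1 Q s.
Proof. by move=> HQ; do 2!eexists; split; [exact: EMvR|..]. Qed.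

Lemma wp_seq p q c1 c2 Q s : wp p c1 (wp q c2 Q) s -> wp (Seq p q) (c1 + c2) Q s.
Proof.
move=> [n [s' [He le_n [m [s'' [He' le_m HQ]]]]]]; exists (n + m), s''.
by split=> //; [exact: ESeq He He'|lia].
Qed.

Lemma wp_if i a p q c Q s :
  (cursym s i = a -> wp p c Q s) -> (cursym s i <> a -> wp q c Q s) ->
  wp (If i a p q) (c + 2) Q s.
Proof.
move=> H1 H2; case: (cursym s i =P a) => E.
  have [n [s' [He le_n HQ]]] := H1 E; exists n.+2, s'; split=> //; [exact: EIfT|lia].
have [n [s' [He le_n HQ]]] := H2 E; exists n.+1, s'; split=> //; [exact: EIfF|lia].
Qed.

(** The variant [k] may drop by more than one, which covers loops that are left early. *)
Lemma wp_until i a p c (I : nat -> st -> Prop) (Q : st -> Prop) k s :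
  I k s ->
  (forall k s, I k s -> cursym s i = a -> Q s) ->
  (forall k s, I k s -> cursym s i <> a ->
     wp p c (fun s' => exists2 k', k' < k & I k' s') s) ->
  wp (Until i a p) (k * (c + 2) + 1) Q s.
Proof.
move=> Ik HQ Hb; have [m le_km] := ubnP k; elim: m k le_km s Ik => // m IH k le_km s Ik.
case: (cursym s i =P a) => E.
  by exists 1, s; split; [exact: EUntilT|lia|exact: HQ Ik E].
have [n [s' [He le_n [k' lt_k' Ik']]]] := Hb _ _ Ik E.
have [n' [s'' [He' le_n' HQ'']]] := IH k' ltac:(lia) s' Ik'.
exists (n.+2 + n'), s''; split=> //; [exact: EUntilF E He He'|nia].
Qed.

(** * Iterated first-order logic and its evaluation *)

Definition rel3 : Type := nat -> nat -> nat -> Prop.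

Definition scons (a : nat) (e : nat -> nat) : nat -> nat :=
  fun i => if i is j.+1 then e j else a.

Inductive form : Type :=
| FLt of nat & nat
| FInp of bool & nat
| FRel of nat & nat & nat
| FNot of form
| FAnd of form & form
| FEx of form
| FIter of form & nat & nat & nat.

Definition iter3 (N : nat) (F : rel3 -> rel3) : rel3 := iter N F (fun _ _ _ => False).

(* First-order logic over [0, N), with the [N]-fold iteration of a definable operator on
   ternary relations; [R] interprets the relation symbol bound by the innermost [FIter]. *)
Fixpoint holds (w : seq bool) (N : nat) (phi : form) (R : rel3) (e : nat -> nat) : Prop :=
  match phi with
  | FLt i j => e i < e j
  | FInp b i => inp w (e i) = Some (inl b)
  | FRel i j k => R (e i) (e j) (e k)
  | FNot phi => ~ holds w N phi R e
  | FAnd phi psi => holds w N phi R e /\ holds w N psi R e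
  | FEx phi => exists2 a, a < N & holds w N phi R (scons a e)
  | FIter phi i j k =>
      iter3 N (fun R x y z => holds w N phi R (scons x (scons y (scons z e))))
        (e i) (e j) (e k)
  end.

(* Tape 0 holds the input, [FL] a flag with the truth value of the formula last evaluated,
   [SC], [C1] and [C2] serve for copying and comparing head positions. The tapes [vt l] and
   [nt l] are rulers of length [N]: the [l]-th bound variable has value [a] when the head of
   [vt l] is on cell [a.+1], and [nt l] counts the rounds of the [l]-th nested iteration, whose
   current and next relations are tabulated on [rt l] and [bt l]. *)
Notation FL := 1 (only parsing).
Notation SC := 2 (only parsing).
Notation C1 := 3 (only parsing).
Notation C2 := 4 (only parsing).
Definition vt l := 4 * l + 5.
Definition rt l := 4 * l + 6.
Definition bt l := 4 * l + 7.
Definition nt l := 4 * l + 8.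

Definition RESET i := Until i mrk (MvL i).
(** A number is held by a head position. The head of [x] runs down to the mark while [SC] counts;
    then [SC] runs down, bringing [x] back and [a] to the same cell. *)
Definition COPY a x :=
  Seq (RESET SC) (Seq (RESET a)
    (Seq (Until x mrk (Seq (MvL x) (MvR SC)))
         (Until SC mrk (Seq (MvL SC) (Seq (MvR x) (MvR a)))))).
(** Both copies are run down together; the flag is raised once [C1] is exhausted while [C2] is
    not. *)
Definition LT x y :=
  Seq (COPY C1 x) (Seq (COPY C2 y) (Seq (Wr FL sym0)
    (Until C2 mrk (Seq (If C1 mrk (Wr FL sym1) (MvL C1)) (MvL C2))))).
Definition SETF i a := If i a (Wr FL sym1) (Wr FL sym0).
Definition INP b x :=
  Seq (COPY C1 x) (Seq (RESET 0) (Seq (Until C1 mrk (Seq (MvL C1) (MvR 0)))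
    (SETF 0 (Some (inl b))))).
(** The initial left move turns the cell number [a.+1] of a value into [a] rounds. *)
Definition TIMES x P := Seq (COPY C1 x) (Seq (MvL C1) (Until C1 mrk (Seq P (MvL C1)))).
Definition FOR x P := Seq (RESET x) (Seq (MvR x) (Until x None (Seq P (MvR x)))).
(** Entry (x, y, z) of a table is in cell (xN + y)N + z + 1. The head of [T] gets there by unary
    counting, with the rulers [vt d] and [vt d.+1], not yet bound, as loop counters for N and
    N^2. *)
Definition READ T x y z d :=
  Seq (RESET T) (Seq (TIMES x (FOR (vt d.+1) (FOR (vt d) (MvR T))))
    (Seq (TIMES y (FOR (vt d) (MvR T))) (Seq (TIMES z (MvR T))
      (Seq (MvR T) (SETF T sym1))))).
Definition SWEEP d P := FOR (vt d.+2) (FOR (vt d.+1) (FOR (vt d) P)).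

(** [d] variables are bound and [rd] iterations are open; the variable with de Bruijn index [i]
    lives on ruler [d - i.+1]. A true instance of an [FEx] sends the head to the end of its ruler,
    which leaves the loop with the flag up. In an [FIter] the next relation gets a table of its own,
    since the body still reads the current one. *)
Fixpoint evalp (phi : form) (d rd : nat) : prog :=
  let v i := vt (d - i.+1) in
  match phi with
  | FLt i j => LT (v i) (v j)
  | FInp b i => INP b (v i)
  | FRel i j k => READ (rt rd.-1) (v i) (v j) (v k) d
  | FNot phi => Seq (evalp phi d rd) (If FL sym1 (Wr FL sym0) (Wr FL sym1))
  | FAnd phi psi => Seq (evalp phi d rd) (If FL sym1 (evalp psi d rd) (Wr FL sym0))
  | FEx phi =>
      Seq (Wr FL sym0) (Seq (RESET (vt d)) (Seq (MvR (vt d))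
        (Until (vt d) None (Seq (evalp phi d.+1 rd)
          (If FL sym1 (Until (vt d) None (MvR (vt d))) (MvR (vt d)))))))
  | FIter phi i j k =>
      Seq (Seq (RESET (rt rd)) (SWEEP d (Seq (MvR (rt rd)) (Wr (rt rd) sym0))))
     (Seq (FOR (nt rd)
        (Seq (Seq (RESET (bt rd)) (SWEEP d (Seq (evalp phi d.+3 rd.+1)
               (Seq (MvR (bt rd)) (If FL sym1 (Wr (bt rd) sym1) (Wr (bt rd) sym0))))))
        (Seq (RESET (rt rd)) (Seq (RESET (bt rd))
          (SWEEP d (Seq (MvR (rt rd)) (Seq (MvR (bt rd))
            (If (bt rd) sym1 (Wr (rt rd) sym1) (Wr (rt rd) sym0)))))))))
     (READ (rt rd) (v i) (v j) (v k) d))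
  end.

(** Number of rulers needed on top of the bound ones; a table access borrows two. *)
Fixpoint depth (phi : form) : nat :=
  match phi with
  | FLt _ _ | FInp _ _ => 0
  | FRel _ _ _ => 2
  | FNot phi => depth phi
  | FAnd phi psi => maxn (depth phi) (depth psi)
  | FEx phi => (depth phi).+1
  | FIter phi _ _ _ => (depth phi).+3
  end.

(** [b] records whether a relation symbol is in scope. *)
Fixpoint wff (phi : form) (d : nat) (b : bool) : bool :=
  match phi with
  | FLt i j => (i < d) && (j < d)
  | FInp _ i => i < d
  | FRel i j k => [&& b, i < d, j < d & k < d]
  | FNot phi => wff phi d b
  | FAnd phi psi => wff phi d b && wff psi d b
  | FEx phi => wff phi d.+1 b
  | FIter phi i j k => [&& i < d, j < d, k < d & wff phi d.+3 true]
  end.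

Section Evaluation.

Variables (w : seq bool) (N B M : nat).
Hypotheses (N_gt0 : 0 < N) (B_ge : N ^ 3 + 2 <= B).

Lemma N_lt_B : N.+1 < B.
Proof. by move: B_ge; rewrite !expnS expn0; nia. Qed.

(** Heads on which enclosing loops depend: bound variables, round counters, and the writing
    positions in the tables under construction. The heads of the tables [rt] are left out, because
    every access moves them. *)
Definition phd d rd i : Prop :=
  exists l, (l < d /\ i = vt l) \/ (l < rd /\ (i = bt l \/ i = nt l)).
Definition uct rd i : Prop := i = FL \/ exists2 l, rd <= l & i = rt l \/ i = bt l.

Definition frame d rd (s s' : st) : Prop :=
  (forall i, phd d rd i -> hd s' i = hd s i) /\
  (forall i, ~ uct rd i -> ct s' i = ct s i).

(** The bound on all heads makes the cost of a [RESET] uniform, and keeping the flag's head on cell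
    1 keeps the flag clear of the mark. *)
Record gwf (s : st) : Prop := Gwf {
  g_mrk : forall i j, (ct s i j == mrk) = (j == 0);
  g_inp : forall j, ct s 0 j.+1 = inp w j;
  g_rul : forall l i, l < M -> i = vt l \/ i = nt l ->
    forall j, j <= N -> (ct s i j.+1 == None) = (j == N);
  g_bnd : forall i, hd s i <= B;
  g_fl : hd s FL = 1
}.

Lemma frame_refl d rd s : frame d rd s s. Proof. by []. Qed.

Lemma frame_trans d rd s1 s2 s3 :
  frame d rd s1 s2 -> frame d rd s2 s3 -> frame d rd s1 s3.
Proof.
move=> [H1 C1] [H2 C2]; split=> i Hi; first by rewrite H2 // H1.
by rewrite C2 // C1.
Qed.

Lemma frame_le d rd d' rd' s s' :
  d <= d' -> rd <= rd' -> frame d' rd' s s' -> frame d rd s s'.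
Proof.
move=> le_d le_r [H C]; split=> i Hi; [apply: H|apply: C].
  by case: Hi => l Hl; exists l; lia.
by move=> Hu; apply: Hi; case: Hu => [|[l Hl Hi]]; [left|right; exists l => //; lia].
Qed.

Lemma gwf_hd s h : gwf s -> h FL = 1 -> (forall i, h i <= B) -> gwf (St (ct s) h).
Proof. by case=> *; split. Qed.

Lemma gwf_wr s i v : gwf s -> v != mrk -> uct 0 i -> 0 < hd s i ->
  gwf (St (upd (ct s) i (upd (ct s i) (hd s i) v)) (hd s)).
Proof.
move=> [Hm Hi Hr Hb Hf] nv Hu h_gt0; split=> //= [i' j|j|l i' lt_l Hi' j le_j].
- rewrite /upd; case: (i' =P i) => [_|_]; last exact: Hm.
  by case: (j =P hd s i) => [->|_]; [rewrite (negbTE nv); lia|exact: Hm].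
- by rewrite /upd; case: (0 =P i) => // E; move: Hu; rewrite -E /uct /rt /bt; case=> [|[l]]; lia.
- rewrite /upd; case: (i' =P i) => [E|_]; last exact: Hr lt_l Hi' _ le_j.
  by move: Hu Hi'; rewrite E /uct /rt /bt /vt /nt; case=> [|[l' _]]; lia.
Qed.

Ltac upds := rewrite /upd; repeat (case: eqP => ?); first [done | congruence | lia].

Lemma st_eq s c h : ct s = c -> hd s =1 h -> s = St c h.
Proof. by case: s => c' h' /= -> /funext ->. Qed.

Definition small (s s' : st) : Prop :=
  (forall i, 4 < i -> hd s' i = hd s i) /\ (forall i, i <> FL -> ct s' i = ct s i).

Lemma small_frame d rd s s' : small s s' -> frame d rd s s'.
Proof.
case=> H C; split=> i Hi; [apply: H|apply: C].
  by case: Hi => l; rewrite /vt /bt /nt; lia.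
by move=> E; apply: Hi; left.
Qed.

Lemma cur_mrk s i : gwf s -> cursym s i = mrk <-> hd s i = 0.
Proof.
move=> g; rewrite /cursym; split=> [/eqP|/eqP E]; first by rewrite g_mrk // => /eqP.
by apply/eqP; rewrite g_mrk.
Qed.

Lemma wp_reset i s (Q : st -> Prop) : gwf s -> i != FL ->
  Q (St (ct s) (upd (hd s) i 0)) -> wp (RESET i) (3 * B + 1) Q s.
Proof.
move=> g ni HQ.
pose I k s' := k <= hd s i /\ s' = St (ct s) (upd (hd s) i k).
have gI k s' : I k s' -> gwf s' /\ hd s' i = k.
  move=> [le_k ->]; rewrite /= /upd eqxx; split=> //; apply: gwf_hd => //=.
    by rewrite eq_sym (negbTE ni) (g_fl g).
  by move=> j; case: eqP; have := g_bnd g j; have := g_bnd g i; lia.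
apply: (wp_mono (wp_until (c := 1) (I := I) (Q := Q) (k := hd s i) _ _ _)) => //.
- split=> //; apply: st_eq => // j; rewrite /upd; case: eqP => // ->; lia.
- move=> k s' Ik /(cur_mrk i (proj1 (gI _ _ Ik))) E.
  have [_ E'] := gI _ _ Ik; have k0 : k = 0 by lia.
  by case: Ik => _ ->; rewrite k0.
- move=> k s' Ik nm; have [g' E] := gI _ _ Ik.
  have k_gt0 : 0 < k by rewrite lt0n; apply/eqP => k0; apply/nm/cur_mrk => //; lia.
  apply: wp_mvl; first lia.
  exists k.-1; first lia.
  case: Ik => le_k E'; split; first lia.
  by rewrite E' /=; apply: st_eq => //= j; rewrite /upd eqxx; case: eqP.
- by have := g_bnd g i; lia.
Qed.

Definition cCOPY := 15 * B + 4.

Lemma wp_copy (a x : nat) s (Q : st -> Prop) : gwf s ->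
  [&& a != x, a != SC, a != FL, x != SC & x != FL] ->
  Q (St (ct s) (upd (upd (hd s) SC 0) a (hd s x))) -> wp (COPY a x) cCOPY Q s.
Proof.
move=> g /and5P[nax nas naf nxs nxf] HQ; have nsf : SC != FL by [].
have [X EX] : exists X, X = hd s x by exists (hd s x).
have le_XB : X <= B by rewrite EX; exact: g_bnd.
rewrite -EX in HQ.
pose h1 k := upd (upd (upd (hd s) a 0) x k) SC (X - k).
pose h2 k := upd (upd (upd (hd s) a (X - k)) x (X - k)) SC k.
have gh h : (forall i, i \notin [:: a; x; SC] -> h i = hd s i) ->
    (forall i, i \in [:: a; x; SC] -> h i <= B) -> gwf (St (ct s) h).
  move=> H1 H2; apply: gwf_hd => //.
    by rewrite H1 ?(g_fl g) // !inE !negb_or eq_sym naf eq_sym nxf eq_sym nsf.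
  move=> i; case Hi: (i \in [:: a; x; SC]); first exact: H2.
  by rewrite H1 ?Hi //; exact: g_bnd.
have nin i (h : nat -> nat) : i \notin [:: a; x; SC] -> forall p q r,
    upd (upd (upd h a p) x q) SC r i = h i.
  by rewrite !inE !negb_or /upd => /and3P[/negbTE-> /negbTE-> /negbTE->].
have vals (h : nat -> nat) p q r : [/\ upd (upd (upd h a p) x q) SC r a = p,
    upd (upd (upd h a p) x q) SC r x = q & upd (upd (upd h a p) x q) SC r SC = r].
  by rewrite /upd !eqxx (negbTE nax) (negbTE nas) (negbTE nxs).
have g1 k : k <= X -> gwf (St (ct s) (h1 k)).
  move=> le_k; apply: gh => i Hi; first exact: nin.
  have [A1 A2 A3] := vals (hd s) 0 k (X - k); move: Hi; rewrite !inE /h1.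
  by case/or3P=> /eqP->; rewrite ?A1 ?A2 ?A3; lia.
have g2 k : k <= X -> gwf (St (ct s) (h2 k)).
  move=> le_k; apply: gh => i Hi; first exact: nin.
  have [A1 A2 A3] := vals (hd s) (X - k) (X - k) k; move: Hi; rewrite !inE /h2.
  by case/or3P=> /eqP->; rewrite ?A1 ?A2 ?A3; lia.
apply: (wp_cost (c := (3 * B + 1) + ((3 * B + 1) + ((B * (2 + 2) + 1) + (B * (3 + 2) + 1)))));
  last by rewrite /cCOPY; lia.
apply: wp_seq; apply: wp_reset => //; apply: wp_seq; apply: wp_reset => //.
  apply: gwf_hd => //= [|i]; rewrite /upd; last by case: eqP => // _; exact: g_bnd.
  by rewrite (g_fl g).
set s0 := St _ _; apply: wp_seq.
have -> : s0 = St (ct s) (h1 X).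
  apply: st_eq => //= j; rewrite /s0 /h1 /= subnn.
  by upds.
apply: (wp_cost (c := X * (2 + 2) + 1)); last lia.
apply: (wp_until (c := 1 + 1) (I := fun k s' => k <= X /\ s' = St (ct s) (h1 k))) => //.
  move=> k s' [le_k Es] Hc; subst s'.
  have {}Hc : k = 0.
    by move/(cur_mrk x (g1 _ le_k)): Hc; case: (vals (hd s) 0 k (X - k)) => _; rewrite /h1 /= => ->.
  subst k; apply: (wp_cost (c := X * (3 + 2) + 1)); last lia.
  apply: (wp_until (c := 1 + (1 + 1)) (I := fun k s' => k <= X /\ s' = St (ct s) (h2 k))).
  - by split=> //; congr St; rewrite /h1 /h2 subnn subn0.
  - move=> k s' [le_k' ->] Hc.
    have {}Hc : k = 0.
      by move/(cur_mrk SC (g2 _ le_k')): Hc; case: (vals (hd s) (X - k) (X - k) k) => _ _; rewrite /h2 /= => ->.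
    subst k; rewrite /h2 subn0.
    have -> : upd (upd (upd (hd s) a X) x X) SC 0 = upd (upd (hd s) SC 0) a X; last exact: HQ.
    by apply: funext => j; upds.
  - move=> k s' [le_k' ->] Hc; have [A1 A2 A3] := vals (hd s) (X - k) (X - k) k.
    have k_gt0 : 0 < k.
      by rewrite lt0n; apply/eqP => k0; apply/Hc/cur_mrk; [exact: g2|exact: etrans A3 k0].
    apply: wp_seq; apply: wp_mvl => /=; first by rewrite /h2 A3.
    apply: wp_seq; apply: wp_mvr => /=; apply: wp_mvr => /=.
    exists k.-1; first lia.
    split; first lia.
    by congr St; apply: funext => j; rewrite /h2; upds.
move=> k s' [le_k ->] Hc; have [A1 A2 A3] := vals (hd s) 0 k (X - k).
have k_gt0 : 0 < k.
  by rewrite lt0n; apply/eqP => k0; apply/Hc/cur_mrk; [exact: g1|exact: etrans A2 k0].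
apply: wp_seq; apply: wp_mvl => /=; first by rewrite /h1 A2.
apply: wp_mvr => /=.
exists k.-1; first lia.
split; first lia.
by congr St; apply: funext => j; rewrite /h1; upds.
Qed.

Lemma gwf_upd s i v : gwf s -> i != FL -> v <= B -> gwf (St (ct s) (upd (hd s) i v)).
Proof.
move=> g ni le_v; apply: gwf_hd => //= [|j]; rewrite /upd.
  by rewrite eq_sym (negbTE ni) (g_fl g).
by case: eqP => // _; exact: g_bnd.
Qed.

Lemma gwf_updc c h i v : gwf (St c h) -> i != FL -> v <= B -> gwf (St c (upd h i v)).
Proof. exact: (@gwf_upd (St c h)). Qed.

Lemma gwf_wrFL s v : gwf s -> v != mrk ->
  gwf (St (upd (ct s) FL (upd (ct s FL) (hd s FL) v)) (hd s)).
Proof. by move=> g nv; apply: gwf_wr => //; [left|rewrite (g_fl g)]. Qed.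

Lemma cur_upd c h i v : cursym (St (upd c i (upd (c i) (h i) v)) h) i = v.
Proof. by rewrite /cursym /upd /= !eqxx. Qed.

Lemma cur_hd c h i j v : i != j -> cursym (St c (upd h i v)) j = cursym (St c h) j.
Proof. by move=> nij; rewrite /cursym /upd /= eq_sym (negbTE nij). Qed.

Lemma small_refl s : small s s. Proof. by []. Qed.

Lemma small_hd s s1 i v : small s s1 -> i <= 4 -> small s (St (ct s1) (upd (hd s1) i v)).
Proof. by move=> [H C] le_i; split=> j Hj /=; [rewrite -H //; upds|exact: C]. Qed.

Lemma small_wr s s1 f : small s s1 -> small s (St (upd (ct s1) FL f) (hd s1)).
Proof. by move=> [H C]; split=> j Hj /=; [exact: H|rewrite -C //; upds]. Qed.

Definition cLT := 40 * B + 40.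

Lemma wp_LT x y s : gwf s -> 4 < x -> 4 < y ->
  wp (LT x y) cLT (fun s' => [/\ gwf s', small s s' &
    cursym s' FL = sym1 <-> hd s x < hd s y]) s.
Proof.
move=> g x_gt y_gt; have Bx := g_bnd g x; have By := g_bnd g y.
apply: (wp_cost (c := cCOPY + (cCOPY + (1 + (hd s y * (1 + 2 + 1 + 2) + 1)))));
  last by rewrite /cLT /cCOPY; lia.
apply: wp_seq; apply: wp_copy => //; first by lia.
have g1 : gwf (St (ct s) (upd (upd (hd s) SC 0) C1 (hd s x))).
  by apply: gwf_updc => //; apply: gwf_upd.
apply: wp_seq; apply: wp_copy => //; first by lia.
rewrite /=.
have -> : upd (upd (hd s) SC 0) C1 (hd s x) y = hd s y by upds.
apply: wp_seq; apply: wp_wr.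
set s2 := St _ _ in g1 *; set s3 := St (ct s2) _; set s4 := St _ _.
have g3 : gwf s3.
  by rewrite /s3; do 2 apply: gwf_updc => //.
pose I k s' := [/\ gwf s', small s s', hd s' C2 = k, hd s' C1 = hd s x - (hd s y - k) &
  k <= hd s y /\ (cursym s' FL = sym1 <-> hd s x < hd s y - k)].
apply: (wp_until (I := I)) => [||k s' [g' sm E2 E1 [le_k Hf]] nm].
- split=> //; first exact: gwf_wrFL.
  + by apply: small_wr; do 4 apply: (small_hd (s1 := St _ _)) => //; exact: small_refl.
  + by rewrite subnn subn0.
  + by rewrite subnn cur_upd.
- move=> k s' [g' sm E2 E1 [le_k Hf]] /(cur_mrk _ g') k0; split=> //.
  by rewrite Hf -E2 k0 subn0.
have k_gt0 : 0 < k by rewrite lt0n -E2; apply/eqP => k0; apply/nm/cur_mrk.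
apply: wp_seq; apply: wp_if => [Hc|nc].
  move/(cur_mrk _ g'): Hc => Hc; apply: wp_wr; apply: wp_mvl => /=; first lia.
  exists k.-1; first lia.
  split=> /=.
  + apply: gwf_updc => //; first exact: gwf_wrFL.
    by rewrite /= E2; lia.
  + by apply: (small_hd (s1 := St _ _)) => //; apply: small_wr.
  + by rewrite E2 /upd eqxx.
  + by rewrite /upd /=; lia.
  + split; first lia.
    by rewrite cur_hd // cur_upd; split=> // _; lia.
have {}nc : hd s' C1 <> 0 by move/(cur_mrk _ g').
apply: wp_mvl; first lia.
apply: wp_mvl => /=; first by rewrite /upd /=; lia.
exists k.-1; first lia.
split=> /=.
- apply: gwf_updc => //=; last by rewrite /upd /=; lia.
  by apply: gwf_upd => //; have := g_bnd g' C1; lia.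
- by do 2 apply: (small_hd (s1 := St _ _)) => //.
- by rewrite /upd /= E2.
- by rewrite /upd /=; lia.
- split; first lia.
  rewrite !cur_hd //; have -> : cursym (St (ct s') (hd s')) FL = cursym s' FL by [].
  by rewrite Hf; split; lia.
Qed.

Lemma wp_SETF i a s : gwf s ->
  wp (SETF i a) 3 (fun s' => [/\ gwf s', hd s' = hd s, forall j, j <> FL -> ct s' j = ct s j &
    cursym s' FL = sym1 <-> cursym s i = a]) s.
Proof.
move=> g; apply: (wp_cost (c := 1 + 2)) => //.
apply: wp_if => Hc; apply: wp_wr; split=> //; try exact: gwf_wrFL.
- by move=> j nj /=; upds.
- by rewrite cur_upd.
- by move=> j nj /=; upds.
- by rewrite cur_upd.
Qed.

Definition cINP := 30 * B + 40.

Lemma wp_INP b x s : gwf s -> 4 < x -> 0 < hd s x ->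
  wp (INP b x) cINP (fun s' => [/\ gwf s', small s s' &
    cursym s' FL = sym1 <-> inp w (hd s x).-1 = Some (inl b)]) s.
Proof.
move=> g x_gt hx; have Bx := g_bnd g x.
apply: (wp_cost (c := cCOPY + (3 * B + 1 + (hd s x * (1 + 1 + 2) + 1 + 3))));
  last by rewrite /cINP /cCOPY; lia.
apply: wp_seq; apply: wp_copy => //; first by lia.
have g1 : gwf (St (ct s) (upd (upd (hd s) SC 0) C1 (hd s x))).
  by apply: gwf_updc => //; apply: gwf_upd.
apply: wp_seq; apply: wp_reset => //; apply: wp_seq => /=.
pose I k s' := [/\ gwf s', small s s', ct s' = ct s, hd s' C1 = k &
  k <= hd s x /\ hd s' 0 = hd s x - k].
apply: (wp_until (I := I)) => [||k s' [g' sm Ec E1 [le_k E0]] nm].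
- split=> //=; first by apply: gwf_updc.
  + by do 3 apply: (small_hd (s1 := St _ _)) => //; exact: small_refl.
  + by split=> //; rewrite /upd /= subnn.
- move=> k s' [g' sm Ec E1 [le_k E0]] /(cur_mrk _ g') k0.
  apply: wp_mono (wp_SETF _ _ g') (leqnn _) _ => s'' [g'' Eh Ec' Hf]; split=> //.
    case: sm => sm1 sm2; split=> j Hj; first by rewrite Eh; exact: sm1.
    by rewrite Ec' //; exact: sm2.
  by rewrite Hf /cursym E0 -E1 k0 subn0 -{1}(prednK hx) (g_inp g').
have k_gt0 : 0 < k by rewrite lt0n -E1; apply/eqP => k0; apply/nm/cur_mrk.
apply: wp_seq; apply: wp_mvl; first lia.
apply: wp_mvr => /=; exists k.-1; first lia.
split=> //=.
- apply: gwf_updc => //=; last by rewrite /upd /=; lia.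
  by apply: gwf_upd => //; have := g_bnd g' C1; lia.
- by do 2 apply: (small_hd (s1 := St _ _)) => //.
- by rewrite /upd /= E1.
- by split; [lia|rewrite /upd /=; lia].
Qed.

Definition cFOR c := 3 * B + N * (c + 3) + 3.

Lemma wp_for x P c (I : nat -> st -> Prop) (Q : st -> Prop) s :
  (exists2 l, l < M & x = vt l \/ x = nt l) -> gwf s ->
  (forall a s' v, v <= B -> I a s' -> I a (St (ct s') (upd (hd s') x v))) ->
  I 0 s ->
  (forall a s', a < N -> gwf s' -> I a s' -> hd s' x = a.+1 ->
     wp P c (fun s'' => [/\ gwf s'', hd s'' x = a.+1 & I a.+1 s'']) s') ->
  (forall s', gwf s' -> I N s' -> Q s') ->
  wp (FOR x P) (cFOR c) Q s.
Proof.
move=> [l lt_l Ex] g Iins I0 Hb HQ; have NB := N_lt_B.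
have nx : x != FL by case: Ex => ->; rewrite /vt /nt; lia.
apply: (wp_cost (c := 3 * B + 1 + (1 + (N * (c + 1 + 2) + 1)))); last by rewrite /cFOR; nia.
apply: wp_seq; apply: wp_reset => //; apply: wp_seq; apply: wp_mvr => /=.
have g1 : gwf (St (ct s) (upd (upd (hd s) x 0) x (upd (hd s) x 0 x).+1)).
  by apply: gwf_updc => //; [exact: gwf_upd|rewrite /upd eqxx; lia].
pose J k s' := [/\ k <= N, gwf s', hd s' x = (N - k).+1 & I (N - k) s'].
have curN k s' : J k s' -> (cursym s' x == None) = (k == 0).
  case=> le_k g' E _; rewrite /cursym E (g_rul g' lt_l Ex); last lia.
  by lia.
apply: (wp_until (I := J)) => [|k s' Jk /eqP|k s' Jk /eqP/negbTE].
- split=> //=; first by rewrite subnn /upd !eqxx.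
  rewrite subnn; apply: (Iins _ (St _ _)); first by rewrite /upd eqxx; lia.
  exact: (Iins _ s).
- by rewrite (curN _ _ Jk) => /eqP k0; case: Jk => _ g' _; rewrite k0 subn0; exact: HQ.
rewrite (curN _ _ Jk) => k0; case: Jk => le_k g' E Ia.
apply: wp_seq; apply: wp_mono (Hb _ _ _ g' Ia E) (leqnn _) _; first lia.
move=> s'' [g'' E'' Ia']; apply: wp_mvr; exists k.-1; first lia.
have EN : N - k.-1 = (N - k).+1 by lia.
split=> /=; first lia.
- by apply: gwf_upd => //; lia.
- by rewrite /upd eqxx EN E''.
- by rewrite EN; apply: Iins => //; lia.
Qed.

Definition cTIMES c := cCOPY + N * (c + 3) + 2.

Lemma wp_times x P c (I : nat -> st -> Prop) (Q : st -> Prop) s a :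
  4 < x -> a < N -> hd s x = a.+1 -> gwf s ->
  (forall k s' i v, i \in [:: SC; C1] -> v <= B -> I k s' ->
     I k (St (ct s') (upd (hd s') i v))) ->
  I 0 s ->
  (forall k s', k < a -> gwf s' -> I k s' ->
     wp P c (fun s'' => [/\ gwf s'', hd s'' C1 = hd s' C1 & I k.+1 s'']) s') ->
  (forall s', gwf s' -> I a s' -> Q s') ->
  wp (TIMES x P) (cTIMES c) Q s.
Proof.
move=> x_gt lt_a Ex g Iins I0 Hb HQ; have NB := N_lt_B.
apply: (wp_cost (c := cCOPY + (1 + (a * (c + 1 + 2) + 1)))); last by rewrite /cTIMES; nia.
apply: wp_seq; apply: wp_copy => //; first lia.
rewrite Ex; set h1 := upd _ C1 _; have E1 : h1 C1 = a.+1 by rewrite /h1 /upd eqxx.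
apply: wp_seq; apply: wp_mvl => /=; first by rewrite E1.
pose J k s' := [/\ k <= a, gwf s', hd s' C1 = k & I (a - k) s'].
apply: (wp_until (I := J)) => [|k s' [le_k g' E Ia] /(cur_mrk _ g')|k s' [le_k g' E Ia] nm].
- split=> //=.
    by do 2 (apply: gwf_updc => //; last lia); exact: gwf_upd.
  + rewrite subnn; apply: (Iins 0 (St (ct s) h1)) => //; first lia.
    apply: (Iins 0 (St (ct s) _)) => //; first lia.
    by apply: (Iins 0 s).
- by rewrite E => k0; apply: HQ; rewrite // -[a]subn0 -k0.
have k_gt0 : 0 < k by rewrite lt0n -E; apply/eqP => k0; apply/nm/cur_mrk.
apply: wp_seq; apply: wp_mono (Hb _ _ _ g' Ia) (leqnn _) _; first lia.
move=> s'' [g'' E'' Ia']; apply: wp_mvl; first lia.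
have EN : a - k.-1 = (a - k).+1 by lia.
exists k.-1; first lia.
split=> /=; first lia.
- by apply: gwf_upd => //; lia.
- by rewrite /upd eqxx E'' E.
- by rewrite EN; apply: Iins => //; lia.
Qed.

Definition idx (x y z : nat) : nat := (x * N + y) * N + z.

Lemma idx_lt x y z : x < N -> y < N -> z < N -> idx x y z < N ^ 3.
Proof. by rewrite /idx !expnS expn0; nia. Qed.

Lemma idx_inj x y z x' y' z' : y < N -> z < N -> y' < N -> z' < N ->
  idx x y z = idx x' y' z' -> [/\ x = x', y = y' & z = z'].
Proof.
have dm p q p' q' : q < N -> q' < N -> p * N + q = p' * N + q' -> p = p' /\ q = q'.
  move=> lq lq' E; have := congr1 (divn^~ N) E; have := congr1 (modn^~ N) E.
  by rewrite /= !modnMDl !divnMDl // !modn_small // !divn_small // !addn0.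
by move=> ly lz ly' lz' /(dm _ _ _ _ lz lz')[/(dm _ _ _ _ ly ly')[-> ->] ->].
Qed.

Section Read.

Variables (T d : nat) (s : st).
Hypotheses (T_gt : 4 < T) (lt_dM : d.+1 < M)
  (nT0 : T != vt d) (nT1 : T != vt d.+1).

Definition rinv (v : nat) (s' : st) : Prop :=
  [/\ ct s' = ct s, hd s' T = v &
    forall i, i \notin [:: SC; C1; T; vt d; vt d.+1] -> hd s' i = hd s i].

Lemma rinv_upd v s' i u : i \in [:: SC; C1; vt d; vt d.+1] ->
  rinv v s' -> rinv v (St (ct s') (upd (hd s') i u)).
Proof.
rewrite !inE => Hi [Hc Hh Hr]; split=> //= [|j Hj].
  by rewrite /upd; case: eqP => // E; move: Hi nT0 nT1; rewrite -E => /or4P[] /eqP; lia.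
rewrite /upd; case: eqP => [E|_]; last exact: Hr.
by move: Hi Hj; rewrite -E !inE => /or4P[] ->; rewrite ?orbT.
Qed.

Lemma wp_adv0 v s' : gwf s' -> rinv v s' -> v < B ->
  wp (MvR T) 1 (fun s'' => [/\ gwf s'', hd s'' C1 = hd s' C1,
    hd s'' (vt d) = hd s' (vt d), hd s'' (vt d.+1) = hd s' (vt d.+1) & rinv v.+1 s'']) s'.
Proof.
move=> g [Hc Hh Hr] lt_v; apply: wp_mvr; split=> /=.
- by apply: gwf_upd => //; lia.
- by upds.
- by upds.
- by upds.
split=> //=; first by rewrite /upd eqxx Hh.
by move=> i Hi; rewrite -Hr //; move: Hi; rewrite !inE; upds.
Qed.

Lemma wp_adv1 v s' : gwf s' -> rinv v s' -> v + N <= B ->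
  wp (FOR (vt d) (MvR T)) (cFOR 1) (fun s'' => [/\ gwf s'', hd s'' C1 = hd s' C1,
    hd s'' (vt d.+1) = hd s' (vt d.+1) & rinv (v + N) s'']) s'.
Proof.
move=> g Hr le_v.
apply: (wp_for (I := fun a s'' => [/\ hd s'' C1 = hd s' C1,
    hd s'' (vt d.+1) = hd s' (vt d.+1) & rinv (v + a) s''])) => //.
- by exists d; [lia|left].
- move=> a s'' u le_u [E1 E2 Hr2]; split; last by apply: rinv_upd => //; rewrite !inE eqxx ?orbT.
    by rewrite /= /upd; case: eqP => //; rewrite /vt; lia.
  by rewrite /= /upd; case: eqP => //; rewrite /vt; lia.
- by rewrite addn0.
- move=> a s'' lt_a g'' [E1 E2 Hr2] E0.
  apply: wp_mono (wp_adv0 g'' Hr2 _) (leqnn _) _; first lia.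
  by move=> s3 [g3 F1 F0 F2 Hr3]; split; rewrite ?F0 //; split; rewrite ?F1 ?F2 ?addnS.
- by move=> s'' g'' [E1 E2 Hr2].
Qed.

Lemma wp_adv2 v s' : gwf s' -> rinv v s' -> v + N * N <= B ->
  wp (FOR (vt d.+1) (FOR (vt d) (MvR T))) (cFOR (cFOR 1)) (fun s'' =>
    [/\ gwf s'', hd s'' C1 = hd s' C1 & rinv (v + N * N) s'']) s'.
Proof.
move=> g Hr le_v.
apply: (wp_for (I := fun a s'' => hd s'' C1 = hd s' C1 /\ rinv (v + a * N) s'')) => //.
- by exists d.+1; [lia|left].
- move=> a s'' u le_u [E1 Hr2]; split; last by apply: rinv_upd => //; rewrite !inE eqxx ?orbT.
  by rewrite /= /upd; case: eqP => //; rewrite /vt; lia.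
- by rewrite addn0.
- move=> a s'' lt_a g'' [E1 Hr2] E0.
  apply: wp_mono (wp_adv1 g'' Hr2 _) (leqnn _) _; first nia.
  by move=> s3 [g3 F1 F2 Hr3]; split; rewrite ?F2 //; split; rewrite ?F1 // mulSnr addnA.
- by move=> s'' g'' [E1 Hr2].
Qed.

Definition cREAD := 3 * B + 1 + (cTIMES (cFOR (cFOR 1)) + (cTIMES (cFOR 1) +
  (cTIMES 1 + (1 + 3)))).

Lemma wp_READ x y z a b c : gwf s ->
  (forall i, i \in [:: x; y; z] -> 4 < i /\ i \notin [:: T; vt d; vt d.+1]) ->
  hd s x = a.+1 -> hd s y = b.+1 -> hd s z = c.+1 -> a < N -> b < N -> c < N ->
  wp (READ T x y z d) cREAD (fun s' => [/\ gwf s',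
    forall i, i \notin [:: SC; C1; T; vt d; vt d.+1] -> hd s' i = hd s i,
    forall i, i <> FL -> ct s' i = ct s i &
    cursym s' FL = sym1 <-> ct s T (idx a b c).+1 = sym1]) s.
Proof.
move=> g Hn Ex Ey Ez lt_a lt_b lt_c; have NB := N_lt_B.
have [Hx Hy Hz] : [/\ x \in [:: x; y; z], y \in [:: x; y; z] & z \in [:: x; y; z]].
  by rewrite !inE !eqxx ?orbT.
have [x_gt Hx'] := Hn _ Hx; have [y_gt Hy'] := Hn _ Hy; have [z_gt Hz'] := Hn _ Hz.
have nin i : 4 < i -> i \notin [:: T; vt d; vt d.+1] ->
    i \notin [:: SC; C1; T; vt d; vt d.+1].
  by rewrite !inE; lia.
have Iins v s' i u : i \in [:: SC; C1] -> u <= B -> rinv v s' ->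
    rinv v (St (ct s') (upd (hd s') i u)).
  by move=> Hi _; apply: rinv_upd; move: Hi; rewrite !inE => /orP[] ->; rewrite ?orbT.
have le3 : idx a b c + 2 <= B by have := idx_lt lt_a lt_b lt_c; lia.
have lebc : b * N + c < N * N by nia.
have leab : a * (N * N) + b * N + c = idx a b c by rewrite /idx; nia.
apply: wp_seq; apply: wp_reset => //; first lia.
set s1 := St _ _.
have r1 : rinv 0 s1.
  split=> //=; first by rewrite /upd eqxx.
  by move=> i; rewrite !inE; upds.
have g1 : gwf s1 by apply: gwf_upd => //; lia.
have hx1 : hd s1 x = a.+1 by rewrite -Ex; case: r1 => _ _ -> //; exact: nin.
apply: wp_seq; apply: (wp_times (a := a) (I := fun k => rinv (k * (N * N)))) => //.
- by move=> k s' i u Hi le_u; exact: Iins.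
- move=> k s' lt_k g' Hr; apply: wp_mono (wp_adv2 g' Hr _) (leqnn _) _; first nia.
  by move=> s'' [g'' E Hr']; split=> //; rewrite mulSnr.
move=> s2 g2 r2.
have hy2 : hd s2 y = b.+1 by rewrite -Ey; case: r2 => _ _ -> //; exact: nin.
apply: wp_seq; apply: (wp_times (a := b) (I := fun k => rinv (a * (N * N) + k * N))) => //.
- by move=> k s' i u Hi le_u; exact: Iins.
- by rewrite addn0.
- move=> k s' lt_k g' Hr; apply: wp_mono (wp_adv1 g' Hr _) (leqnn _) _; first nia.
  by move=> s'' [g'' E _ Hr']; split=> //; rewrite mulSnr addnA.
move=> s3 g3 r3.
have hz3 : hd s3 z = c.+1 by rewrite -Ez; case: r3 => _ _ -> //; exact: nin.
apply: wp_seq; apply: (wp_times (a := c) (I := fun k => rinv (a * (N * N) + b * N + k))) => //.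
- by move=> k s' i u Hi le_u; exact: Iins.
- by rewrite addn0.
- move=> k s' lt_k g' Hr; apply: wp_mono (wp_adv0 g' Hr _) (leqnn _) _; first nia.
  by move=> s'' [g'' E _ _ Hr']; split=> //; rewrite addnS.
move=> s4 g4 r4; rewrite leab in r4.
apply: wp_seq; apply: wp_mono (wp_adv0 g4 r4 _) (leqnn _) _; first lia.
move=> s5 [g5 _ _ _ [Ec5 ET5 Eh5]].
apply: wp_mono (wp_SETF _ _ g5) (leqnn _) _ => s6 [g6 Eh6 Ec6 Hf]; split=> //.
- by move=> i Hi; rewrite Eh6 Eh5.
- by move=> i Hi; rewrite Ec6 // Ec5.
- by rewrite Hf /cursym ET5 Ec5.
Qed.

End Read.

Lemma wp_sweep d P c (I : nat -> st -> Prop) (Q : st -> Prop) s :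
  d.+2 < M -> gwf s ->
  (forall k s' i v, i \in [:: vt d; vt d.+1; vt d.+2] -> v <= B -> I k s' ->
     I k (St (ct s') (upd (hd s') i v))) ->
  I 0 s ->
  (forall x y z s', x < N -> y < N -> z < N -> gwf s' -> I (idx x y z) s' ->
     hd s' (vt d.+2) = x.+1 -> hd s' (vt d.+1) = y.+1 -> hd s' (vt d) = z.+1 ->
     wp P c (fun s'' => [/\ gwf s'',
       forall i, i \in [:: vt d; vt d.+1; vt d.+2] -> hd s'' i = hd s' i
       & I (idx x y z).+1 s'']) s') ->
  (forall s', gwf s' -> I (N ^ 3) s' -> Q s') ->
  wp (SWEEP d P) (cFOR (cFOR (cFOR c))) Q s.
Proof.
move=> lt_d g Iins I0 Hb HQ.
have [m0 m1 m2] : [/\ vt d \in [:: vt d; vt d.+1; vt d.+2],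
    vt d.+1 \in [:: vt d; vt d.+1; vt d.+2] & vt d.+2 \in [:: vt d; vt d.+1; vt d.+2]].
  by rewrite !inE !eqxx ?orbT.
have nvt l l' h v : l <> l' -> upd h (vt l) v (vt l') = h (vt l').
  by move=> nl; rewrite /upd; case: eqP => //; rewrite /vt; lia.
apply: (wp_for (I := fun x => I (idx x 0 0))) => //.
- by exists d.+2; [|left].
- by move=> a s' v; exact: Iins.
- move=> x s1 lt_x g1 I1 Ex.
  apply: (wp_for (I := fun y s' => hd s' (vt d.+2) = x.+1 /\ I (idx x y 0) s')) => //.
  + by exists d.+1; [lia|left].
  + by move=> a s' v le_v [E Ia]; split; [rewrite /= nvt //; lia|exact: Iins].
  + move=> y s2 lt_y g2 [Ex2 I2] Ey.
    apply: (wp_for (I := fun z s' => [/\ hd s' (vt d.+2) = x.+1, hd s' (vt d.+1) = y.+1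
      & I (idx x y z) s'])) => //.
    * by exists d; [lia|left].
    * move=> a s' v le_v [E E' Ia]; split; [rewrite /= nvt //; lia| |exact: Iins].
      by rewrite /= nvt //; lia.
    * move=> z s3 lt_z g3 [Ex3 Ey3 I3] Ez.
      apply: wp_mono (Hb x y z s3 lt_x lt_y lt_z g3 I3 Ex3 Ey3 Ez) (leqnn _) _.
      move=> s4 [g4 H4 I4]; split; rewrite ?H4 //; split; rewrite ?H4 //.
      by rewrite /idx addnS.
    * move=> s3 g3 [Ex3 Ey3 I3]; split=> //; split=> //.
      by move: I3; congr I; rewrite /idx; nia.
  + move=> s2 g2 [Ex2 I2]; split=> //; move: I2; congr I; rewrite /idx; nia.
- by move=> s' g' I'; apply: HQ => //; move: I'; congr I; rewrite /idx !expnS expn0; nia.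
Qed.

Fixpoint cst (phi : form) : nat :=
  match phi with
  | FLt _ _ => cLT
  | FInp _ _ => cINP
  | FRel _ _ _ => cREAD
  | FNot phi => cst phi + 3
  | FAnd phi psi => cst phi + (cst psi + 1 + 2)
  | FEx phi =>
      1 + (3 * B + 1 + (1 + (N * (cst phi + (N * (1 + 2) + 1 + 1 + 2) + 2) + 1)))
  | FIter phi _ _ _ =>
      3 * B + 1 + cFOR (cFOR (cFOR (1 + 1))) +
      (cFOR (3 * B + 1 + cFOR (cFOR (cFOR (cst phi + (1 + (1 + 2))))) +
             (3 * B + 1 + (3 * B + 1 + cFOR (cFOR (cFOR (1 + (1 + (1 + 2)))))))) +
       cREAD)
  end.

Definition envok d (e : nat -> nat) (s : st) : Prop :=
  forall i, i < d -> hd s (vt (d - i.+1)) = (e i).+1 /\ e i < N.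

Definition tab T (R : rel3) n (s : st) : Prop :=
  forall x y z, x < N -> y < N -> z < N -> idx x y z < n ->
    (ct s T (idx x y z).+1 = sym1 <-> R x y z).

Lemma envok_frame d rd e s s' : frame d rd s s' -> envok d e s -> envok d e s'.
Proof.
move=> [H _] E i lt_i; have [<- ?] := E i lt_i; split=> //; apply: H.
by exists (d - i.+1); left; split=> //; lia.
Qed.

Lemma envok_scons d e s a :
  envok d e s -> hd s (vt d) = a.+1 -> a < N -> envok d.+1 (scons a e) s.
Proof. by move=> E Ea lt_a [|i] lt_i /=; [rewrite subn1|rewrite subSS; exact: E]. Qed.

Lemma frame_hd d rd s s' i v :
  frame d rd s s' -> ~ phd d rd i -> frame d rd s (St (ct s') (upd (hd s') i v)).
Proof.
move=> [H C] ni; split=> //= j Hj; rewrite /upd; case: eqP => [E|_]; last exact: H.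
by rewrite E in Hj.
Qed.

Lemma frame_wr d rd s s' i f :
  frame d rd s s' -> uct rd i -> frame d rd s (St (upd (ct s') i f) (hd s')).
Proof.
move=> [H C] ui; split=> //= j Hj; rewrite /upd; case: eqP => [E|_]; last exact: C.
by case: Hj; rewrite E.
Qed.

Lemma tab_wr T R s x y z v : x < N -> y < N -> z < N ->
  tab T R (idx x y z) s -> (v = sym1 <-> R x y z) ->
  tab T R (idx x y z).+1 (St (upd (ct s) T (upd (ct s T) (idx x y z).+1 v)) (hd s)).
Proof.
move=> lx ly lz Ht Hv x' y' z' lx' ly' lz'; rewrite ltnS leq_eqVlt => /orP[/eqP E|lt_i] /=.
  have [-> -> ->] := idx_inj ly' lz' ly lz E.
  by rewrite /upd !eqxx.
rewrite /upd eqxx; case: eqP => [|_]; first lia.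
exact: Ht.
Qed.

Lemma tab_ct T R n s s' : ct s' T = ct s T -> tab T R n s -> tab T R n s'.
Proof. by move=> E H x y z lx ly lz lt; rewrite E; exact: H. Qed.

Ltac tapes := rewrite /phd /uct /vt /rt /bt /nt; lia.

(** Induction on the formula, with the environment held in head positions. The frame condition is
    what carries loop invariants across the evaluation of a subformula. *)
Lemma evalp_correct phi d rd b R e s :
  wff phi d b -> d + depth phi <= M -> rd + depth phi <= M -> gwf s -> envok d e s ->
  (b -> 0 < rd /\ tab (rt rd.-1) R (N ^ 3) s) ->
  wp (evalp phi d rd) (cst phi)
    (fun s' => [/\ gwf s', frame d rd s s' & cursym s' FL = sym1 <-> holds w N phi R e]) s.
Proof.
elim: phi d rd b R e s => [i j|b0 i|i j k|phi IH|phi IH psi IH'|phi IH|phi IH i j k]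
  d rd b R e s /= W Hd Hr g E HR.
- move/andP: W => [lt_i lt_j]; have [Ei _] := E i lt_i; have [Ej _] := E j lt_j.
  apply: wp_mono (wp_LT g _ _) (leqnn _) _; [tapes|tapes|].
  by move=> s' [g' sm Hf]; split=> //; [exact: small_frame|rewrite Hf Ei Ej].
- have [Ei _] := E i W.
  apply: wp_mono (wp_INP b0 g _ _) (leqnn _) _; [tapes|lia|].
  by move=> s' [g' sm Hf]; split=> //; [exact: small_frame|rewrite Hf Ei].
- move/and4P: W => [Hb lt_i lt_j lt_k]; have [rd_gt Ht] := HR Hb.
  have [Ei li] := E i lt_i; have [Ej lj] := E j lt_j; have [Ek lk] := E k lt_k.
  apply: wp_mono (@wp_READ (rt rd.-1) d s _ _ _ _ _ _ _ _ _ _ g _ Ei Ej Ek li lj lk) (leqnn _) _.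
  + by rewrite /rt; lia.
  + lia.
  + by rewrite /rt /vt; lia.
  + by rewrite /rt /vt; lia.
  + by move=> l; rewrite !inE => Hl; split; move: Hl; rewrite /rt /vt; lia.
  move=> s' [g' Hh Hc Hf]; split=> //; last by rewrite Hf Ht // idx_lt.
  split=> l Hl; [apply: Hh|apply: Hc => El; apply: Hl; left] => //.
  by rewrite !inE; case: Hl => l'; rewrite /vt /bt /nt /rt; lia.
- apply: wp_seq; apply: wp_mono (IH _ _ _ _ _ _ W Hd Hr g E HR) (leqnn _) _.
  move=> s1 [g1 F1 H1]; apply: (wp_cost (c := 1 + 2)) => //.
  apply: wp_if => Hc; apply: wp_wr; (split; [exact: gwf_wrFL|by apply: frame_wr => //; left|]).
    by rewrite cur_upd; split=> // nh; case: nh; apply/H1.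
  by rewrite cur_upd; split=> // _ /H1.
- move/andP: W => [W1 W2].
  apply: wp_seq; apply: wp_mono (IH _ _ _ _ _ _ W1 _ _ g E HR) (leqnn _) _; [lia|lia|].
  move=> s1 [g1 F1 H1]; apply: wp_if => Hc.
    apply: wp_mono (IH' _ _ _ _ _ s1 W2 _ _ g1 (envok_frame F1 E) _) _ _; [lia|lia| |lia|].
      move=> Hb; have [rd_gt Ht] := HR Hb; split=> //; apply: tab_ct Ht; apply: (proj2 F1).
      by case=> [|[l]]; tapes.
    move=> s2 [g2 F2 H2]; split=> //; first exact: frame_trans F1 F2.
    by rewrite H2; split=> [|[]] //; split=> //; apply/H1.
  apply: (wp_cost (c := 1)); last lia.
  apply: wp_wr; split; [exact: gwf_wrFL|by apply: frame_wr => //; left|].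
  by rewrite cur_upd; split=> // -[/H1].
- have NB := N_lt_B; have nphd : ~ phd d rd (vt d) by case=> l; tapes.
  have nFL : vt d != FL by tapes.
  apply: wp_seq; apply: wp_wr; apply: wp_seq; apply: wp_reset; [exact: gwf_wrFL|tapes|].
  apply: wp_seq; apply: wp_mvr => /=.
  (* [k] counts the values still to be tried; a success forces [k = 0], so the loop ends at once. *)
  pose J k s' := [/\ k <= N, gwf s', frame d rd s s', hd s' (vt d) = (N - k).+1 &
    (cursym s' FL = sym1 /\ k = 0 /\ exists2 a, a < N & holds w N phi R (scons a e)) \/
    (cursym s' FL <> sym1 /\ forall a, a < N - k -> ~ holds w N phi R (scons a e))].
  have rul s' k : gwf s' -> hd s' (vt d) = (N - k).+1 -> k <= N ->
      (cursym s' (vt d) == None) = (k == 0).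
    move=> g' E' le_k; rewrite /cursym E' (@g_rul _ g' d); [|lia|by left|lia].
    by lia.
  apply: (wp_until (I := J)) => [|k s' [le_k g' F' E' [[Hf [k0 Hex]]|[Hf Hall]]] /eqP|k s'
    [le_k g' F' E' Hor] /eqP].
  + split=> //.
    * apply: gwf_updc => //; first by apply: gwf_updc => //; exact: gwf_wrFL.
      by rewrite /upd eqxx; lia.
    * do 2 (apply: (@frame_hd _ _ _ (St _ _)) => //).
      by apply: frame_wr; [exact: frame_refl|left].
    * by rewrite subnn /= /upd !eqxx.
    * by right; split; [rewrite !cur_hd // cur_upd|rewrite subnn].
  + by move=> _; split.
  + rewrite (rul s' k) // => /eqP k0; split=> //; split=> // -[a lt_a Ha].
    by case: (Hall a) => //; lia.
  rewrite (rul s' k) // => k0.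
  case: Hor => [[_ [k0' _]]|[Hf Hall]]; first by rewrite k0' in k0.
  have lt_a : N - k < N by lia.
  apply: wp_seq; apply: wp_mono (IH d.+1 rd b R (scons (N - k) e) s' W _ _ g' _ _) (leqnn _) _;
    [lia|lia| | |].
  + by apply: envok_scons => //; exact: envok_frame F' E.
  + move=> Hb; have [rd_gt Ht] := HR Hb; split=> //; apply: tab_ct Ht; apply: (proj2 F').
    by case=> [|[l]]; tapes.
  move=> s1 [g1 F1 H1].
  have E1 : hd s1 (vt d) = (N - k).+1.
    by rewrite -E'; apply: (proj1 F1); exists d; left; split.
  have {}F1 : frame d rd s s1.
    by apply: frame_trans F' _; apply: frame_le F1 => //.
  apply: wp_if => Hc; last first.
    have nh : ~ holds w N phi R (scons (N - k) e) by move/H1.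
    apply: (wp_cost (c := 1)); last lia.
    apply: wp_mvr; exists k.-1; first lia.
    have EN : N - k.-1 = (N - k).+1 by lia.
    split=> /=; first lia.
    * by apply: gwf_upd => //; rewrite E1; lia.
    * exact: frame_hd.
    * by rewrite /upd eqxx E1 EN.
    right; split; first by rewrite cur_hd //; tapes.
    move=> a; rewrite EN ltnS leq_eqVlt => /orP[/eqP->//|]; exact: Hall.
  have Hh : holds w N phi R (scons (N - k) e) by apply/H1.
  (* The inner loop drives the head to the blank behind the ruler, so that [k] drops to 0 in one
     round of the outer loop. *)
  pose J' j s2 := j <= k /\ s2 = St (ct s1) (upd (hd s1) (vt d) (N - j).+1).
  have gJ j s2 : J' j s2 -> gwf s2 /\ hd s2 (vt d) = (N - j).+1.
    move=> [le_j ->]; split; last by rewrite /= /upd eqxx.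
    by apply: gwf_upd => //; lia.
  apply: (wp_cost (c := k * (1 + 2) + 1)); last by nia.
  apply: (wp_until (I := J')) => [|j s2 Jj /eqP|j s2 Jj /eqP].
  + by split=> //; apply: st_eq => // l; rewrite /upd; case: eqP => // ->.
  + have [g2 E2] := gJ _ _ Jj; have le_j := proj1 Jj.
    rewrite (rul s2 j) // => [/eqP j0|]; last lia.
    exists 0; first lia.
    split=> //; [by case: Jj => _ ->; exact: frame_hd|by rewrite E2 j0|left].
    split; last by split=> //; exists (N - k).
    by case: Jj => _ ->; rewrite cur_hd //; tapes.
  have [g2 E2] := gJ _ _ Jj; have le_j := proj1 Jj.
  rewrite (rul s2 j) // => [j0|]; last lia.
  apply: wp_mvr; rewrite E2; exists j.-1; first lia.
  split; first lia.
  have EN : N - j.-1 = (N - j).+1 by lia.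
  by case: Jj => _ ->; rewrite EN /=; congr St; apply: funext => l; upds.
- case/and4P: W => [lt_i lt_j lt_k W].
  have [Ei li] := E i lt_i; have [Ej lj] := E j lt_j; have [Ek lk] := E k lt_k.
  pose F (R : rel3) x y z := holds w N phi R (scons x (scons y (scons z e))).
  (* At the start of round [n] the table [rt rd] holds [RI n]; [bt rd] is filled with [RI n.+1]
     before it is copied over. *)
  pose RI n : rel3 := iter n F (fun _ _ _ => False).
  have N3 : N ^ 3 + 2 <= B by [].
  have lt_rd : rd < M by lia.
  have utt : uct rd (rt rd) by right; exists rd => //; left.
  have ubt : uct rd (bt rd) by right; exists rd => //; right.
  have utt0 : uct 0 (rt rd) by right; exists rd => //; left.
  have ubt0 : uct 0 (bt rd) by right; exists rd => //; right.
  have ptt : ~ phd d rd (rt rd) by case=> l; tapes.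
  have pbt : ~ phd d rd (bt rd) by case=> l; tapes.
  have pnt : ~ phd d rd (nt rd) by case=> l; tapes.
  have pvt l : l \in [:: vt d; vt d.+1; vt d.+2] ->
      [/\ ~ phd d rd l, l != FL, l != rt rd, l != bt rd & l != nt rd].
    rewrite !inE => Hl; split; try by move: Hl; tapes.
    by case=> l' Hl'; move: Hl Hl'; tapes.
  have ntt : rt rd != FL by tapes.
  have nbt : bt rd != FL by tapes.
  have neq1 : rt rd != bt rd by tapes.
  have neq2 : rt rd != nt rd by tapes.
  have neq3 : bt rd != nt rd by tapes.
  apply: wp_seq; apply: wp_seq; apply: wp_reset => //.
  have updn (h : nat -> nat) l v l' : l != l' -> upd h l v l' = h l'.
    by rewrite /upd eq_sym => /negbTE->.
  have updnf (h : nat -> nat -> sym) l v l' : l != l' -> upd h l v l' = h l'.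
    by rewrite /upd eq_sym => /negbTE->.
  have upde T (h : nat -> T) l v : upd h l v l = v by rewrite /upd eqxx.
  apply: (@wp_sweep d _ _ (fun n s' => [/\ frame d rd s s', hd s' (rt rd) = n &
      tab (rt rd) (RI 0) n s'])) => //; first lia.
  + exact: gwf_upd.
  + move=> n s' l v Hl le_v [F' E' T']; have [pl _ n1 _ _] := pvt l Hl.
    by split=> //; [exact: frame_hd|rewrite /= updn].
  + split=> //; first by apply: frame_hd => //.
    by rewrite /= upde.
  + move=> x y z s' lx ly lz g' [F' E' T'] Ex Ey Ez; have lti := idx_lt lx ly lz.
    apply: wp_seq; apply: wp_mvr; apply: wp_wr; rewrite E' [hd _ _]/= upde; split.
    * have := @gwf_wr (St (ct s') (upd (hd s') (rt rd) (idx x y z).+1)) (rt rd) sym0.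
      by rewrite /= upde; apply=> //; apply: gwf_upd => //; lia.
    * by move=> l Hl; have [_ _ n1 _ _] := pvt l Hl; rewrite /= updn // eq_sym.
    * split; [|by rewrite /= upde|].
        by apply: (@frame_wr _ _ _ (St _ _)) => //; exact: frame_hd.
      exact: (@tab_wr _ _ (St _ _)).
  move=> s1 g1 [F1 _ T1]; apply: wp_seq.
  apply: (wp_for (I := fun n s' => frame d rd s s' /\ tab (rt rd) (RI n) (N ^ 3) s')) => //.
  + by exists rd; [|right].
  + by move=> n s' v le_v [F' T']; split=> //; exact: frame_hd.
  + move=> n s2 lt_n g2 [F2 T2] En.
    apply: wp_seq; apply: wp_seq; apply: wp_reset => //.
    apply: (@wp_sweep d _ _ (fun m s' => [/\ frame d rd s s' /\ hd s' (nt rd) = n.+1,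
        tab (rt rd) (RI n) (N ^ 3) s', hd s' (bt rd) = m & tab (bt rd) (RI n.+1) m s'])) => //.
    * lia.
    * exact: gwf_upd.
    * move=> m s' l v Hl le_v [[F' N'] T' E' T'']; have [pl _ _ n2 n3] := pvt l Hl.
      split=> //; last by rewrite /= updn.
      by split; [exact: frame_hd|rewrite /= updn].
    * split=> //; last by rewrite /= upde.
      by split; [exact: frame_hd|rewrite /= updn].
    * move=> x y z s' lx ly lz g' [[F' N'] T' E' T''] Ex Ey Ez; have lti := idx_lt lx ly lz.
      apply: wp_seq.
      apply: wp_mono (IH d.+3 rd.+1 true (RI n) (scons x (scons y (scons z e))) s' W
        _ _ g' _ _) (leqnn _) _; [lia|lia| |by []|].
        by do 3 apply: envok_scons => //; exact: envok_frame F' E.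
      move=> s3 [g3 F3 H3].
      have hs3 l : l \in [:: vt d; vt d.+1; vt d.+2] -> hd s3 l = hd s' l.
        by rewrite !inE => Hl; apply: (proj1 F3); case/or3P: Hl => /eqP->;
          [exists d|exists d.+1|exists d.+2]; left; split=> //; lia.
      have b3 : hd s3 (bt rd) = idx x y z.
        by rewrite -E'; apply: (proj1 F3); exists rd; right; split=> //; left.
      have n3 : hd s3 (nt rd) = n.+1.
        by rewrite -N'; apply: (proj1 F3); exists rd; right; split=> //; right.
      have c3 l : l = rt rd \/ l = bt rd -> ct s3 l = ct s' l.
        by move=> Hl; apply: (proj2 F3); case=> [|[l' lt_l']]; move: Hl; tapes.
      have {F3}F3 : frame d rd s s3 by apply: frame_trans F' _; apply: frame_le F3; lia.
      have T3 : tab (rt rd) (RI n) (N ^ 3) s3 by apply: tab_ct T'; apply: c3; left.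
      have T3' : tab (bt rd) (RI n.+1) (idx x y z) s3 by apply: tab_ct T''; apply: c3; right.
      apply: wp_seq; apply: wp_mvr; rewrite b3.
      set s4 := St _ _.
      have g4 : gwf s4 by apply: gwf_upd => //; lia.
      have F4 : frame d rd s s4 by apply: frame_hd.
      have K4 v : v != mrk -> (v = sym1 <-> RI n.+1 x y z) ->
          wp (Wr (bt rd) v) 1 (fun s'' => [/\ gwf s'',
            forall l, l \in [:: vt d; vt d.+1; vt d.+2] -> hd s'' l = hd s' l &
            [/\ frame d rd s s'' /\ hd s'' (nt rd) = n.+1, tab (rt rd) (RI n) (N ^ 3) s'',
                hd s'' (bt rd) = (idx x y z).+1 & tab (bt rd) (RI n.+1) (idx x y z).+1 s'']]) s4.
        move=> nv Hv; apply: wp_wr.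
        have := @gwf_wr s4 (bt rd) v g4 nv ubt0; rewrite [hd s4 _]/= upde => g5.
        split; first exact: g5.
          by move=> l Hl; have [_ _ _ n2 _] := pvt l Hl; rewrite /= updn ?hs3 // eq_sym.
        split.
        - by split; [exact: frame_wr|rewrite /= updn].
        - by apply: tab_ct T3; rewrite /= updnf // eq_sym.
        - by rewrite /= upde.
        - by apply: (@tab_wr _ _ s4).
      have E4 : cursym s4 FL = cursym s3 FL by rewrite /s4 cur_hd.
      have {}H3 : cursym s3 FL = sym1 <-> RI n.+1 x y z by exact: H3.
      apply: wp_if => Hc; apply: K4 => //; rewrite E4 in Hc; first by rewrite -H3.
      by split=> // /H3.
    move=> s3 g3 [[F3 N3'] T3 _ T3'].
    apply: wp_seq; apply: wp_reset => //; apply: wp_seq; apply: wp_reset => //.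
      exact: gwf_upd.
    apply: (@wp_sweep d _ _ (fun m s' => [/\ frame d rd s s' /\ hd s' (nt rd) = n.+1,
        tab (bt rd) (RI n.+1) (N ^ 3) s', hd s' (bt rd) = m, hd s' (rt rd) = m &
        tab (rt rd) (RI n.+1) m s'])) => //.
    * lia.
    * by do 2 apply: gwf_upd => //.
    * move=> m s' l v Hl le_v [[F' N'] T' E' E'' T'']; have [pl _ n1 n2 n3] := pvt l Hl.
      split=> //; try by rewrite /= updn.
      by split; [exact: frame_hd|rewrite /= updn].
    * split=> //; try by rewrite /= ?upde // updn ?upde // eq_sym.
      split; last by rewrite /= !updn.
      by apply: (@frame_hd _ _ _ (St _ _)) => //; exact: frame_hd.
    * move=> x y z s' lx ly lz g' [[F' N'] T' E' E'' T''] Ex Ey Ez.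
      have lti := idx_lt lx ly lz.
      apply: wp_seq; apply: wp_mvr; rewrite E''; apply: wp_seq; apply: wp_mvr.
      rewrite [ct (St _ _)]/= [hd (St _ _)]/= updn // E'.
      set s4 := St _ _.
      have g4 : gwf s4 by apply: gwf_updc => //; [apply: gwf_upd => //; lia|lia].
      have F4 : frame d rd s s4.
        by apply: (@frame_hd _ _ _ (St _ _)) => //; exact: frame_hd.
      have h4 : hd s4 (rt rd) = (idx x y z).+1 by rewrite /= updn ?upde // eq_sym.
      have K4 v : v != mrk -> (v = sym1 <-> RI n.+1 x y z) ->
          wp (Wr (rt rd) v) 1 (fun s'' => [/\ gwf s'',
            forall l, l \in [:: vt d; vt d.+1; vt d.+2] -> hd s'' l = hd s' l &
            [/\ frame d rd s s'' /\ hd s'' (nt rd) = n.+1, tab (bt rd) (RI n.+1) (N ^ 3) s'',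
                hd s'' (bt rd) = (idx x y z).+1, hd s'' (rt rd) = (idx x y z).+1 &
                tab (rt rd) (RI n.+1) (idx x y z).+1 s'']]) s4.
        move=> nv Hv; apply: wp_wr.
        have := @gwf_wr s4 (rt rd) v g4 nv utt0; rewrite h4 => g5.
        split; first exact: g5.
          move=> l Hl; have [_ _ n1 n2 _] := pvt l Hl.
          by rewrite /= !updn // eq_sym.
        split.
        - by split; [exact: frame_wr|rewrite /= !updn].
        - by apply: tab_ct T'; rewrite /= updnf.
        - by rewrite /= upde.
        - exact: h4.
        - by apply: (@tab_wr _ _ s4).
      have E4 : cursym s4 (bt rd) = sym1 <-> RI n.+1 x y z.
        by rewrite /cursym /= upde; exact: T'.
      apply: wp_if => Hc; apply: K4 => //; first by rewrite -E4.
      by split=> // /E4.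
    move=> s4 g4 [[F4 N4] T4 _ _ T4']; split=> //; split=> //.
  move=> s2 g2 [F2 T2].
  have [E2i E2j E2k] : [/\ hd s2 (vt (d - i.+1)) = (e i).+1,
      hd s2 (vt (d - j.+1)) = (e j).+1 & hd s2 (vt (d - k.+1)) = (e k).+1].
    by have H2 := envok_frame F2 E; split; apply: (proj1 (H2 _ _)).
  apply: wp_mono (@wp_READ (rt rd) d s2 _ _ _ _ _ _ _ _ _ _ g2 _ E2i E2j E2k li lj lk)
    (leqnn _) _.
  + by rewrite /rt; lia.
  + lia.
  + by rewrite /rt /vt; lia.
  + by rewrite /rt /vt; lia.
  + by move=> l; rewrite !inE => Hl; split; move: Hl; rewrite /rt /vt; lia.
  move=> s' [g' Hh Hc Hf]; split=> //.
  + apply: frame_trans F2 _; split=> l Hl; [apply: Hh|apply: Hc => El; apply: Hl; left] => //.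
    by rewrite !inE; case: Hl => l'; rewrite /vt /bt /nt /rt; lia.
  + by rewrite Hf; apply: T2 => //; exact: idx_lt.
Qed.

End Evaluation.

(** * Building rulers of doubly exponential length *)

Definition dexp (n : nat) : nat := 2 ^ (2 ^ (10 * n + 10)).

Definition WRS (v : sym) (l : seq nat) (p : prog) : prog := foldr (fun i => Seq (Wr i v)) p l.
Definition MVRS (l : seq nat) (p : prog) : prog := foldr (fun i => Seq (MvR i)) p l.
(** Tape [a] carries x symbols and its head is just behind them. The head of [b] counts x while that
    of [a] runs back; after the return to the end, one symbol is appended for each unit of [b]. *)
Definition DOUBLE a b :=
  Seq (MvL a) (Seq (Until a mrk (Seq (MvL a) (MvR b)))
    (Seq (MvR a) (Seq (Until a None (MvR a))
      (Until b mrk (Seq (Wr a sym1) (Seq (MvR a) (MvL b))))))).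
Definition DOUBLES a b k p := iter k (Seq (DOUBLE a b)) p.
Definition START i p := Seq (MvR i) (Seq (Wr i sym1) (Seq (MvR i) p)).
(** Ten doublings per input bit and ten more produce 2^(10n+10) symbols on tape 2; that many
    doublings produce N symbols on tape 3, which are then copied to all tapes from 5 on. The last
    move puts the flag's head on cell 1. *)
Definition SETUP K p :=
  Seq (MvL 0) (WRS mrk (iota 0 K.+1) (START 2 (Seq (MvR 0)
    (Seq (Until 0 None (DOUBLES 2 4 10 (MvR 0))) (DOUBLES 2 4 10
  (START 3 (Seq (MvL 2) (Seq (Until 2 mrk (Seq (DOUBLE 3 4) (MvL 2)))
  (Seq (MvL 3) (MVRS (iota 5 (K - 4))
    (Seq (Until 3 mrk (WRS sym1 (iota 5 (K - 4)) (MVRS (iota 5 (K - 4)) (MvL 3))))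
  (Seq (MvR 1) p)))))))))))).

Lemma wp_wrs v l p c (Q : st -> Prop) s : uniq l ->
  wp p c Q (St (fun i => if i \in l then upd (ct s i) (hd s i) v else ct s i) (hd s)) ->
  wp (WRS v l p) (size l + c) Q s.
Proof.
elim: l s => [|i l IH] s /=.
  by move=> _; case: s.
move=> /andP[ni ul] H; apply: (wp_cost (c := 1 + (size l + c))); last by rewrite add1n addSn.
apply: wp_seq; apply: wp_wr; apply: IH => //; move: H; congr (wp p c Q).
congr St; apply: funext => j; rewrite inE /upd /=; case: (j =P i) => [->|_] //=.
by rewrite (negbTE ni).
Qed.

Lemma wp_mvrs l p c (Q : st -> Prop) s : uniq l ->
  wp p c Q (St (ct s) (fun i => (i \in l) + hd s i)) ->
  wp (MVRS l p) (size l + c) Q s.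
Proof.
elim: l s => [|i l IH] s /=.
  by move=> _; case: s.
move=> /andP[ni ul] H; apply: (wp_cost (c := 1 + (size l + c))); last by rewrite add1n addSn.
apply: wp_seq; apply: wp_mvr; apply: IH => //; move: H; congr (wp p c Q).
congr St; apply: funext => j; rewrite inE /upd /=; case: (j =P i) => [->|_] //=.
by rewrite (negbTE ni).
Qed.

Definition rul (x j : nat) : sym := if j == 0 then mrk else if j <= x then sym1 else None.

Lemma rul_mrk x j : (rul x j == mrk) = (j == 0).
Proof. by rewrite /rul; case: j => //= j; case: ifP. Qed.

Lemma rul_None x j : (rul x j == None) = (x < j).
Proof. by rewrite /rul; case: j => //= j; rewrite (ltnNge x); case: ifP. Qed.

Lemma rul_snoc x : upd (rul x) x.+1 sym1 = rul x.+1.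
Proof.
apply: funext => j; rewrite /upd /rul; case: (j =P x.+1) => [->|n]; first by rewrite /= leqnn.
by case: j n => //= j n; have -> : (j < x.+1) = (j < x) by lia.
Qed.

Lemma upd_upd T (h : nat -> T) i u v : upd (upd h i u) i v = upd h i v.
Proof. by apply: funext => j; rewrite /upd; case: eqP. Qed.

Lemma upd_id T (h : nat -> T) i v : h i = v -> upd h i v = h.
Proof. by move=> <-; apply: funext => j; rewrite /upd; case: eqP => // ->. Qed.

Lemma upd_comm T (h : nat -> T) i j u v : i != j -> upd (upd h i u) j v = upd (upd h j v) i u.
Proof.
move=> nij; apply: funext => k; rewrite /upd; case: (k =P j) => // ->.
by rewrite eq_sym (negbTE nij).
Qed.

Lemma upd_eq T (h : nat -> T) i v : upd h i v i = v.
Proof. by rewrite /upd eqxx. Qed.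

Lemma upd_ne T (h : nat -> T) i j v : j != i -> upd h i v j = h j.
Proof. by rewrite /upd => /negbTE->. Qed.

Lemma wp_double a b x s (Q : st -> Prop) : a != b ->
  ct s a = rul x -> hd s a = x.+1 -> (forall j, (ct s b j == mrk) = (j == 0)) ->
  hd s b = 0 ->
  Q (St (upd (ct s) a (rul (2 * x))) (upd (hd s) a (2 * x).+1)) ->
  wp (DOUBLE a b) (15 * x + 10) Q s.
Proof.
move=> nab Ca Ha Cb Hb HQ; have nba : b != a by rewrite eq_sym.
pose S1 k := St (ct s) (upd (upd (hd s) a (x - k)) b k).
pose S2 k := St (ct s) (upd (upd (hd s) a k) b x).
pose S3 k := St (upd (ct s) a (rul (x + k))) (upd (upd (hd s) a (x + k).+1) b (x - k)).
have c1 k : (cursym (S1 k) a == mrk) = (x - k == 0).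
  by rewrite /cursym /S1 /= Ca upd_ne // upd_eq rul_mrk.
have c2 k : (cursym (S2 k) a == None) = (x < k).
  by rewrite /cursym /S2 /= Ca upd_ne // upd_eq rul_None.
have c3 k : (cursym (S3 k) b == mrk) = (x - k == 0).
  by rewrite /cursym /S3 /= upd_eq upd_ne // Cb.
apply: (wp_cost (c := 1 + (x * (1 + 1 + 2) + 1 + (1 + (x * (1 + 2) + 1 + (x * (1 + (1 + 1) + 2) + 1))))));
  last lia.
apply: wp_seq; apply: wp_mvl; rewrite Ha //.
have -> : St (ct s) (upd (hd s) a x.+1.-1) = S1 0.
  by rewrite /S1 subn0 (upd_id (i := b)) // upd_ne.
apply: wp_seq.
apply: (wp_until (I := fun k s' => k <= x /\ s' = S1 (x - k))) => [|k _ [le_k ->] /eqP|k _ [le_k ->] /eqP].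
- by split=> //; rewrite subnn.
- rewrite c1 => Hk; have -> : x - k = x by lia.
  apply: wp_seq; apply: wp_mvr.
  have -> : St (ct (S1 x)) (upd (hd (S1 x)) a (hd (S1 x) a).+1) = S2 1.
    rewrite /S1 /S2 /= subnn; congr St.
    by rewrite (upd_comm _ _ _ nba) upd_upd upd_ne // upd_eq.
  apply: wp_seq.
  apply: (wp_until (I := fun k s' => k <= x /\ s' = S2 (x.+1 - k))) => [|k' _ [le_k' ->] /eqP|k' _ [le_k' ->] /eqP].
  + by split=> //; congr S2; lia.
  + rewrite c2 => Hk'; have -> : x.+1 - k' = x.+1 by lia.
    apply: (wp_until (I := fun k s' => k <= x /\ s' = S3 (x - k))) => [|k2 _ [le_k2 ->] /eqP|k2 _ [le_k2 ->] /eqP].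
    * by split=> //; rewrite /S2 /S3 subnn addn0 subn0 (upd_id (v := rul x)).
    * rewrite c3 => Hk2; have E : x - k2 = x by lia.
      move: HQ; congr Q; rewrite /S3 E subnn addnn mul2n; congr St.
      by rewrite (upd_id (i := b)) // upd_ne.
    rewrite c3 => Hk2; apply: wp_seq; apply: wp_wr; apply: wp_seq; apply: wp_mvr.
    have ha : hd (S3 (x - k2)) a = (x + (x - k2)).+1 by rewrite /= upd_ne // upd_eq.
    have hb : hd (S3 (x - k2)) b = k2 by rewrite /= upd_eq; lia.
    apply: wp_mvl => /=; first by rewrite upd_ne // upd_eq; lia.
    exists k2.-1; first lia.
    split; first lia.
    rewrite !(upd_ne _ _ nab) !upd_eq upd_ne // upd_eq upd_upd rul_snoc -addnS.
    have -> : (x - k2).+1 = x - k2.-1 by lia.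
    congr St; rewrite (upd_comm _ _ _ nba) upd_upd upd_upd; congr upd; lia.
  rewrite c2 => Hk'; apply: wp_mvr; exists k'.-1; first lia.
  split; first lia.
  rewrite /S2 /= upd_ne // upd_eq; congr St; rewrite (upd_comm _ _ _ nba) upd_upd; congr upd.
  by congr upd; lia.
rewrite c1 => Hk; apply: wp_seq; apply: wp_mvl => /=; first by rewrite upd_ne // upd_eq; lia.
apply: wp_mvr => /=; exists k.-1; first lia.
split; first lia.
rewrite /S1 (upd_ne _ _ nab) !upd_eq upd_ne // upd_eq.
rewrite (upd_comm _ _ _ nba) !upd_upd; congr St; congr upd; last lia.
by congr upd; lia.
Qed.

Lemma wp_doubles a b k p c x s (Q : st -> Prop) : a != b ->
  ct s a = rul x -> hd s a = x.+1 -> (forall j, (ct s b j == mrk) = (j == 0)) ->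
  hd s b = 0 ->
  wp p c Q (St (upd (ct s) a (rul (2 ^ k * x))) (upd (hd s) a (2 ^ k * x).+1)) ->
  wp (DOUBLES a b k p) (k * (15 * (2 ^ k * x) + 10) + c) Q s.
Proof.
move=> nab; have nba : b != a by rewrite eq_sym.
elim: k x s => [|k IH] x s Ca Ha Cb Hb.
  by rewrite mul1n !upd_id //; case: s {Ca Ha Cb Hb}.
move=> H; apply: (wp_cost (c := (15 * x + 10) + (k * (15 * (2 ^ k * (2 * x)) + 10) + c))).
  apply: wp_seq; apply: (wp_double nab Ca Ha Cb Hb); apply: IH.
  - by rewrite /= upd_eq.
  - by rewrite /= upd_eq.
  - by move=> j; rewrite /= upd_ne.
  - by rewrite /= upd_ne.
  by move: H; rewrite /= !upd_upd (mulnA (2 ^ k)) -expnSr.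
rewrite (mulnA (2 ^ k)) -expnSr.
have : x <= 2 ^ k.+1 * x by rewrite leq_pmull // expn_gt0.
by move: (2 ^ k.+1 * x) => P le_x; rewrite mulSn; lia.
Qed.

Section Setup.

Variables (K : nat) (w : seq bool) (N X : nat).
Hypotheses (K_gt : 4 < K) (EX : X = 2 ^ (10 * size w + 10)) (EN : N = 2 ^ X).

Definition cS x2 x3 y (i : nat) : nat -> sym :=
  if i == 0 then fun j => if j is j'.+1 then inp w j' else mrk
  else if i == 2 then rul x2 else if i == 3 then rul x3
  else if i < 5 then rul 0 else if i <= K then rul y else rul N.

Definition hS h0 h1 h2 h3 g (i : nat) : nat :=
  if i == 0 then h0 else if i == 1 then h1 else if i == 2 then h2
  else if i == 3 then h3 else if 4 < i <= K then g else 0.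

Ltac updfun := apply: funext => i; rewrite /upd /cS /hS; repeat (case: eqP => ?); subst;
  first [done | lia | congruence].

Lemma cS2 x2 x3 y z : upd (cS x2 x3 y) 2 (rul z) = cS z x3 y. Proof. updfun. Qed.
Lemma cS3 x2 x3 y z : upd (cS x2 x3 y) 3 (rul z) = cS x2 z y. Proof. updfun. Qed.
Lemma hS0 h0 h1 h2 h3 g v : upd (hS h0 h1 h2 h3 g) 0 v = hS v h1 h2 h3 g. Proof. updfun. Qed.
Lemma hS1 h0 h1 h2 h3 g v : upd (hS h0 h1 h2 h3 g) 1 v = hS h0 v h2 h3 g. Proof. updfun. Qed.
Lemma hS2 h0 h1 h2 h3 g v : upd (hS h0 h1 h2 h3 g) 2 v = hS h0 h1 v h3 g. Proof. updfun. Qed.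
Lemma hS3 h0 h1 h2 h3 g v : upd (hS h0 h1 h2 h3 g) 3 v = hS h0 h1 h2 v g. Proof. updfun. Qed.

Lemma inp_None j : (inp w j == None) = (size w <= j).
Proof.
rewrite /inp; case: leqP => Hj; last by rewrite (nth_map false).
by rewrite nth_default // size_map.
Qed.

Lemma inp_mrk j : (inp w j == mrk) = false.
Proof.
rewrite /inp; case: (ltnP j (size w)) => Hj; first by rewrite (nth_map false).
by rewrite nth_default // size_map.
Qed.

Lemma cS_mrk x2 x3 y i j : (cS x2 x3 y i j == mrk) = (j == 0).
Proof.
rewrite /cS; repeat (case: ifP => _); rewrite ?rul_mrk //.
by case: j => //= j; rewrite inp_mrk.
Qed.

Lemma gwf_setup B M : N ^ 3 + 2 <= B -> size w + 2 <= N ->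
  gwf w N B M (St (cS X N N) (hS (size w).+1 1 0 0 N.+1)).
Proof.
move=> le_B le_w; have NB : N + 2 <= B by move: le_B; rewrite !expnS expn0; nia.
split=> //=.
- exact: cS_mrk.
- move=> l i _ Hi j le_j; have -> : cS X N N i = rul N.
    rewrite /cS; move: Hi; rewrite /vt /nt => Hi.
    do 4 (case: ifP => [|_]; first by lia).
    by case: ifP.
  by rewrite rul_None; lia.
- by move=> i; rewrite /hS; repeat (case: ifP => _); lia.
Qed.

Definition csetup : nat :=
  K + 20 + size w * (10 * (15 * X + 10) + 3) + 10 * (15 * X + 10) +
  X * (15 * N + 13) + K + N * (K + K + 3).

(** Programs work on infinitely many tapes, the machine only on those up to [K]. The others are
    taken to be finished rulers from the start, so that [gwf] can be stated for all tapes. *)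
Lemma wp_setup B M p c s0 (Q : st -> Prop) :
  N ^ 3 + 2 <= B -> size w + 2 <= N -> starts_on K w s0 ->
  (forall i, K < i -> ct s0 i = rul N /\ hd s0 i = 0) ->
  (forall s, gwf w N B M s -> wp p c Q s) -> wp (SETUP K p) (csetup + c) Q s0.
Proof.
move=> le_B le_w H0 H1 HQ; have szw := size_iota.
have [l5 u5] : size (iota 5 (K - 4)) = K - 4 /\ uniq (iota 5 (K - 4)).
  by rewrite size_iota iota_uniq.
have m5 i : (i \in iota 5 (K - 4)) = (4 < i <= K) by rewrite mem_iota; lia.
apply: (wp_cost (c :=
  1 + (size (iota 0 K.+1) + (1 + (1 + (1 + (1 + (size w * ((10 * (15 * X + 10) + 1) + 2) + 1
  + (10 * (15 * X + 10) + (1 + (1 + (1 + (1 + (X * ((15 * N + 10 + 1) + 2) + 1 + (1 + (size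
  (iota 5 (K - 4)) + (N * ((size (iota 5 (K - 4)) + (size (iota 5 (K - 4)) + 1)) + 2) + 1 +
  (1 + c))))))))))))))))));
  last by rewrite /csetup l5 size_iota; lia.
apply: wp_seq; apply: wp_mvl; first by case: (H0 0 isT) => _ ->.
apply: wp_wrs; first exact: iota_uniq.
set s1 := St _ _; have -> : s1 = St (cS 0 0 0) (hS 0 0 0 0 0).
  rewrite /s1; congr St; apply: funext => i; last first.
    rewrite /= /upd /hS; case: eqP => [_|ni]; first by case: (H0 0 isT) => _ ->.
    have -> : hd s0 i = 0.
      case: (leqP i K) => Hi; last by case: (H1 i Hi).
      by case: (H0 i Hi) => _ ->; lia.
    by repeat (case: ifP => _).
  rewrite mem_iota add0n /=; case: (leqP i K) => Hi; last first.
    have [-> _] := H1 i Hi; have -> : (i < K.+1) = false by lia.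
    rewrite /cS; do 4 (case: ifP => [|_]; first by lia).
    by case: ifP => //; lia.
  have [Hc Hh] := H0 i Hi.
  have -> : upd (hd s0) 0 (hd s0 0).-1 i = 0.
    by case: (H0 0 isT) => _ E0; rewrite /upd E0 Hh; case: eqP.
  rewrite ltnS Hi; apply: funext => j; rewrite /upd Hc /cS /rul.
  by case: (i == 0); case: j => [|j] //=; rewrite ?ltn0 ?Hi; repeat (case: ifP => //=).
apply: wp_seq; apply: wp_mvr; rewrite [ct _]/= [hd _]/= hS2.
apply: wp_seq; apply: wp_wr; rewrite [ct _]/= [hd _]/=.
have -> : upd (cS 0 0 0) 2 (upd (cS 0 0 0 2) (hS 0 0 (hS 0 0 0 0 0 2).+1 0 0 2) sym1) = cS 1 0 0.
  by rewrite -[RHS](cS2 0) -rul_snoc.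
apply: wp_seq; apply: wp_mvr; rewrite [ct _]/= [hd _]/= hS2.
apply: wp_seq; apply: wp_mvr; rewrite [ct _]/= [hd _]/= hS0.
have X_gt0 : 0 < X by rewrite EX expn_gt0.
have D10 k : k < size w -> 2 ^ 10 * 2 ^ (10 * k) <= X.
  by move=> Hk; rewrite -expnD EX leq_exp2l //; lia.
apply: wp_seq.
apply: (wp_until (I := fun k s => k <= size w /\
    s = St (cS (2 ^ (10 * (size w - k))) 0 0)
      (hS (size w - k).+1 0 (2 ^ (10 * (size w - k))).+1 0 0)))
  => [|k _ [le_k ->]|k _ [le_k ->] Hc].
- by split=> //; rewrite subnn.
- rewrite /cursym /= => /eqP; rewrite inp_None => Hk.
  have -> : size w - k = size w by lia.
  have EXn : 2 ^ 10 * 2 ^ (10 * size w) = X by rewrite EX -expnD addnC.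
  rewrite -{1}EXn; apply: (@wp_doubles 2 4 10 _ _ (2 ^ (10 * size w))) => //.
    by move=> j; rewrite /= cS_mrk.
  rewrite [ct _]/= [hd _]/= cS2 hS2 EXn.
  apply: wp_seq; apply: wp_mvr; rewrite [ct _]/= [hd _]/= hS3.
  apply: wp_seq; apply: wp_wr; rewrite [ct _]/= [hd _]/=.
  set h3 := hS _ _ _ _ _.
  have -> : upd (cS X 0 0) 3 (upd (cS X 0 0 3) (h3 3) sym1) = cS X 1 0.
    by rewrite -[RHS](cS3 _ 0) -rul_snoc.
  rewrite /h3; apply: wp_seq; apply: wp_mvr; rewrite [ct _]/= [hd _]/= hS3.
  apply: wp_seq; apply: wp_mvl; rewrite ?[ct _]/= ?[hd _]/= ?hS2 //.
  apply: wp_seq.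
  apply: (wp_until (I := fun k s => k <= X /\
      s = St (cS X (2 ^ (X - k)) 0) (hS (size w).+1 0 k (2 ^ (X - k)).+1 0)))
    => [|k' _ [le_k' ->]|k' _ [le_k' ->] Hc].
  + by split=> //; rewrite subnn.
  + move=> /eqP; rewrite /cursym cS_mrk => /eqP E0; have {E0}-> : k' = 0 by exact: E0.
    rewrite subn0 -EN.
    apply: wp_seq; apply: wp_mvl; rewrite ?[ct _]/= ?[hd _]/= ?hS3 //.
    apply: wp_mvrs => //; rewrite ?[ct _]/= ?[hd _]/=.
    have -> : (fun i => (i \in iota 5 (K - 4)) + hS (size w).+1 0 0 N 0 i)
        = hS (size w).+1 0 0 N 1.
      by apply: funext => i; rewrite m5 /hS; repeat (case: eqP => ?); subst; try done; case: ifP.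
    apply: wp_seq.
    apply: (wp_until (I := fun k s => k <= N /\
        s = St (cS X N (N - k)) (hS (size w).+1 0 0 k (N - k).+1)))
      => [|k2 _ [le_k2 ->]|k2 _ [le_k2 ->] Hc].
    * by split=> //; rewrite subnn.
    * move=> /eqP; rewrite /cursym cS_mrk => /eqP E0; have {E0}-> : k2 = 0 by exact: E0.
      rewrite subn0; apply: wp_seq; apply: wp_mvr; rewrite [ct _]/= [hd _]/= hS1.
      by apply: HQ; exact: gwf_setup.
    have k2_gt0 : 0 < k2.
      by rewrite lt0n; apply/eqP => E0; apply: Hc; apply/eqP; rewrite /cursym cS_mrk E0.
    apply: wp_wrs => //; apply: wp_mvrs => //; rewrite [ct _]/= [hd _]/=.
    apply: wp_mvl => [|/=]; first by rewrite /= m5.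
    exists k2.-1; first lia.
    split; first lia.
    have E2 : N - k2.-1 = (N - k2).+1 by lia.
    rewrite E2; congr St; apply: funext => i /=.
      rewrite m5; case: ifP => Hi; last first.
        by rewrite /cS; case: (ltnP i 5) => H5 //; case: (leqP i K) => HK //; lia.
      have [n0 n1 n2 n3 n4] : [/\ (i == 0) = false, (i == 1) = false, (i == 2) = false,
          (i == 3) = false & (i < 5) = false] by split; lia.
      have leK : i <= K by lia.
      by rewrite /cS /hS n0 n1 n2 n3 n4 Hi leK -rul_snoc.
    rewrite !m5 /upd /hS; case: (i =P 3) => [->|_] //=.
    by rewrite m5; repeat (case: eqP => [->|_] //=); case: ifP.
  have k'_gt0 : 0 < k'.
    by rewrite lt0n; apply/eqP => E0; apply: Hc; apply/eqP; rewrite /cursym cS_mrk E0.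
  have leN : 2 * 2 ^ (X - k') <= N by rewrite -expnS EN leq_exp2l //; lia.
  apply: wp_seq; apply: (wp_cost (c := 15 * 2 ^ (X - k') + 10)); last by nia.
  apply: (@wp_double 3 4 (2 ^ (X - k'))) => //.
    by move=> j; rewrite /= cS_mrk.
  rewrite [ct _]/= [hd _]/= cS3 hS3.
  apply: wp_mvl => //; rewrite ?[ct _]/= ?[hd _]/= ?hS2; exists k'.-1; first lia.
  split; first lia.
  have -> : X - k'.-1 = (X - k').+1 by lia.
  by rewrite expnS.
have Hk : 0 < k.
  by rewrite lt0n; apply/eqP => E0; apply: Hc; apply/eqP; rewrite /cursym /= inp_None E0 subn0.
have le10 := D10 (size w - k) ltac:(lia).
apply: (wp_cost (c := 10 * (15 * (2 ^ 10 * 2 ^ (10 * (size w - k))) + 10) + 1)); last by lia.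
apply: (@wp_doubles 2 4 10 _ _ (2 ^ (10 * (size w - k)))) => //.
  by move=> j; rewrite /= cS_mrk.
rewrite [ct _]/= [hd _]/= cS2 hS2; apply: wp_mvr; rewrite [ct _]/= [hd _]/= hS0.
exists k.-1; first lia.
split; first lia.
have -> : size w - k.-1 = (size w - k).+1 by lia.
by rewrite -expnD mulnS.
Qed.

End Setup.

Fixpoint maxtape (p : prog) : nat :=
  match p with
  | Wr i _ | MvL i | MvR i => i
  | Seq p q => maxn (maxtape p) (maxtape q)
  | If i _ p q => maxn i (maxn (maxtape p) (maxtape q))
  | Until i _ p => maxn i (maxtape p)
  end.

Lemma tapes_leP K p : maxtape p <= K -> tapes_le K p.
Proof. by elim: p => //= *; lia. Qed.

Lemma tapes_le_wrs K v l p : all (leq^~ K) l -> tapes_le K p -> tapes_le K (WRS v l p).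
Proof. by move=> + Hp; elim: l => //= i l IH /andP[-> /IH->]. Qed.

Lemma tapes_le_mvrs K l p : all (leq^~ K) l -> tapes_le K p -> tapes_le K (MVRS l p).
Proof. by move=> + Hp; elim: l => //= i l IH /andP[-> /IH->]. Qed.

Lemma tapes_le_seq K p q : tapes_le K p -> tapes_le K q -> tapes_le K (Seq p q).
Proof. by move=> /= -> ->. Qed.

Lemma tapes_le_setup K p : 4 < K -> tapes_le K p -> tapes_le K (SETUP K p).
Proof.
move=> K_gt Hp.
have l0 : all (leq^~ K) (iota 0 K.+1) by apply/allP => i; rewrite mem_iota; lia.
have l5 : all (leq^~ K) (iota 5 (K - 4)) by apply/allP => i; rewrite mem_iota; lia.
have HU i a q : i <= K -> tapes_le K q -> tapes_le K (Until i a q) by move=> /= -> ->.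
have HD a b k q : a <= K -> b <= K -> tapes_le K q -> tapes_le K (DOUBLES a b k q).
  by move=> Ha Hb Hq; elim: k => //= k ->; rewrite Ha Hb.
have HL i : i < 5 -> tapes_le K (MvL i) by move=> /=; lia.
have HR i : i < 5 -> tapes_le K (MvR i) by move=> /=; lia.
have HW i a : i < 5 -> tapes_le K (Wr i a) by move=> /=; lia.
rewrite /SETUP /START; repeat first [ exact: Hp | exact: HL | exact: HR | exact: HW
  | apply: tapes_le_wrs; first exact: l0 | apply: tapes_le_wrs; first exact: l5
  | apply: tapes_le_mvrs; first exact: l5 | apply: HU; first lia
  | apply: HD; [lia|lia|] | by rewrite /=; lia | apply: tapes_le_seq ].
Qed.

(** * Polynomial bounds on the running time *)

Definition polybound (f : nat -> nat) : Prop := exists d, forall N, 2 <= N -> f N <= N ^ d.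

Lemma pb_const c : polybound (fun=> c).
Proof.
exists c => N le_N; apply: (@leq_trans (2 ^ c)); first exact/ltnW/ltn_expl.
by case: c => // c; rewrite leq_exp2r.
Qed.

Lemma pb_id : polybound id.
Proof. by exists 1. Qed.

Lemma pb_mul f g : polybound f -> polybound g -> polybound (fun N => f N * g N).
Proof.
by move=> [a Ha] [b Hb]; exists (a + b) => N le_N; rewrite expnD leq_mul ?Ha ?Hb.
Qed.

Lemma pb_add f g : polybound f -> polybound g -> polybound (fun N => f N + g N).
Proof.
move=> [a Ha] [b Hb]; exists (a + b).+1 => N le_N.
have [le1 le2] : N ^ a <= N ^ (a + b) /\ N ^ b <= N ^ (a + b).
  by split; rewrite leq_pexp2l //; lia.
have := Ha N le_N; have := Hb N le_N; rewrite expnS.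
by move: (N ^ a) (N ^ b) (N ^ (a + b)) le1 le2 => x y z; nia.
Qed.

Ltac pbtac := rewrite /cLT /cINP /cREAD /cTIMES /cCOPY /cFOR ?expnS ?expn0;
  repeat first [exact: pb_const | exact: pb_id | apply: pb_add | apply: pb_mul].

Lemma pb_cst phi : polybound (fun N => cst N (N ^ 3 + 2) phi).
Proof.
elim: phi => [i j|b i|i j k|phi IH|phi IH psi IH'|phi IH|phi IH i j k] /=;
  by pbtac.
Qed.

Definition csetup_le (K N : nat) : nat :=
  K + 20 + N * (10 * (15 * N + 10) + 3) + 10 * (15 * N + 10) +
  N * (15 * N + 13) + K + N * (K + K + 3).

Lemma csetup_bound K w N X : size w <= N -> X <= N -> csetup K w N X <= csetup_le K N.
Proof.
by move=> le_w le_X; rewrite /csetup /csetup_le !leq_add ?leq_mul ?leq_add ?leq_mul.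
Qed.

Lemma form_in_2EXPTIME phi (R : rel3) (e : nat -> nat) (L : seq bool -> Prop) :
  wff phi 0 false -> (forall w, L w <-> holds w (dexp (size w)) phi R e) ->
  in_2EXPTIME L.
Proof.
move=> W HL.
pose q := evalp phi 0 0; pose K := maxn 5 (maxtape q).
have [d Hd] : polybound (fun N => csetup_le K N + (cst N (N ^ 3 + 2) phi + 1)).
  apply: pb_add; last by apply: pb_add; [exact: pb_cst|exact: pb_const].
  by rewrite /csetup_le; pbtac.
exists (machine (compile (SETUP K q) 0) K 1).
(* The running time is at most N^d, that is, 2 to the power d 2^(10n+10); the factor d < 2^d is
   absorbed into the second exponent. *)
exists (10%:P * 'X + (10 + d)%:P)%R.
have K_gt : 4 < K by rewrite /K; lia.
apply: machine_decides => [||w]; first exact/tapes_le_setup/tapes_leP/leq_maxr.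
  by lia.
rewrite !hornerE /=.
pose n := size w; pose X := 2 ^ (10 * n + 10); pose N := 2 ^ X.
have ltX : 10 * n + 10 < X by exact: ltn_expl.
have ltN : X < N by exact: ltn_expl.
pose B := N ^ 3 + 2.
pose s0 := St (fun i => if i <= K then
    (fun j => if (i == 0) && (0 < j) then inp w j.-1 else None) else rul N)
  (fun i => if i <= K then (i == 0 : nat) else 0).
have H0 : starts_on K w s0.
  by move=> i Hi; rewrite /s0 /= Hi; split.
have H1 i : K < i -> ct s0 i = rul N /\ hd s0 i = 0.
  by rewrite ltnNge /s0 /= => /negbTE->.
have N_gt0 : 0 < N by lia.
have le_w : size w + 2 <= N by lia.
have HQ s : gwf w N B (depth phi) s -> wp q (cst N B phi) (fun s' => cursym s' 1 = sym1 <-> L w) s.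
  move=> g; apply: wp_mono (evalp_correct (M := depth phi) (b := false) (R := R) (e := e)
    N_gt0 (leqnn _) W _ _ g _ _) (leqnn _) _ => // s' [_ _ ->]; rewrite HL; exact: iff_refl.
have [m [s [He le_m Hs]]] :=
  wp_setup K_gt (erefl X) (erefl N) (leqnn B) le_w H0 H1 HQ.
exists s0, m, s; split=> //.
apply: leq_trans (_ : N ^ d <= _).
  apply: leq_trans (Hd N _); last lia.
  rewrite addnA addn1 ltnS; apply: leq_trans le_m _; rewrite leq_add2r.
  by apply: csetup_bound; lia.
rewrite -expnM leq_exp2l //.
set r := (X in _ <= 2 ^ X); have -> : r = (10 * n + 10) + d by rewrite /r /n; lia.
by rewrite expnD leq_mul2l (ltnW (ltn_expl d _)) ?orbT.
Qed.

(** * Definability *)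

Definition NN (w : seq bool) : nat := dexp (size w).

Lemma NN_gt w : 2 < NN w.
Proof. by apply: (@leq_trans (2 ^ 2)) => //; rewrite leq_exp2l // -[2]/(2 ^ 1) leq_exp2l //; lia. Qed.

Definition env : Type := nat -> nat.
Definition valid (w : seq bool) (e : env) : Prop := forall i, e i < NN w.

Lemma valid_scons w a e : a < NN w -> valid w e -> valid w (scons a e).
Proof. by move=> Ha He [|i] /=. Qed.

(** The formula is uniform in [w] and may mention one relation symbol, so that the bodies of
    iterations can be composed from definable pieces. *)
Definition Def (P : seq bool -> rel3 -> env -> Prop) : Prop :=
  exists phi, forall w R e, valid w e -> (P w R e <-> holds w (NN w) phi R e).

(** Terms are not part of the language: a term is given by its graph, with the value in variable 0
    and the arguments shifted. Values stay below N so that a quantifier can reach them. *)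
Definition DT (f : seq bool -> env -> nat) : Prop :=
  (forall w e, valid w e -> f w e < NN w) /\
  Def (fun w R e => f w (fun i => e i.+1) = e 0).

Lemma Def_ext P Q : (forall w R e, valid w e -> (P w R e <-> Q w R e)) -> Def Q -> Def P.
Proof. by move=> E [phi H]; exists phi => w R e He; rewrite E // H. Qed.

Definition up (s : nat -> nat) (i : nat) : nat := if i is j.+1 then (s j).+1 else 0.

Fixpoint ren (s : nat -> nat) (phi : form) : form :=
  match phi with
  | FLt i j => FLt (s i) (s j)
  | FInp b i => FInp b (s i)
  | FRel i j k => FRel (s i) (s j) (s k)
  | FNot phi => FNot (ren s phi)
  | FAnd phi psi => FAnd (ren s phi) (ren s psi)
  | FEx phi => FEx (ren (up s) phi)
  | FIter phi i j k => FIter (ren (up (up (up s))) phi) (s i) (s j) (s k)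
  end.

Lemma scons_up s a (e : env) : (fun i => scons a e (up s i)) = scons a (fun i => e (s i)).
Proof. by apply: funext => -[|i]. Qed.

Lemma holds_ren w N phi s R e :
  holds w N (ren s phi) R e <-> holds w N phi R (fun i => e (s i)).
Proof.
elim: phi s R e => [i j|b i|i j k|phi IH|phi IH psi IH'|phi IH|phi IH i j k] s R e //=.
- by have := IH s R e; tauto.
- by have := IH s R e; have := IH' s R e; tauto.
- by split=> -[a lt_a H]; exists a => //; have := IH (up s) R (scons a e);
    rewrite scons_up; tauto.
have -> : (fun Q x y z => holds w N (ren (up (up (up s))) phi) Q (scons x (scons y (scons z e))))
  = (fun Q x y z => holds w N phi Q (scons x (scons y (scons z (fun i => e (s i)))))); last by [].
apply: funext => Q; apply: funext => x; apply: funext => y; apply: funext => z.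
apply: propext; have := IH (up (up (up s))) Q (scons x (scons y (scons z e))).
by rewrite (scons_up _ x) (scons_up _ y) (scons_up _ z).
Qed.

Lemma Def_ren P s : Def P -> Def (fun w R e => P w R (fun i => e (s i))).
Proof.
move=> [phi H]; exists (ren s phi) => w R e He; rewrite holds_ren -H // => i; exact: He.
Qed.

Lemma DT_ren f s : DT f -> DT (fun w e => f w (fun i => e (s i))).
Proof.
move=> [Hb Hf]; split=> [w e He|]; first by apply: Hb => i; exact: He.
exact: (Def_ren (up s) Hf).
Qed.

Lemma Def_and P Q : Def P -> Def Q -> Def (fun w R e => P w R e /\ Q w R e).
Proof.
by move=> [p Hp] [q Hq]; exists (FAnd p q) => w R e He; rewrite Hp // Hq.
Qed.

Lemma Def_not P : Def P -> Def (fun w R e => ~ P w R e).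
Proof. by move=> [p Hp]; exists (FNot p) => w R e He; rewrite Hp. Qed.

Lemma Def_or P Q : Def P -> Def Q -> Def (fun w R e => P w R e \/ Q w R e).
Proof.
move=> DP DQ; apply: (Def_ext _ (Def_not (Def_and (Def_not DP) (Def_not DQ)))).
move=> w R e _; split=> [[] H []//|]; have [] := pselect (P w R e); first by left.
by have [] := pselect (Q w R e); [right|move=> nQ nP /(_ (conj nP nQ))].
Qed.

Lemma Def_imp P Q : Def P -> Def Q -> Def (fun w R e => P w R e -> Q w R e).
Proof.
move=> DP DQ; apply: (Def_ext _ (Def_not (Def_and DP (Def_not DQ)))) => w R e _.
split=> [H [p nq]|H p]; first exact/nq/H.
by have [//|nq] := pselect (Q w R e); case: H.
Qed.

Lemma Def_iff P Q : Def P -> Def Q -> Def (fun w R e => P w R e <-> Q w R e).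
Proof. by move=> DP DQ; apply: Def_and; apply: Def_imp. Qed.

Lemma Def_ex (Q : seq bool -> rel3 -> nat -> env -> Prop) :
  Def (fun w R e => Q w R (e 0) (fun i => e i.+1)) ->
  Def (fun w R e => exists2 a, a < NN w & Q w R a e).
Proof.
move=> [q Hq]; exists (FEx q) => w R e He.
by split=> -[a lt_a H]; exists a => //; apply/(Hq w R (scons a e) (valid_scons lt_a He)).
Qed.

Lemma Def_all (Q : seq bool -> rel3 -> nat -> env -> Prop) :
  Def (fun w R e => Q w R (e 0) (fun i => e i.+1)) ->
  Def (fun w R e => forall a, a < NN w -> Q w R a e).
Proof.
move=> DQ; apply: (Def_ext _ (Def_not (@Def_ex (fun w R a e => ~ Q w R a e) (Def_not DQ)))).
move=> w R e He; split=> [H [a /H Ha]//|H a lt_a].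
by have [//|nq] := pselect (Q w R a e); case: H; exists a.
Qed.

Lemma Def_ltv i j : Def (fun w R e => e i < e j).
Proof. by exists (FLt i j). Qed.

Lemma Def_eqv i j : Def (fun w R e => e i = e j).
Proof.
apply: (Def_ext _ (Def_and (Def_not (Def_ltv i j)) (Def_not (Def_ltv j i)))) => w R e _.
by split=> [->|[]]; [split; rewrite ltnn|lia].
Qed.

Lemma DT_var i : DT (fun w e => e i).
Proof. by split=> [w e He|]; [exact: He|exact: Def_eqv]. Qed.

Lemma Def_let (f : seq bool -> env -> nat) (Q : seq bool -> rel3 -> nat -> env -> Prop) :
  DT f -> Def (fun w R e => Q w R (e 0) (fun i => e i.+1)) ->
  Def (fun w R e => Q w R (f w e) e).
Proof.
move=> [Hb Hf] HQ.
apply: (Def_ext _ (@Def_ex (fun w R a e => f w e = a /\ Q w R a e) (Def_and Hf HQ))).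
move=> w R e He; split=> [H|[a _ [<-]]//].
by exists (f w e); [exact: Hb|].
Qed.

Lemma foldr_sconsE (l : seq nat) (e : env) i :
  foldr scons e l i = if i < size l then nth 0 l i else e (i - size l).
Proof. by elim: l i => [|a l IH] [|i] //=; rewrite ?subn0 // IH. Qed.

Lemma Def_substs (P : seq bool -> rel3 -> env -> Prop) (ts : seq (seq bool -> env -> nat)) :
  Def P -> foldr (fun t => and (DT t)) True ts ->
  Def (fun w R e => P w R (foldr scons e [seq t w e | t <- ts])).
Proof.
elim: {ts}(size ts) {-2}ts (erefl (size ts)) P => [|n IH] [|t ts] //= [Hn] P DP [Dt Dts].
apply: (@Def_let t (fun w R a e => P w R (scons a (foldr scons e [seq t w e | t <- ts])))) => //.
(* The induction hypothesis puts the values of [ts] in front of that of [t]; [s] moves the latter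
   from place [size ts] back to the front. *)
pose s i := if i == 0 then size ts else if i <= size ts then i.-1 else i.
pose ts' := [seq (fun w (e : env) => t w (fun i => e i.+1)) | t <- ts].
have Dts' : foldr (fun t => and (DT t)) True ts'.
  rewrite /ts'; elim: ts Dts {IH s ts' Hn} => //= u us IHus [Du Dus]; split; last exact: IHus.
  exact: (DT_ren succn Du).
have sz' : size ts' = n by rewrite size_map.
apply: (Def_ext _ (IH ts' sz' _ (Def_ren s DP) Dts')) => w R e _.
suff -> : scons (e 0) (foldr scons (fun i => e i.+1) [seq t w (fun i => e i.+1) | t <- ts])
    = (fun i => foldr scons e [seq t w e | t <- ts'] (s i)) by [].
rewrite /ts' -map_comp; apply: funext => -[|i]; rewrite foldr_sconsE size_map /s /=.
  by rewrite ltnn subnn.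
rewrite foldr_sconsE size_map; case: (ltnP i (size ts)) => lt_i; first by rewrite lt_i.
by rewrite ltnNge ltnW //= subSn.
Qed.

Lemma Def_app1 (P : seq bool -> nat -> Prop) f :
  Def (fun w R e => P w (e 0)) -> DT f -> Def (fun w R e => P w (f w e)).
Proof. by move=> DP Df; apply: (Def_substs (ts := [:: f]) DP). Qed.

Lemma Def_app2 (P : seq bool -> nat -> nat -> Prop) f g :
  Def (fun w R e => P w (e 0) (e 1)) -> DT f -> DT g ->
  Def (fun w R e => P w (f w e) (g w e)).
Proof. by move=> DP Df Dg; apply: (Def_substs (ts := [:: f; g]) DP). Qed.

Lemma Def_app3 (P : seq bool -> nat -> nat -> nat -> Prop) f g h :
  Def (fun w R e => P w (e 0) (e 1) (e 2)) -> DT f -> DT g -> DT h ->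
  Def (fun w R e => P w (f w e) (g w e) (h w e)).
Proof. by move=> DP *; apply: (Def_substs (ts := [:: f; g; h]) DP). Qed.

Lemma Def_app4 (P : seq bool -> nat -> nat -> nat -> nat -> Prop) f g h k :
  Def (fun w R e => P w (e 0) (e 1) (e 2) (e 3)) -> DT f -> DT g -> DT h -> DT k ->
  Def (fun w R e => P w (f w e) (g w e) (h w e) (k w e)).
Proof. by move=> DP *; apply: (Def_substs (ts := [:: f; g; h; k]) DP). Qed.

Lemma DT_app2 (F : seq bool -> nat -> nat -> nat) f g :
  Def (fun w R e => F w (e 0) (e 1) = e 2) ->
  (forall w x y, x < NN w -> y < NN w -> F w x y < NN w) ->
  DT f -> DT g -> DT (fun w e => F w (f w e) (g w e)).
Proof.
move=> DF HF Df Dg; split=> [w e He|]; first by apply: HF; [apply Df|apply Dg].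
exact: (Def_app3 (P := fun w x y z => F w x y = z) DF
  (DT_ren succn Df) (DT_ren succn Dg) (DT_var 0)).
Qed.

Lemma DT_app3 (F : seq bool -> nat -> nat -> nat -> nat) f g h :
  Def (fun w R e => F w (e 0) (e 1) (e 2) = e 3) ->
  (forall w x y z, x < NN w -> y < NN w -> z < NN w -> F w x y z < NN w) ->
  DT f -> DT g -> DT h -> DT (fun w e => F w (f w e) (g w e) (h w e)).
Proof.
move=> DF HF Df Dg Dh; split=> [w e He|].
  by apply: HF; [apply Df|apply Dg|apply Dh].
exact: (Def_app4 (P := fun w x y z u => F w x y z = u) DF
  (DT_ren succn Df) (DT_ren succn Dg) (DT_ren succn Dh) (DT_var 0)).
Qed.

Lemma DT_cst (F : seq bool -> nat) :
  (forall w, F w < NN w) -> Def (fun w R e => F w = e 0) -> DT (fun w e => F w).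
Proof. by move=> HF DF; split=> // w e _. Qed.

Lemma Def_lt f g : DT f -> DT g -> Def (fun w R e => f w e < g w e).
Proof. exact: (Def_app2 (P := fun w x y => x < y) (Def_ltv 0 1)). Qed.

Lemma Def_eq f g : DT f -> DT g -> Def (fun w R e => f w e = g w e).
Proof. exact: (Def_app2 (P := fun w x y => x = y) (Def_eqv 0 1)). Qed.

Lemma Def_rel f g h : DT f -> DT g -> DT h ->
  Def (fun w R e => R (f w e) (g w e) (h w e)).
Proof.
move=> Df Dg Dh.
have DP : Def (fun w R e => R (e 0) (e 1) (e 2)) by exists (FRel 0 1 2).
exact: (Def_substs (ts := [:: f; g; h]) DP).
Qed.

Lemma Def_bit b f : DT f -> Def (fun w R e => inp w (f w e) = Some (inl b)).
Proof.
have DP : Def (fun w R e => inp w (e 0) = Some (inl b)) by exists (FInp b 0).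
exact: (Def_app1 (P := fun w x => inp w x = Some (inl b))).
Qed.

(** Variables and quantifiers only reach values below N, so a formula cannot see how two relations
    differ elsewhere. Iterates are known to agree only below N. *)
Lemma holds_relE w N phi (R R' : rel3) e : 0 < N ->
  (forall x y z, x < N -> y < N -> z < N -> (R x y z <-> R' x y z)) ->
  (forall i, e i < N) -> (holds w N phi R e <-> holds w N phi R' e).
Proof.
move=> N_gt0; elim: phi R R' e => [i j|b i|i j k|phi IH|phi IH psi IH'|phi IH|phi IH i j k]
  R R' e HR He //=.
- exact: HR.
- by have := IH R R' e HR He; tauto.
- by have := IH R R' e HR He; have := IH' R R' e HR He; tauto.
split=> -[a lt_a H]; exists a => //; move: H; apply IH => //;
  by [move=> [|l] /=|move=> ? ? ? *; split; apply HR].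
Qed.

Lemma Def_iter (F : seq bool -> rel3 -> nat -> nat -> nat -> env -> Prop) f g h :
  Def (fun w R e => F w R (e 0) (e 1) (e 2) (fun i => e i.+3)) -> DT f -> DT g -> DT h ->
  Def (fun w R e => iter3 (NN w) (fun R' x y z => F w R' x y z e) (f w e) (g w e) (h w e)).
Proof.
move=> [phi Hphi] Df Dg Dh.
apply: (@Def_let f (fun w R a e => iter3 (NN w) (fun R' x y z => F w R' x y z e) a (g w e) (h w e))) => //.
apply: (@Def_let (fun w e => g w (fun i => e i.+1)) (fun w R a e => iter3 (NN w)
  (fun R' x y z => F w R' x y z (fun i => e i.+1)) (e 0) a (h w (fun i => e i.+1)))).
  exact: (DT_ren succn Dg).
apply: (@Def_let (fun w e => h w (fun i => e i.+2)) (fun w R a e => iter3 (NN w)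
  (fun R' x y z => F w R' x y z (fun i => e i.+2)) (e 1) (e 0) a)).
  exact: (DT_ren (fun i => i.+2) Dh).
(* The three arguments of the iteration are bound as variables first; under the variables of the
   body they occupy places 3 to 5, which [s] skips. *)
pose s i := if i is j.+3 then j.+3.+3 else i.
exists (FIter (ren s phi) 2 1 0) => w R e He /=; rewrite /iter3.
have N_gt0 : 0 < NN w by have := NN_gt w; lia.
have sE x y z : (fun i => scons x (scons y (scons z e)) (s i))
    = scons x (scons y (scons z (fun i => e i.+3))).
  by apply: funext => -[|[|[|i]]].
have He3 : valid w (fun i => e i.+3) by move=> i; exact: He.
suff H n x y z : x < NN w -> y < NN w -> z < NN w ->
    (iter n (fun R' x y z => F w R' x y z (fun i => e i.+3)) (fun _ _ _ => False) x y z <->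
     iter n (fun R' x y z => holds w (NN w) (ren s phi) R' (scons x (scons y (scons z e))))
       (fun _ _ _ => False) x y z) by exact: H.
elim: n x y z => [|n IH] x y z lx ly lz; first by [].
rewrite !iterS.
set R1 := iter n _ _ in IH *; set R2 := iter n _ _ in IH *.
have V : valid w (scons x (scons y (scons z (fun i => e i.+3)))).
  by do 3 apply: valid_scons => //.
have E1 := Hphi w R1 _ V.
have E2 := @holds_relE w (NN w) phi R1 R2 _ N_gt0 IH V.
have := holds_ren w (NN w) phi s R2 (scons x (scons y (scons z e))).
rewrite sE; move: E1 E2 => /=; tauto.
Qed.

(** After n rounds the iterate is right on all triples of measure below n, whatever it says about
    the others; for measures below N, N rounds settle everything. *)
Lemma iter3_wf N (F : rel3 -> rel3) (P : rel3) (m : nat -> nat -> nat -> nat) :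
  (forall R x y z, x < N -> y < N -> z < N ->
     (forall x' y' z', x' < N -> y' < N -> z' < N -> m x' y' z' < m x y z ->
        (R x' y' z' <-> P x' y' z')) ->
     (F R x y z <-> P x y z)) ->
  forall x y z, x < N -> y < N -> z < N -> m x y z < N -> (iter3 N F x y z <-> P x y z).
Proof.
move=> H; suff Hn n x y z : x < N -> y < N -> z < N -> m x y z < n ->
    (iter n F (fun _ _ _ => False) x y z <-> P x y z) by move=> *; apply: Hn.
elim: n x y z => [|n IH] x y z lx ly lz; first by rewrite ltn0.
move=> lt_n; rewrite iterS; apply: H => // x' y' z' lx' ly' lz' lt_m.
by apply: IH => //; exact: leq_trans lt_m _.
Qed.

(** The form in which iteration defines arithmetic and parsing: recursion along a measure, with one
    parameter that stays fixed. *)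
Lemma Def_rec (P : seq bool -> nat -> rel3) (F : seq bool -> nat -> rel3 -> rel3)
    (m : seq bool -> nat -> nat -> nat -> nat) :
  (forall w p R x y z, p < NN w -> x < NN w -> y < NN w -> z < NN w ->
     (forall x' y' z', x' < NN w -> y' < NN w -> z' < NN w -> m w x' y' z' < m w x y z ->
        (R x' y' z' <-> P w p x' y' z')) ->
     (F w p R x y z <-> P w p x y z)) ->
  (forall w x y z, x < NN w -> y < NN w -> z < NN w -> m w x y z < NN w) ->
  Def (fun w R e => F w (e 3) R (e 0) (e 1) (e 2)) ->
  Def (fun w R e => P w (e 3) (e 0) (e 1) (e 2)).
Proof.
move=> HF Hm DF.
(* Under the three variables of the body the parameter moves from place 3 to place 6. *)
have := @Def_iter (fun w R x y z e => F w (e 3) R x y z) (fun w e => e 0) (fun w e => e 1)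
  (fun w e => e 2) (Def_ren (fun i => if i == 3 then 6 else i) DF) (DT_var 0) (DT_var 1) (DT_var 2).
apply: Def_ext => w R e He; apply: iff_sym.
apply: (iter3_wf (m := m w)) => //; last exact: Hm.
by move=> Q x y z lx ly lz HQ; apply: HF.
Qed.

Create HintDb def.
#[local] Hint Resolve Def_and Def_or Def_not Def_imp Def_iff Def_ex Def_all DT_var
  Def_lt Def_eq Def_rel Def_bit : def.
Ltac defs := cbv beta; auto 100 with def nocore.

(** * Arithmetic below N *)

Lemma Def_le f g : DT f -> DT g -> Def (fun w R e => f w e <= g w e).
Proof.
move=> Df Dg; apply: (Def_ext _ (Def_not (Def_lt Dg Df))) => w R e _.
by rewrite ltnNge; split=> [->|/negP/negPn].
Qed.
#[local] Hint Resolve Def_le : def.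

Lemma DT_0 : DT (fun w e => 0).
Proof.
apply: (@DT_cst (fun=> 0)) => [w|]; first by have := NN_gt w; lia.
apply: (@Def_ext _ (fun w R e => forall a, a < NN w -> ~ a < e 0)); last by defs.
move=> w R e He; split=> [<- //|H]; have g := NN_gt w.
by case: (posnP (e 0)) => // E; case: (H 0) => //; lia.
Qed.
#[local] Hint Resolve DT_0 : def.

Lemma Def_succ f g : DT f -> DT g -> Def (fun w R e => (f w e).+1 = g w e).
Proof.
apply: (Def_app2 (P := fun w x y => x.+1 = y)).
apply: (@Def_ext _ (fun w R e => e 0 < e 1 /\
  (forall a, a < NN w -> ~ (e 0 < a /\ a < e 1)))); last by defs.
move=> w R e He; split=> [<-|[lt H]]; first by split=> // a _; lia.
by case: (ltngtP (e 0).+1 (e 1)) => // lt2; [case: (H _ (leq_trans lt2 (ltnW (He 1))))|]; lia.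
Qed.
#[local] Hint Resolve Def_succ : def.

Lemma DT_1 : DT (fun w e => 1).
Proof.
apply: (@DT_cst (fun=> 1)) => [w|]; first by have := NN_gt w; lia.
exact: Def_succ DT_0 (DT_var 0).
Qed.
Lemma DT_2 : DT (fun w e => 2).
Proof.
apply: (@DT_cst (fun=> 2)) => [w|]; first exact: NN_gt w.
exact: Def_succ DT_1 (DT_var 0).
Qed.
#[local] Hint Resolve DT_1 DT_2 : def.

Lemma Def_add f g h : DT f -> DT g -> DT h -> Def (fun w R e => f w e + g w e = h w e).
Proof.
apply: (Def_app3 (P := fun w x y z => x + y = z)).
apply: (@Def_ren (fun w R e => e 0 + e 1 = e 2) (fun i => i)).
apply: (Def_rec (P := fun w p x y z => x + y = z)
  (F := fun w p R x y z => (y = 0 /\ x = z) \/ (exists2 y', y' < NN w &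
     exists2 z', z' < NN w & y'.+1 = y /\ z'.+1 = z /\ R x y' z'))
  (m := fun w x y z => y)) => //; last by defs.
move=> w p R x y z _ lx ly lz H; split=> [[[-> ->]|[y' ly' [z' lz' [Ey [Ez HR]]]]]|Ezz]; last subst z.
- exact: addn0.
- by have := proj1 (H x y' z' lx ly' lz' _) HR; lia.
case: y ly lz H => [|y] ly lz H; first by left; rewrite addn0.
right; exists y; first lia.
by exists (x + y); [lia|split=> //; split; [rewrite addnS|apply/H => //=; lia]].
Qed.
#[local] Hint Resolve Def_add : def.

Lemma Def_mul f g h : DT f -> DT g -> DT h -> Def (fun w R e => f w e * g w e = h w e).
Proof.
apply: (Def_app3 (P := fun w x y z => x * y = z)).
apply: (@Def_ren (fun w R e => e 0 * e 1 = e 2) (fun i => i)).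
apply: (Def_rec (P := fun w p x y z => x * y = z)
  (F := fun w p R x y z => (y = 0 /\ z = 0) \/ (exists2 y', y' < NN w &
     exists2 z', z' < NN w & y'.+1 = y /\ z' + x = z /\ R x y' z'))
  (m := fun w x y z => y)) => //; last by defs.
move=> w p R x y z _ lx ly lz H; split=> [[[-> ->]|[y' ly' [z' lz' [Ey [Ez HR]]]]]|Ezz]; last subst z.
- exact: muln0.
- by rewrite -Ey mulnS addnC (proj1 (H x y' z' lx ly' lz' _) HR) //=; lia.
case: y ly lz H => [|y] ly lz H; first by left; rewrite muln0.
right; exists y; first lia.
exists (x * y); first lia.
by split=> //; split; [rewrite mulnS addnC|apply/H => //=; nia].
Qed.
#[local] Hint Resolve Def_mul : def.

Lemma Def_pow f g h : DT f -> DT g -> DT h -> Def (fun w R e => f w e ^ g w e = h w e).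
Proof.
apply: (Def_app3 (P := fun w p x y => p ^ x = y)).
suff D : Def (fun w R e => e 3 ^ e 0 = e 1) by exact: (Def_ren (nth 0 [:: 1; 2; 0; 0]) D).
apply: (Def_rec (P := fun w p x y z => p ^ x = y)
  (F := fun w p R x y z => (x = 0 /\ y = 1) \/ (exists2 x', x' < NN w &
     exists2 y', y' < NN w & x'.+1 = x /\ y' * p = y /\ R x' y' z))
  (m := fun w x y z => x)) => //; last by defs.
move=> w p R x y z lp lx ly lz H; split=> [[[-> ->]|[x' lx' [y' ly' [Ex [Ey HR]]]]]|Ey].
- exact: expn0.
- by rewrite -Ex expnSr (proj1 (H x' y' z lx' ly' lz _) HR) //=; lia.
case: x lx Ey H => [|x] lx Ey H; first by left.
right; exists x; first lia.
(* The smaller power must also be below N to serve as a witness; base 0 is separate because 0^0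
   exceeds 0^1. *)
have lt : p ^ x < NN w.
  case: (posnP p) => [->|p_gt]; last by rewrite -Ey expnS in ly; nia.
  by have gN := NN_gt w; case: (x) => [|x']; rewrite ?expn0 ?exp0n //; lia.
exists (p ^ x) => //; split=> //; split; first by rewrite -expnSr.
by apply/H => //=; lia.
Qed.
#[local] Hint Resolve Def_pow : def.

Lemma Def_div f g h : DT f -> DT g -> DT h -> Def (fun w R e => f w e %/ g w e = h w e).
Proof.
apply: (Def_app3 (P := fun w x y z => x %/ y = z)).
apply: (@Def_ext _ (fun w R e => (e 1 = 0 /\ e 2 = 0) \/ (exists2 u, u < NN w &
  exists2 r, r < NN w & e 2 * e 1 = u /\ u + r = e 0 /\ r < e 1))); last by defs.
move=> w R e He; split=> [<-|[[-> ->]|[u lu [r lr [<- [<- lt]]]]]].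
- case: (posnP (e 1)) => [E|y_gt]; first by left; rewrite E divn0.
  right; exists (e 0 %/ e 1 * e 1); first exact: leq_ltn_trans (leq_divM _ _) (He 0).
  exists (e 0 %% e 1); first exact: leq_ltn_trans (leq_mod _ _) (He 0).
  by rewrite -divn_eq ltn_pmod.
- exact: divn0.
- by rewrite divnMDl; [rewrite divn_small // addn0|lia].
Qed.
#[local] Hint Resolve Def_div : def.

Lemma DT_modn f g : DT f -> DT g -> DT (fun w e => f w e %% g w e).
Proof.
apply: (DT_app2 (F := fun w x y => x %% y)) => [|w x y lx ly]; last first.
  exact: leq_ltn_trans (leq_mod _ _) lx.
apply: (@Def_ext _ (fun w R e => exists2 q, q < NN w & exists2 u, u < NN w &
  e 0 %/ e 1 = q /\ q * e 1 = u /\ u + e 2 = e 0)); last by defs.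
move=> w R e He; have E := divn_eq (e 0) (e 1); have l0 := He 0.
split=> [<-|[q lq [u lu [Eq [Eu Es]]]]]; last by subst; lia.
exists (e 0 %/ e 1); first exact: leq_ltn_trans (leq_div _ _) l0.
by exists (e 0 %/ e 1 * e 1); first exact: leq_ltn_trans (leq_divM _ _) l0.
Qed.
#[local] Hint Resolve DT_modn : def.

Definition dig (K x t : nat) : nat := (x %/ K ^ t) %% K.

Lemma DT_dig f g h : DT f -> DT g -> DT h -> DT (fun w e => dig (f w e) (g w e) (h w e)).
Proof.
(* Repeated division, because the power itself may exceed N. *)
have D : Def (fun w R e => e 0 %/ e 3 ^ e 1 = e 2).
  apply: (Def_rec (P := fun w p x t z => x %/ p ^ t = z)
    (F := fun w p R x t z => (t = 0 /\ x = z) \/ (exists2 t', t' < NN w &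
     exists2 z', z' < NN w & t'.+1 = t /\ z' %/ p = z /\ R x t' z'))
    (m := fun w x t z => t)) => //; last by defs.
  move=> w p R x t z _ lx lt lz H.
  split=> [[[-> ->]|[t' lt' [z' lz' [Et [Ez HR]]]]]|Ez].
  - by rewrite expn0 divn1.
  - by rewrite -Et expnSr divnMA (proj1 (H x t' z' lx lt' lz' _) HR) //=; lia.
  case: t lt Ez H => [|t] lt Ez H; first by left; rewrite expn0 divn1 in Ez.
  right; exists t; first lia.
  have lz0 : x %/ p ^ t < NN w by exact: leq_ltn_trans (leq_div _ _) lx.
  exists (x %/ p ^ t) => //; split=> //; split; first by rewrite -divnMA -expnSr.
  by apply/H => //=; lia.
have Dq f' g' h' : DT f' -> DT g' -> DT h' -> DT (fun w e => f' w e %/ g' w e ^ h' w e).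
  apply: (DT_app3 (F := fun w x p t => x %/ p ^ t)) => [|w x p t lx _ _].
    exact: (Def_ren (nth 0 [:: 0; 2; 3; 1]) D).
  exact: leq_ltn_trans (leq_div _ _) lx.
by move=> Df Dg Dh; exact: (DT_modn (Dq _ _ _ Dg Df Dh) Df).
Qed.
#[local] Hint Resolve DT_dig : def.

(** * Parsing the input *)

Definition seg (w : seq bool) (i j : nat) (s : seq bool) : Prop :=
  exists u v, [/\ w = u ++ s ++ v, size u = i & j = i + size s].

Lemma seg_le w i j s : seg w i j s -> i <= j /\ j <= size w.
Proof. by move=> [u [v [-> <- ->]]]; rewrite !size_cat; lia. Qed.

Lemma size_NN w : size w + 2 < NN w.
Proof.
rewrite /NN /dexp; have := ltn_expl (2 ^ (10 * size w + 10)) (isT : 1 < 2).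
by have := ltn_expl (10 * size w + 10) (isT : 1 < 2); lia.
Qed.

Lemma seg_NN w i j s : seg w i j s -> i < NN w /\ j < NN w.
Proof. by move/seg_le=> [le1 le2]; have := size_NN w; lia. Qed.

Lemma seg0 w i j : seg w i j [::] <-> i <= size w /\ j = i.
Proof.
split=> [[u [v [-> <- ->]]]|[le_i ->]]; first by rewrite size_cat addn0; lia.
by exists (take i w), (drop i w); rewrite cat_take_drop size_takel // addn0.
Qed.

Lemma seg_cat w i j s t :
  seg w i j (s ++ t) <-> exists k, seg w i k s /\ seg w k j t.
Proof.
split=> [[u [v [E <- ->]]]|[k [[u [v [E <- Ek]]] [u' [v' [E' sz' ->]]]]]].
  exists (size u + size s); split; first by exists u, (t ++ v); rewrite E -catA.
  by exists (u ++ s), v; rewrite E -!catA !size_cat addnA.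
have Eu : u' = u ++ s.
  have := congr1 (take (size u')) (etrans (esym E') E).
  by rewrite take_size_cat // catA sz' Ek -size_cat take_size_cat.
exists u, v'; rewrite E' Eu -!catA; split=> //.
by rewrite Ek size_cat addnA.
Qed.

Lemma seg1 w i j b : seg w i j [:: b] <-> inp w i = Some (inl b) /\ i.+1 = j.
Proof.
rewrite /inp; split=> [[u [v [-> <- ->]]]|[Hi <-]].
  by rewrite map_cat nth_cat size_map ltnn subnn addn1.
have lt_i : i < size w.
  by rewrite ltnNge; apply/negP => le; rewrite nth_default ?size_map in Hi.
exists (take i w), (drop i.+1 w); rewrite size_takel ?addn1 //; last exact: ltnW.
rewrite -{1}(cat_take_drop i w) (drop_nth false) //=; split=> //.
by move: Hi; rewrite (nth_map false) // => -[->].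
Qed.

Lemma seg_cons w i j b s :
  seg w i j (b :: s) <-> inp w i = Some (inl b) /\ seg w i.+1 j s.
Proof.
rewrite -cat1s seg_cat; split=> [[k [/seg1[Hi <-] Hs]]|[Hi Hs]] //.
by exists i.+1; split=> //; apply/seg1.
Qed.

Lemma inp_lt w i b : inp w i = Some (inl b) -> i < size w.
Proof.
by rewrite /inp => H; rewrite ltnNge; apply/negP => le; rewrite nth_default ?size_map in H.
Qed.

Lemma seg_inj T (e : T -> seq bool) w i j j' x y :
  prefix_code e -> seg w i j (e x) -> seg w i j' (e y) -> x = y /\ j = j'.
Proof.
move=> He [u [v [E <- ->]]] [u' [v' [E' sz ->]]].
have Eu : u' = u.
  by have := congr1 (take (size u')) (etrans (esym E) E'); rewrite take_size_cat // sz take_size_cat.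
move: E'; rewrite E Eu => /eqP; rewrite eqseq_cat // => /andP[_ /eqP /He[<- _]].
by [].
Qed.

Lemma DT_size : DT (fun w e => size w).
Proof.
apply: (@DT_cst (fun w => size w)) => [w|]; first by have := size_NN w; lia.
apply: (@Def_ext _ (fun w R e => (~ inp w (e 0) = Some (inl true) /\ ~ inp w (e 0) = Some (inl false)) /\
  forall a, a < NN w -> a < e 0 -> inp w a = Some (inl true) \/ inp w a = Some (inl false)));
  last by defs.
move=> w R e He; split=> [<-|[[n1 n0] H]].
  split; first by split=> /inp_lt; rewrite ltnn.
  move=> a _ lt_a; rewrite /inp (nth_map false) //; case: (nth _ _ _); by [left|right].
case: (ltngtP (size w) (e 0)) => // lt_s.
  have := H (size w) _ lt_s; have := size_NN w; rewrite /inp nth_default ?size_map //.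
  by move=> g /(_ ltac:(lia)) [].
move: n1 n0; rewrite /inp (nth_map false) //.
by case: (nth _ _ _).
Qed.
#[local] Hint Resolve DT_size : def.

Lemma Def_seg s f g : DT f -> DT g -> Def (fun w R e => seg w (f w e) (g w e) s).
Proof.
apply: (Def_app2 (P := fun w x y => seg w x y s)).
elim: s => [|b s IH].
  apply: (@Def_ext _ (fun w R e => e 0 <= size w /\ e 1 = e 0)); last by defs.
  by move=> w R e _; exact: seg0.
have IHs f' g' : DT f' -> DT g' -> Def (fun w R e => seg w (f' w e) (g' w e) s).
  exact: (Def_app2 (P := fun w x y => seg w x y s) IH).
apply: (@Def_ext _ (fun w R e => inp w (e 0) = Some (inl b) /\
  exists2 k, k < NN w & (e 0).+1 = k /\ seg w k (e 1) s)); last by defs.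
move=> w R e He; rewrite seg_cons; split=> [[Hi Hs]|[Hi [k _ [<- Hs]]]] //.
by split=> //; exists (e 0).+1 => //; case: (seg_NN Hs).
Qed.
#[local] Hint Resolve Def_seg : def.

Definition NP w i j : Prop := exists A, seg w i j (enc_name A).
Definition CP w i j : Prop := exists C, seg w i j (enc_concept C).
Definition NPd w i : Prop := exists2 j, j < NN w & NP w i j.
Definition CPd w i : Prop := exists2 j, j < NN w & CP w i j.
(** Names and concepts are encoded by prefix codes, so a start position determines what is written
    there and can stand for it. *)
Definition nm w i A : Prop := exists j, seg w i j (enc_name A).
Definition cpt w i C : Prop := exists j, seg w i j (enc_concept C).
Definition nmeq w i j : Prop := exists A, nm w i A /\ nm w j A.

Lemma Def_NP f g : DT f -> DT g -> Def (fun w R e => NP w (f w e) (g w e)).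
Proof.
apply: (Def_app2 (P := NP)); apply: (@Def_ren (fun w R e => NP w (e 0) (e 1)) (fun i => i)).
apply: (Def_rec (P := fun w p i j z => NP w i j) (F := fun w p R i j z =>
   seg w i j [:: false] \/ exists2 k, k < NN w &
     (seg w i k [:: true; false] \/ seg w i k [:: true; true]) /\ R k j z)
  (m := fun w i j z => size w - i)) => [w p R i j z _ li lj lz H|w i j z _ _ _|]; last by defs.
- split=> [[Hs|[k lk [Hs HR]]]|[[|b A]]].
  + by exists [::].
  + have [b Hb] : exists b, seg w i k [:: true; b] by case: Hs; eexists; eassumption.
    have Hlt : size w - k < size w - i.
      by move: Hb; rewrite seg_cons => -[/inp_lt + /seg_cons[_ /seg_le]]; lia.
    have [A HA] := proj1 (H k j z lk lj lz Hlt) HR.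
    by exists (b :: A); rewrite -[enc_name _]/([:: true; b] ++ enc_name A) seg_cat; exists k.
  + by left.
  rewrite -[enc_name _]/([:: true; b] ++ enc_name A) seg_cat => -[k [Hb HA]]; right.
  have [_ lk] := seg_NN Hb; exists k => //; split; first by case: (b) Hb; [right|left].
  apply/H => //; last by exists A.
  by move: Hb; rewrite seg_cons => -[/inp_lt + /seg_cons[_ /seg_le]]; lia.
- by have := size_NN w; lia.
Qed.
#[local] Hint Resolve Def_NP : def.

Lemma Def_nmeq f g : DT f -> DT g -> Def (fun w R e => nmeq w (f w e) (g w e)).
Proof.
apply: (Def_app2 (P := nmeq)); apply: (@Def_ren (fun w R e => nmeq w (e 0) (e 1)) (fun i => i)).
apply: (Def_rec (P := fun w p i j z => nmeq w i j) (F := fun w p R i j z =>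
   exists2 k, k < NN w & exists2 l, l < NN w &
     (seg w i k [:: false] /\ seg w j l [:: false]) \/
     ((seg w i k [:: true; false] /\ seg w j l [:: true; false] \/
       seg w i k [:: true; true] /\ seg w j l [:: true; true]) /\ R k l z))
  (m := fun w i j z => size w - i)) => [w p R i j z _ li lj lz H|w i j z _ _ _|]; last by defs.
- split=> [[k lk [l ll [[Hi Hj]|[Hs HR]]]]|[[|b A] [[k Hk] [l Hl]]]].
  + by exists [::]; split; eexists; eassumption.
  + have [b [Hb Hb']] : exists b, seg w i k [:: true; b] /\ seg w j l [:: true; b].
      by case: Hs => -[]; eexists; split; eassumption.
    have Hlt : size w - k < size w - i.
      by move: Hb; rewrite seg_cons => -[/inp_lt + /seg_cons[_ /seg_le]]; lia.
    have [A [[k' HA] [l' HA']]] := proj1 (H k l z lk ll lz Hlt) HR.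
    exists (b :: A); split; [exists k'|exists l'];
      rewrite -[enc_name _]/([:: true; b] ++ enc_name A) seg_cat; by [exists k|exists l].
  + exists k; first by case: (seg_NN Hk).
    by exists l; [case: (seg_NN Hl)|left].
  move: Hk Hl; rewrite -[enc_name _]/([:: true; b] ++ enc_name A) !seg_cat.
  move=> [k' [Hb HA]] [l' [Hb' HA']].
  exists k'; first by case: (seg_NN HA).
  exists l'; first by case: (seg_NN HA').
  right; split; first by case: (b) Hb Hb'; [right|left].
  apply/H; rewrite ?(proj1 (seg_NN HA)) ?(proj1 (seg_NN HA')) //.
    by move: Hb; rewrite seg_cons => -[/inp_lt + /seg_cons[_ /seg_le]]; lia.
  by exists A; split; [exists k|exists l].
- by have := size_NN w; lia.
Qed.
#[local] Hint Resolve Def_nmeq : def.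

Lemma enc_concept_gt0 C : 0 < size (enc_concept C).
Proof. by case: C. Qed.

Lemma seg_lt w i j s : seg w i j s -> 0 < size s -> i < j.
Proof. by move=> [u [v [_ _ ->]]]; lia. Qed.

Lemma Def_CP f g : DT f -> DT g -> Def (fun w R e => CP w (f w e) (g w e)).
Proof.
apply: (Def_app2 (P := CP)); apply: (@Def_ren (fun w R e => CP w (e 0) (e 1)) (fun i => i)).
apply: (Def_rec (P := fun w p i j z => CP w i j) (F := fun w p R i j z =>
   seg w i j [:: false; false; true] \/ exists2 k, k < NN w &
     (seg w i k [:: false; false; false] /\ NP w k j) \/
     (seg w i k [:: false; true; false] /\ R k j z) \/
     exists2 l, l < NN w &
       (seg w i k [:: false; true; true] /\ R k l z /\ R l j z) \/
       (seg w i k [:: true; false; false] /\ NP w k l /\ R l j z))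
  (m := fun w i j z => size w - i)) => [w p R i j z _ li lj lz H|w i j z _ _ _|]; last by defs.
- have H' k j' : k < NN w -> j' < NN w -> i < k -> k <= size w -> (R k j' z <-> CP w k j').
    by move=> lk lj' lt_ik le_k; apply: H => //; lia.
  have seg3 k a b c : seg w i k [:: a; b; c] -> i < k /\ k <= size w.
    by move=> Hs; have := seg_le Hs; have := seg_lt Hs; move=> /(_ isT); lia.
  split.
  + case=> [Hs|[k lk [[Hs [A HA]]|[[Hs HR]|[l ll [[Hs [HR HR']]|[Hs [[A HA] HR]]]]]]]].
    * by exists CTop.
    * by exists (CName A); rewrite seg_cat; exists k.
    * have [lt1 le1] := seg3 _ _ _ _ Hs; have [C HC] := proj1 (H' k j lk lj lt1 le1) HR.
      by exists (CNot C); rewrite seg_cat; exists k.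
    * have [lt1 le1] := seg3 _ _ _ _ Hs; have [C HC] := proj1 (H' k l lk ll lt1 le1) HR.
      have [le2 le3] := seg_le HC.
      have [D HD] := proj1 (H' l j ll lj ltac:(lia) le3) HR'.
      by exists (CAnd C D); rewrite seg_cat; exists k; split=> //; apply/seg_cat; exists l.
    * have [lt1 le1] := seg3 _ _ _ _ Hs; have [le2 le3] := seg_le HA.
      have [D HD] := proj1 (H' l j ll lj ltac:(lia) le3) HR.
      by exists (CEx A D); rewrite seg_cat; exists k; split=> //; apply/seg_cat; exists l.
  + move=> [[A||C|C D|A C]]; rewrite [enc_concept _]/=.
    * rewrite -[_ :: _]/([:: false; false; false] ++ enc_name A) seg_cat => -[k [Hs HA]].
      by right; exists k; [case: (seg_NN HA)|left; split=> //; exists A].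
    * by left.
    * rewrite -[_ :: _]/([:: false; true; false] ++ enc_concept C) seg_cat => -[k [Hs HC]].
      have [lt1 le1] := seg3 _ _ _ _ Hs; have [lk _] := seg_NN HC.
      by right; exists k => //; right; left; split=> //; apply/H' => //; exists C.
    * rewrite -[_ :: _]/([:: false; true; true] ++ (enc_concept C ++ enc_concept D)) seg_cat.
      move=> [k [Hs /seg_cat[l [HC HD]]]].
      have [lt1 le1] := seg3 _ _ _ _ Hs; have [lk ll] := seg_NN HC; have [le2 le3] := seg_le HC.
      right; exists k => //; right; right; exists l => //; left; split=> //.
      by split; apply/H'; rewrite //; [exists C|lia|exists D].
    * rewrite -[_ :: _]/([:: true; false; false] ++ (enc_name A ++ enc_concept C)) seg_cat.
      move=> [k [Hs /seg_cat[l [HA HC]]]].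
      have [lt1 le1] := seg3 _ _ _ _ Hs; have [lk ll] := seg_NN HA; have [le2 le3] := seg_le HA.
      right; exists k => //; right; right; exists l => //; right; split=> //.
      by split; [exists A|apply/H'; rewrite //; [lia|exists C]].
- by have := size_NN w; lia.
Qed.
#[local] Hint Resolve Def_CP : def.

Lemma Def_NPd f : DT f -> Def (fun w R e => NPd w (f w e)).
Proof. by apply: (Def_app1 (P := NPd)); rewrite /NPd; defs. Qed.
Lemma Def_CPd f : DT f -> Def (fun w R e => CPd w (f w e)).
Proof. by apply: (Def_app1 (P := CPd)); rewrite /CPd; defs. Qed.
#[local] Hint Resolve Def_NPd Def_CPd : def.

Lemma nm_NPd w p : NPd w p <-> exists A, nm w p A.
Proof.
split=> [[j _ [A HA]]|[A [j HA]]]; first by exists A, j.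
by exists j; [case: (seg_NN HA)|exists A].
Qed.

Lemma cpt_CPd w p : CPd w p <-> exists C, cpt w p C.
Proof.
split=> [[j _ [A HA]]|[A [j HA]]]; first by exists A, j.
by exists j; [case: (seg_NN HA)|exists A].
Qed.

Lemma nm_inj w p A B : nm w p A -> nm w p B -> A = B.
Proof. by move=> [j H] [k H']; case: (seg_inj enc_name_prefix H H'). Qed.

Lemma cpt_inj w p C D : cpt w p C -> cpt w p D -> C = D.
Proof. by move=> [j H] [k H']; case: (seg_inj enc_concept_prefix H H'). Qed.

Lemma nm_lt w p A : nm w p A -> p < size w.
Proof.
by move=> [j H]; have := seg_lt H; have := seg_le H; case: A H => [|b A] _ [] /= _ + /(_ isT); lia.
Qed.

Lemma cpt_lt w p C : cpt w p C -> p < size w.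
Proof.
by move=> [j H]; have := seg_lt H (enc_concept_gt0 C); have := seg_le H; lia.
Qed.

Section Lists.

Variables (T : Type) (e : T -> seq bool).

Definition cells (l : seq T) : seq bool := flatten [seq true :: e x | x <- l].
(** The positions reached from [s] by reading whole list cells, wherever the list ends. *)
Definition cell w s i : Prop := exists l, seg w s i (cells l).
Definition LE w s j : Prop := exists l, seg w s j (enc_list e l).
Definition item w i j : Prop := exists x, seg w i j (e x).

Lemma enc_listE l : enc_list e l = cells l ++ [:: false].
Proof. by elim: l => //= x l ->; rewrite /cells /= -catA. Qed.

Lemma Def_cell : (forall f g, DT f -> DT g -> Def (fun w R e => item w (f w e) (g w e))) ->
  forall f g, DT f -> DT g -> Def (fun w R e => cell w (f w e) (g w e)).
Proof.
move=> Dit f g; apply: (Def_app2 (P := cell)).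
apply: (@Def_ren (fun w R e => cell w (e 0) (e 1)) (fun i => i)).
apply: (Def_rec (P := fun w p i j z => cell w i j) (F := fun w p R i j z =>
   (i <= size w /\ j = i) \/ exists2 k, k < NN w & exists2 l, l < NN w &
     seg w i k [:: true] /\ item w k l /\ R l j z)
  (m := fun w i j z => size w - i)) => [w p R i j z _ li lj lz H|w i j z _ _ _|]; last by defs.
- split=> [[/seg0 Hs|[k lk [l ll [Hs [[x Hx] HR]]]]]|[[|x t]]].
  + by exists [::].
  + have Hlt : size w - l < size w - i.
      by have := seg_lt Hs isT; have := seg_le Hs; have := seg_le Hx; lia.
    have [t Ht] := proj1 (H l j z ll lj lz Hlt) HR.
    by exists (x :: t); rewrite /cells /= -cat1s seg_cat; exists k; split=> //; apply/seg_cat; exists l.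
  + by rewrite seg0; left.
  rewrite /cells /= -cat1s seg_cat => -[k [Hs /seg_cat[l [Hx Ht]]]]; right.
  have [lk ll] := seg_NN Hx; exists k => //; exists l => //; split=> //.
  split; first by exists x.
  apply/H => //; last by exists t.
  by have := seg_lt Hs isT; have := seg_le Hs; have := seg_le Hx; lia.
- by have := size_NN w; lia.
Qed.

Lemma Def_LE : (forall f g, DT f -> DT g -> Def (fun w R e => item w (f w e) (g w e))) ->
  forall f g, DT f -> DT g -> Def (fun w R e => LE w (f w e) (g w e)).
Proof.
move=> Dit f g; have Dc := Def_cell Dit; apply: (Def_app2 (P := LE)).
apply: (@Def_ext _ (fun w R e => exists2 i, i < NN w & cell w (e 0) i /\ seg w i (e 1) [:: false]));
  last by defs.
move=> w R e0 _; split=> [[l]|[i _ [[l Hl] Hs]]].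
  rewrite enc_listE seg_cat => -[k [Hl Hs]].
  by exists k; [case: (seg_NN Hs)|split=> //; exists l].
by exists l; rewrite enc_listE seg_cat; exists i.
Qed.

Hypothesis e_prefix : prefix_code e.

(** Since [e] is a prefix code, the cells read up to [i] are the first cells of [l] itself; the
    induction consumes both in step. *)
Lemma cell_In w s j l i k m x : seg w s j (enc_list e l) ->
  cell w s i -> seg w i k [:: true] -> seg w k m (e x) -> List.In x l.
Proof.
move=> Hl [t Ht] Hs Hx; elim: t s l Hl Ht => [|y t IH] s [|z l].
- move=> /seg1[E _] /seg0[_ Ei]; move: Hs; rewrite seg1 Ei E => -[] //.
- rewrite /= seg_cons seg_cat => -[_ [n [Hz _]]] /seg0[_ Ei]; move: Hs; rewrite seg1 Ei => -[_ Ek].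
  by move: Hz; rewrite Ek => Hz; left; case: (seg_inj e_prefix Hz Hx).
- by move=> /seg1[E _]; rewrite /cells /= seg_cons => -[]; rewrite E.
rewrite /= seg_cons seg_cat => -[_ [n [Hz Hl]]]; rewrite /cells /= seg_cons seg_cat.
move=> [_ [n' [Hy Ht]]]; right; apply: IH Hl _.
by have [_ ->] := seg_inj e_prefix Hz Hy.
Qed.

Lemma In_cell w s j l x : seg w s j (enc_list e l) -> List.In x l ->
  exists i k m, [/\ cell w s i, seg w i k [:: true] & seg w k m (e x)].
Proof.
elim: l s => [|y l IH] s //=; rewrite seg_cons seg_cat => -[Hs [n [Hy Hl]]] [E|Hin].
  rewrite -E; exists s, s.+1, n; split=> //; last exact/seg1.
  exists [::]; apply/seg0; split=> //; exact/ltnW/(inp_lt Hs).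
have [i [k [m [[t Ht] Hk Hm]]]] := IH n Hl Hin; exists i, k, m; split=> //.
by exists (y :: t); rewrite /cells /= seg_cons seg_cat; split=> //; exists n.
Qed.

End Lists.

Lemma enc_inclusion_prefix : prefix_code enc_inclusion.
Proof.
move=> [C D] [C' D'] r s; rewrite /enc_inclusion /= -!catA.
by case/enc_concept_prefix=> -> /enc_concept_prefix [-> ->].
Qed.

Lemma enc_assertion_prefix : prefix_code enc_assertion.
Proof.
case=> [A a|R a b] [A' a'|R' a' b'] r s //=; rewrite -!catA; case.
  by case/enc_name_prefix=> -> /enc_name_prefix [-> ->].
by case/enc_name_prefix=> -> /enc_name_prefix [-> /enc_name_prefix [-> ->]].
Qed.

Lemma Def_itemI f g : DT f -> DT g -> Def (fun w R e => item enc_inclusion w (f w e) (g w e)).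
Proof.
apply: (Def_app2 (P := item enc_inclusion)).
apply: (@Def_ext _ (fun w R e => exists2 k, k < NN w & CP w (e 0) k /\ CP w k (e 1))); last by defs.
move=> w R e _; split=> [[[C D]]|[k _ [[C HC] [D HD]]]].
  rewrite /enc_inclusion seg_cat => -[k [HC HD]]; exists k; first by case: (seg_NN HD).
  by split; [exists C|exists D].
by exists (C, D); rewrite /enc_inclusion seg_cat; exists k.
Qed.

Lemma Def_itemN f g : DT f -> DT g -> Def (fun w R e => item enc_name w (f w e) (g w e)).
Proof. exact: Def_NP. Qed.

Lemma Def_itemA f g : DT f -> DT g -> Def (fun w R e => item enc_assertion w (f w e) (g w e)).
Proof.
apply: (Def_app2 (P := item enc_assertion)).
apply: (@Def_ext _ (fun w R e => exists2 p, p < NN w & exists2 a, a < NN w &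
  (seg w (e 0) p [:: false] /\ NP w p a /\ NP w a (e 1)) \/
  (seg w (e 0) p [:: true] /\ NP w p a /\ exists2 b, b < NN w & NP w a b /\ NP w b (e 1))));
  last by defs.
move=> w R e _; split=> [[[A x|P x y]]|[p _ [a _ [[Hs [[A HA] [x Hx]]]|[Hs [[P HP] [b _ [[x Hx] [y Hy]]]]]]]]].
- rewrite /= -cat1s seg_cat => -[p [Hs /seg_cat[a [HA Hx]]]]; have [lp la] := seg_NN HA.
  by exists p => //; exists a => //; left; split=> //; split; [exists A|exists x].
- rewrite /= -cat1s seg_cat => -[p [Hs /seg_cat[a [HA /seg_cat[b [Hx Hy]]]]]].
  have [lp la] := seg_NN HA; have [_ lb] := seg_NN Hx.
  exists p => //; exists a => //; right; split=> //; split; first by exists P.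
  by exists b => //; split; [exists x|exists y].
- exists (AConcept A x); rewrite /= -cat1s seg_cat; exists p; split=> //.
  by apply/seg_cat; exists a.
exists (ARole P x y); rewrite /= -cat1s seg_cat; exists p; split=> //.
by apply/seg_cat; exists a; split=> //; apply/seg_cat; exists b.
Qed.

Definition cellI := cell enc_inclusion.
Definition cellA := cell enc_assertion.
Definition cellN := cell enc_name.
Definition LEI := LE enc_inclusion.
Definition LEA := LE enc_assertion.
Definition LEN := LE enc_name.

Definition Def_cellI := Def_cell Def_itemI.
Definition Def_cellA := Def_cell Def_itemA.
Definition Def_cellN := Def_cell Def_itemN.
Definition Def_LEI := Def_LE Def_itemI.
Definition Def_LEA := Def_LE Def_itemA.
Definition Def_LEN := Def_LE Def_itemN.
#[local] Hint Resolve Def_cellI Def_cellA Def_cellN Def_LEI Def_LEA Def_LEN : def.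

Definition inc w s a b : Prop := exists2 i, i < NN w &
  cellI w s i /\ seg w i a [:: true] /\ CP w a b /\ CPd w b.
Definition ca w s p a : Prop := exists2 i, i < NN w & exists2 k, k < NN w &
  cellA w s i /\ seg w i k [:: true] /\ seg w k p [:: false] /\ NP w p a /\ NPd w a.
Definition ra w s p a b : Prop := exists2 i, i < NN w & exists2 k, k < NN w &
  cellA w s i /\ seg w i k [:: true] /\ seg w k p [:: true] /\ NP w p a /\ NP w a b /\ NPd w b.
Definition nin w s p : Prop := exists2 i, i < NN w &
  cellN w s i /\ seg w i p [:: true] /\ NPd w p.

Lemma Def_inc f g h : DT f -> DT g -> DT h ->
  Def (fun w R e => inc w (f w e) (g w e) (h w e)).
Proof. by apply: (Def_app3 (P := inc)); rewrite /inc; defs. Qed.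
Lemma Def_ca f g h : DT f -> DT g -> DT h ->
  Def (fun w R e => ca w (f w e) (g w e) (h w e)).
Proof. by apply: (Def_app3 (P := ca)); rewrite /ca; defs. Qed.
Lemma Def_ra f g h k : DT f -> DT g -> DT h -> DT k ->
  Def (fun w R e => ra w (f w e) (g w e) (h w e) (k w e)).
Proof. by apply: (Def_app4 (P := ra)); rewrite /ra; defs. Qed.
Lemma Def_nin f g : DT f -> DT g -> Def (fun w R e => nin w (f w e) (g w e)).
Proof. by apply: (Def_app2 (P := nin)); rewrite /nin; defs. Qed.
#[local] Hint Resolve Def_inc Def_ca Def_ra Def_nin : def.

Section Membership.

Variables (w : seq bool) (s j : nat).

Lemma inc_sound T a b : seg w s j (enc_list enc_inclusion T) -> inc w s a b ->
  exists C D, [/\ cpt w a C, cpt w b D & List.In (C, D) T].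
Proof.
move=> Hl [i _ [Hc [Hs [[C HC] /cpt_CPd[D [m HD]]]]]]; exists C, D; split.
- by exists b.
- by exists m.
apply: (cell_In enc_inclusion_prefix Hl Hc Hs (m := m)).
by rewrite /enc_inclusion seg_cat; exists b.
Qed.

Lemma inc_complete T C D : seg w s j (enc_list enc_inclusion T) -> List.In (C, D) T ->
  exists a b, [/\ inc w s a b, cpt w a C & cpt w b D].
Proof.
move=> Hl /(In_cell Hl)[i [k [m [Hc Hs]]]]; rewrite /enc_inclusion seg_cat => -[b [HC HD]].
exists k, b; split; [|by exists b|by exists m].
exists i; first by case: (seg_NN Hs).
by split=> //; split=> //; split; [exists C|apply/cpt_CPd; exists D, m].
Qed.

Lemma ca_sound A p a : seg w s j (enc_list enc_assertion A) -> ca w s p a ->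
  exists P x, [/\ nm w p P, nm w a x & List.In (AConcept P x) A].
Proof.
move=> Hl [i _ [k _ [Hc [Hs [Hp [[P HP] /nm_NPd[x [m Hx]]]]]]]]; exists P, x; split.
- by exists a.
- by exists m.
apply: (cell_In enc_assertion_prefix Hl Hc Hs (m := m)).
by rewrite /= -cat1s seg_cat; exists p; split=> //; apply/seg_cat; exists a.
Qed.

Lemma ca_complete A P x : seg w s j (enc_list enc_assertion A) -> List.In (AConcept P x) A ->
  exists p a, [/\ ca w s p a, nm w p P & nm w a x].
Proof.
move=> Hl /(In_cell Hl)[i [k [m [Hc Hs]]]]; rewrite /= -cat1s seg_cat.
move=> [p [Hp /seg_cat[a [HP Hx]]]]; exists p, a; split; [|by exists a|by exists m].
have [li lk] := seg_NN Hs; exists i => //; exists k => //.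
by do 3 split=> //; split; [exists P|apply/nm_NPd; exists x, m].
Qed.

Lemma ra_sound A p a b : seg w s j (enc_list enc_assertion A) -> ra w s p a b ->
  exists P x y, [/\ nm w p P, nm w a x, nm w b y & List.In (ARole P x y) A].
Proof.
move=> Hl [i _ [k _ [Hc [Hs [Hp [[P HP] [[x Hx] /nm_NPd[y [m Hy]]]]]]]]]; exists P, x, y; split.
- by exists a.
- by exists b.
- by exists m.
apply: (cell_In enc_assertion_prefix Hl Hc Hs (m := m)).
rewrite /= -cat1s seg_cat; exists p; split=> //; apply/seg_cat; exists a; split=> //.
by apply/seg_cat; exists b.
Qed.

Lemma ra_complete A P x y : seg w s j (enc_list enc_assertion A) -> List.In (ARole P x y) A ->
  exists p a b, [/\ ra w s p a b, nm w p P, nm w a x & nm w b y].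
Proof.
move=> Hl /(In_cell Hl)[i [k [m [Hc Hs]]]]; rewrite /= -cat1s seg_cat.
move=> [p [Hp /seg_cat[a [HP /seg_cat[b [Hx Hy]]]]]].
exists p, a, b; split; [|by exists a|by exists b|by exists m].
have [li lk] := seg_NN Hs; exists i => //; exists k => //.
by do 3 split=> //; split; [exists P|split; [exists x|apply/nm_NPd; exists y, m]].
Qed.

Lemma nin_sound l p : seg w s j (enc_list enc_name l) -> nin w s p ->
  exists2 P, nm w p P & P \in l.
Proof.
move=> Hl [i _ [Hc [Hs /nm_NPd[P [m HP]]]]]; exists P; first by exists m.
have := cell_In enc_name_prefix Hl Hc Hs HP.
by elim: l {Hl} => //= x l IH; rewrite inE => -[->|/IH->]; rewrite ?eqxx ?orbT.
Qed.

Lemma nin_complete l P : seg w s j (enc_list enc_name l) -> P \in l ->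
  exists2 p, nin w s p & nm w p P.
Proof.
move=> Hl Pl; have : List.In P l.
  by elim: l Pl {Hl} => //= x l IH; rewrite inE => /orP[/eqP->|/IH]; [left|right].
move=> /(In_cell Hl)[i [k [m [Hc Hs Hm]]]]; exists k; last by exists m.
exists i; first by case: (seg_NN Hs).
by split=> //; split=> //; apply/nm_NPd; exists P, m.
Qed.

End Membership.

Definition kTop w i : Prop := exists2 j, j < NN w & seg w i j [:: false; false; true].
Definition kNm w i p : Prop := seg w i p [:: false; false; false] /\ NPd w p.
Definition kNot w i a : Prop := seg w i a [:: false; true; false] /\ CPd w a.
Definition kAnd w i a b : Prop := seg w i a [:: false; true; true] /\ CP w a b /\ CPd w b.
Definition kEx w i p a : Prop := seg w i p [:: true; false; false] /\ NP w p a /\ CPd w a.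

Lemma Def_kTop f : DT f -> Def (fun w R e => kTop w (f w e)).
Proof. by apply: (Def_app1 (P := kTop)); rewrite /kTop; defs. Qed.
Lemma Def_kNm f g : DT f -> DT g -> Def (fun w R e => kNm w (f w e) (g w e)).
Proof. by apply: (Def_app2 (P := kNm)); rewrite /kNm; defs. Qed.
Lemma Def_kNot f g : DT f -> DT g -> Def (fun w R e => kNot w (f w e) (g w e)).
Proof. by apply: (Def_app2 (P := kNot)); rewrite /kNot; defs. Qed.
Lemma Def_kAnd f g h : DT f -> DT g -> DT h ->
  Def (fun w R e => kAnd w (f w e) (g w e) (h w e)).
Proof. by apply: (Def_app3 (P := kAnd)); rewrite /kAnd; defs. Qed.
Lemma Def_kEx f g h : DT f -> DT g -> DT h ->
  Def (fun w R e => kEx w (f w e) (g w e) (h w e)).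
Proof. by apply: (Def_app3 (P := kEx)); rewrite /kEx; defs. Qed.

Lemma cpt_kinds w i C : cpt w i C ->
  match C with
  | CName A => exists2 p, kNm w i p & nm w p A
  | CTop => kTop w i
  | CNot C => exists2 a, kNot w i a & cpt w a C
  | CAnd C D => exists a b, [/\ kAnd w i a b, cpt w a C & cpt w b D]
  | CEx P C => exists p a, [/\ kEx w i p a, nm w p P & cpt w a C]
  end.
Proof.
move=> [j]; case: C => [A||C|C D|P C]; rewrite [enc_concept _]/=.
- rewrite -[_ :: _]/([:: false; false; false] ++ enc_name A) seg_cat => -[p [Hs HA]].
  by exists p; [split=> //; apply/nm_NPd; exists A, j|exists j].
- by move=> Hs; exists j => //; case: (seg_NN Hs).
- rewrite -[_ :: _]/([:: false; true; false] ++ enc_concept C) seg_cat => -[a [Hs HC]].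
  by exists a; [split=> //; apply/cpt_CPd; exists C, j|exists j].
- rewrite -[_ :: _]/([:: false; true; true] ++ (enc_concept C ++ enc_concept D)) seg_cat.
  move=> [a [Hs /seg_cat[b [HC HD]]]]; exists a, b; split; [|by exists b|by exists j].
  by split=> //; split; [exists C|apply/cpt_CPd; exists D, j].
- rewrite -[_ :: _]/([:: true; false; false] ++ (enc_name P ++ enc_concept C)) seg_cat.
  move=> [p [Hs /seg_cat[a [HP HC]]]]; exists p, a; split; [|by exists a|by exists j].
  by split=> //; split; [exists P|apply/cpt_CPd; exists C, j].
Qed.

Lemma kTop_cpt w i : kTop w i -> cpt w i CTop.
Proof. by move=> [j _ H]; exists j. Qed.

Lemma kNm_cpt w i p : kNm w i p -> exists2 A, nm w p A & cpt w i (CName A).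
Proof.
move=> [Hs /nm_NPd[A [j HA]]]; exists A; exists j => //.
by rewrite [enc_concept _]/= -[_ :: _]/([:: false; false; false] ++ enc_name A) seg_cat; exists p.
Qed.

Lemma kNot_cpt w i a : kNot w i a -> exists2 C, cpt w a C & cpt w i (CNot C).
Proof.
move=> [Hs /cpt_CPd[C [j HC]]]; exists C; exists j => //.
by rewrite [enc_concept _]/= -[_ :: _]/([:: false; true; false] ++ enc_concept C) seg_cat; exists a.
Qed.

Lemma kAnd_cpt w i a b : kAnd w i a b ->
  exists C D, [/\ cpt w a C, cpt w b D & cpt w i (CAnd C D)].
Proof.
move=> [Hs [[C HC] /cpt_CPd[D [j HD]]]]; exists C, D; split; [by exists b|by exists j|exists j].
rewrite [enc_concept _]/= -[_ :: _]/([:: false; true; true] ++ (enc_concept C ++ enc_concept D)).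
by rewrite seg_cat; exists a; split=> //; apply/seg_cat; exists b.
Qed.

Lemma kEx_cpt w i p a : kEx w i p a ->
  exists P C, [/\ nm w p P, cpt w a C & cpt w i (CEx P C)].
Proof.
move=> [Hs [[P HP] /cpt_CPd[C [j HC]]]]; exists P, C; split; [by exists a|by exists j|exists j].
rewrite [enc_concept _]/= -[_ :: _]/([:: true; false; false] ++ (enc_name P ++ enc_concept C)).
by rewrite seg_cat; exists p; split=> //; apply/seg_cat; exists a.
Qed.

(** * The criterion *)

#[local] Hint Resolve Def_kTop Def_kNm Def_kNot Def_kAnd Def_kEx : def.

Lemma Def_app5 (P : seq bool -> nat -> nat -> nat -> nat -> nat -> Prop) f1 f2 f3 f4 f5 :
  Def (fun w R e => P w (e 0) (e 1) (e 2) (e 3) (e 4)) ->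
  DT f1 -> DT f2 -> DT f3 -> DT f4 -> DT f5 ->
  Def (fun w R e => P w (f1 w e) (f2 w e) (f3 w e) (f4 w e) (f5 w e)).
Proof. by move=> DP *; apply: (Def_substs (ts := [:: f1; f2; f3; f4; f5]) DP). Qed.

Lemma Def_app6 (P : seq bool -> nat -> nat -> nat -> nat -> nat -> nat -> Prop)
    f1 f2 f3 f4 f5 f6 :
  Def (fun w R e => P w (e 0) (e 1) (e 2) (e 3) (e 4) (e 5)) ->
  DT f1 -> DT f2 -> DT f3 -> DT f4 -> DT f5 -> DT f6 ->
  Def (fun w R e => P w (f1 w e) (f2 w e) (f3 w e) (f4 w e) (f5 w e) (f6 w e)).
Proof. by move=> DP *; apply: (Def_substs (ts := [:: f1; f2; f3; f4; f5; f6]) DP). Qed.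

Lemma Def_app7 (P : seq bool -> nat -> nat -> nat -> nat -> nat -> nat -> nat -> Prop)
    f1 f2 f3 f4 f5 f6 f7 :
  Def (fun w R e => P w (e 0) (e 1) (e 2) (e 3) (e 4) (e 5) (e 6)) ->
  DT f1 -> DT f2 -> DT f3 -> DT f4 -> DT f5 -> DT f6 -> DT f7 ->
  Def (fun w R e => P w (f1 w e) (f2 w e) (f3 w e) (f4 w e) (f5 w e) (f6 w e) (f7 w e)).
Proof. by move=> DP *; apply: (Def_substs (ts := [:: f1; f2; f3; f4; f5; f6; f7]) DP). Qed.

Lemma Def_app9
    (P : seq bool -> nat -> nat -> nat -> nat -> nat -> nat -> nat -> nat -> nat -> Prop)
    f1 f2 f3 f4 f5 f6 f7 f8 f9 :
  Def (fun w R e => P w (e 0) (e 1) (e 2) (e 3) (e 4) (e 5) (e 6) (e 7) (e 8)) ->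
  DT f1 -> DT f2 -> DT f3 -> DT f4 -> DT f5 -> DT f6 -> DT f7 -> DT f8 -> DT f9 ->
  Def (fun w R e => P w (f1 w e) (f2 w e) (f3 w e) (f4 w e) (f5 w e) (f6 w e) (f7 w e)
                      (f8 w e) (f9 w e)).
Proof.
by move=> DP *; apply: (Def_substs (ts := [:: f1; f2; f3; f4; f5; f6; f7; f8; f9]) DP).
Qed.

(** * Sizes of the coded objects *)

Definition KT (w : seq bool) : nat := 2 ^ (size w + size w).
(** With n = [size w] the inner exponent is 6n+6, which leaves room for the compressed ranks by
    [rank_space]; it is written with sums only, which [DT_WW] follows. *)
Definition WW (w : seq bool) : nat :=
  2 ^ (2 ^ (((size w).+1 + (size w).+1) + (((size w).+1 + (size w).+1) + ((size w).+1 + (size w).+1)))).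
Definition top (w : seq bool) : nat := (WW w).-1.
(** One value more than there are positions: [size w] marks a type that fails by a concept name,
    with no restriction to follow. *)
Definition KS (w : seq bool) : nat := (size w).+1.
Definition WK (w : seq bool) : nat := WW w ^ KT w.
Definition SK (w : seq bool) : nat := KS w ^ KT w.

Lemma lin_exp a n : n * 2 ^ a <= 2 ^ (n + a).
Proof. by rewrite expnD leq_mul2r (ltnW (ltn_expl n _)) ?orbT. Qed.

Lemma WK_pow w : WK w = 2 ^ (2 ^ (8 * size w + 6)).
Proof. by rewrite /WK /WW /KT -expnM -expnD; congr (2 ^ (2 ^ _)); lia. Qed.

Lemma SK_le w : SK w <= WK w.
Proof.
rewrite /SK /WK leq_exp2r ?expn_gt0 // /KS /WW.
apply: ltn_trans (ltn_expl (size w) (isT : 1 < 2)) _; rewrite ltn_exp2l //.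
by apply: leq_trans (ltnW (ltn_expl _ (isT : 1 < 2))); lia.
Qed.

Lemma KT_le w : KT w <= WK w.
Proof. by rewrite WK_pow /KT leq_exp2l //; apply: leq_trans (ltnW (ltn_expl _ (isT : 1 < 2))); lia. Qed.

(** The largest objects quantified over are arrays with one rank function per position. Raising
    2^(2^(8n+6)) to the power n+1 adds at most n+1 to the inner exponent, which stays below
    10n+10. *)
Lemma arr_NN w : WK w ^ (size w).+1 < NN w.
Proof.
rewrite WK_pow -expnM /NN /dexp ltn_exp2l //.
apply: (@leq_ltn_trans (2 ^ ((size w).+1 + (8 * size w + 6)))); first by rewrite mulnC lin_exp.
by rewrite ltn_exp2l //; lia.
Qed.

Lemma WK_NN w : WK w < NN w.
Proof.
apply: leq_ltn_trans (arr_NN w); rewrite -{1}(expn1 (WK w)) leq_pexp2l //.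
by rewrite WK_pow expn_gt0.
Qed.

Lemma WW_le w : WW w <= WK w.
Proof.
rewrite -{1}(expn1 (WW w)) /WK leq_pexp2l ?expn_gt0 //.
Qed.

Lemma bounds_NN w : [/\ KT w < NN w, WW w < NN w, SK w < NN w & KS w < NN w].
Proof.
have := WK_NN w; have := KT_le w; have := WW_le w; have := SK_le w; have := size_NN w.
by rewrite /KS; split; lia.
Qed.

Lemma DT_KT : DT (fun w e => KT w).
Proof.
apply: DT_cst => [w|]; first by case: (bounds_NN w).
apply: (@Def_ext _ (fun w R e => exists2 a, a < NN w & size w + size w = a /\ 2 ^ a = e 0));
  last by defs.
move=> w R e He; rewrite /KT; split=> [E|[a _ [<-]]//].
exists (size w + size w) => //; case: (bounds_NN w) => lt _ _ _.
exact: ltn_trans (ltn_expl _ (isT : 1 < 2)) lt.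
Qed.

Lemma DT_WW : DT (fun w e => WW w).
Proof.
apply: DT_cst => [w|]; first by case: (bounds_NN w).
apply: (@Def_ext _ (fun w R e => exists2 n, n < NN w & exists2 a, a < NN w &
  exists2 b, b < NN w & exists2 c, c < NN w & exists2 d, d < NN w &
  (size w).+1 = n /\ n + n = a /\ a + a = b /\ a + b = c /\ 2 ^ c = d /\ 2 ^ d = e 0));
  last by defs.
move=> w R e He; split=> [E|[n _ [a _ [b _ [c _ [d _ [<- [<- [<- [<- [<- <-]]]]]]]]]]]; last by [].
have lt := He 0; rewrite -E /WW in lt.
have lt1 := ltn_trans (ltn_expl _ (isT : 1 < 2)) lt.
have lt2 := ltn_trans (ltn_expl _ (isT : 1 < 2)) lt1.
exists (size w).+1; first lia.
exists ((size w).+1 + (size w).+1); first lia.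
exists (((size w).+1 + (size w).+1) + ((size w).+1 + (size w).+1)); first lia.
exists (((size w).+1 + (size w).+1) + (((size w).+1 + (size w).+1) + ((size w).+1 + (size w).+1)));
  first lia.
by eexists; [exact: lt1|].
Qed.

Lemma DT_top : DT (fun w e => top w).
Proof.
apply: DT_cst => [w|]; first by case: (bounds_NN w) => _ + _ _; rewrite /top; lia.
apply: (@Def_ext _ (fun w R e => exists2 a, a < NN w & (e 0).+1 = a /\ WW w = a));
  last by have := DT_WW; defs.
move=> w R e He; have W_gt : 0 < WW w by rewrite expn_gt0.
rewrite /top; split=> [<-|[a _ [<- ->]]] //.
by exists (WW w); [case: (bounds_NN w)|rewrite prednK].
Qed.

Lemma DT_KS : DT (fun w e => KS w).
Proof.
apply: DT_cst => [w|]; first by case: (bounds_NN w).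
by rewrite /KS; defs.
Qed.

Lemma DT_WK : DT (fun w e => WK w).
Proof.
apply: DT_cst => [w|]; first exact: WK_NN.
by rewrite /WK; have := DT_WW; have := DT_KT; defs.
Qed.

Lemma DT_SK : DT (fun w e => SK w).
Proof.
apply: DT_cst => [w|]; first by case: (bounds_NN w).
by rewrite /SK; have := DT_KS; have := DT_KT; defs.
Qed.
#[local] Hint Resolve DT_KT DT_WW DT_top DT_KS DT_WK DT_SK : def.

(* A type is a number below [KT w] used as a bit vector: bit [i] stands for the concept written
   at position [i] of [w], bit [size w + p] for the concept name written at position [p]. *)
Definition inb (t i : nat) : Prop := dig 2 t i = 1.
Definition nb (w : seq bool) (t p : nat) : Prop := exists2 q, q < NN w & size w + p = q /\ inb t q.

Lemma Def_inb f g : DT f -> DT g -> Def (fun w R e => inb (f w e) (g w e)).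
Proof. by rewrite /inb; defs. Qed.
#[local] Hint Resolve Def_inb : def.
Lemma Def_nb f g : DT f -> DT g -> Def (fun w R e => nb w (f w e) (g w e)).
Proof. by apply: (Def_app2 (P := nb)); rewrite /nb; defs. Qed.
#[local] Hint Resolve Def_nb : def.

(** Only the Boolean structure is local; existential restrictions are dealt with by [propg] and by
    the choice of successors. *)
Definition vld (w : seq bool) (t : nat) : Prop :=
  (forall i, i < NN w -> kTop w i -> inb t i) /\
  (forall i, i < NN w -> forall p, p < NN w -> kNm w i p -> (inb t i <-> nb w t p)) /\
  (forall i, i < NN w -> forall a, a < NN w -> kNot w i a -> (inb t i <-> ~ inb t a)) /\
  (forall i, i < NN w -> forall a, a < NN w -> forall b, b < NN w ->
     kAnd w i a b -> (inb t i <-> inb t a /\ inb t b)) /\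
  (forall p, p < NN w -> forall q, q < NN w -> nmeq w p q -> (nb w t p <-> nb w t q)).

Definition vldT (w : seq bool) (s t : nat) : Prop :=
  vld w t /\ forall a, a < NN w -> forall b, b < NN w -> inc w s a b -> inb t a -> inb t b.

(* With [h > 0] the right-hand KB has no types, and the criterion degenerates to the
   consistency of the left-hand KB. *)
Definition vld2 (w : seq bool) (s h t : nat) : Prop := ~ 0 < h /\ vldT w s t.

(** The constraint that a negated existential restriction puts on a successor, in contrapositive
    form. *)
Definition propg (w : seq bool) (t p t' : nat) : Prop :=
  forall j, j < NN w -> forall q, q < NN w -> forall a, a < NN w ->
    kEx w j q a -> nmeq w p q -> inb t' a -> inb t j.

Definition compat (w : seq bool) (s h t p a t' : nat) : Prop :=
  t' < KT w /\ vld2 w s h t' /\ inb t' a /\ propg w t p t'.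

Definition insig (w : seq bool) (s p : nat) : Prop :=
  exists2 q, q < NN w & nin w s q /\ nmeq w p q.

(* A label is a triple [(tau, r, s)]: a type [tau] of K1, and the codes of two functions of the
   types [t] of K2, a rank in base [WW w], [top w] standing for infinity, and the position of
   an existential restriction in base [KS w]. *)
Definition rk (w : seq bool) (r t : nat) : nat := dig (WW w) r t.
Definition str (w : seq bool) (s t : nat) : nat := dig (KS w) s t.

(** What an edge with role [p] owes to the refutation: if the restriction that [s] singles out for
    [t] is along this role and the role is in Σ, the end of the edge is a possible answer, and every
    type offered there must fail in fewer rounds. *)
Definition Ob (w : seq bool) (tr h sr r s p r' : nat) : Prop :=
  forall t, t < NN w -> t < KT w -> vld2 w tr h t -> rk w r t < top w ->
  forall j, j < NN w -> forall p', p' < NN w -> forall a, a < NN w ->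
    str w s t = j -> kEx w j p' a -> nmeq w p p' -> insig w sr p ->
    forall t', t' < NN w -> compat w tr h t p a t' -> rk w r' t' < rk w r t.

(* [phi] codes, for each [t], a rank at which the simulation of [t] fails at every element:
   this is what a witness along a role outside Σ is compared with. *)
Definition Just (w : seq bool) (tr h sc sr phi tau r s t : nat) : Prop :=
  (exists2 p, p < NN w & insig w sc p /\ nb w t p /\ ~ nb w tau p) \/
  (exists2 j, j < NN w & exists2 p, p < NN w & exists2 a, a < NN w &
     str w s t = j /\ kEx w j p a /\ inb t j /\
     (~ insig w sr p -> forall t', t' < NN w -> compat w tr h t p a t' -> rk w phi t' < rk w r t)).

(** The size bounds discard all triples outside a finite box in the first round. The comparison with
    [phi] at every label is what makes [phi] a rank of failure everywhere. *)
Definition OKl (w : seq bool) (tl tr h sc sr phi : nat) (Z : rel3) (tau r s : nat) : Prop :=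
  (tau < KT w /\ r < WK w /\ s < SK w) /\ vldT w tl tau /\
  (forall t, t < NN w -> t < KT w -> vld2 w tr h t ->
     rk w r t <= rk w phi t /\ (rk w r t < top w -> Just w tr h sc sr phi tau r s t)) /\
  (forall j, j < NN w -> forall p, p < NN w -> forall a, a < NN w ->
     kEx w j p a -> inb tau j ->
     exists2 tau', tau' < NN w & exists2 r', r' < NN w & exists2 s', s' < NN w &
       Z tau' r' s' /\ inb tau' a /\ propg w tau p tau' /\ Ob w tr h sr r s p r').

(* The greatest fixpoint of [OKl], obtained by iterating the dual operator from below. *)
Definition ZZ (w : seq bool) (tl tr h sc sr phi tau r s : nat) : Prop :=
  ~ iter3 (NN w) (fun R x y z => ~ OKl w tl tr h sc sr phi (fun a b c => ~ R a b c) x y z)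
      tau r s.

Definition tA (w : seq bool) (At p : nat) : nat := dig (KT w) At p.
Definition rA (w : seq bool) (Ar p : nat) : nat := dig (WK w) Ar p.
Definition sA (w : seq bool) (As p : nat) : nat := dig (SK w) As p.

Definition indR (w : seq bool) (ar a : nat) : Prop :=
  exists2 p, p < NN w & ca w ar p a \/
    exists2 b, b < NN w & ra w ar p a b \/ ra w ar p b a.

(* [f] codes types for the individuals of K2 and [t] is the type of one further element, which
   accounts for the queries that match away from the ABox. *)
Definition asg (w : seq bool) (tr ar h f t : nat) : Prop :=
  (forall a, a < NN w -> forall b, b < NN w -> nmeq w a b -> tA w f a = tA w f b) /\
  (forall a, a < NN w -> indR w ar a -> vld2 w tr h (tA w f a)) /\
  (forall p, p < NN w -> forall a, a < NN w -> ca w ar p a -> nb w (tA w f a) p) /\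
  (forall p, p < NN w -> forall a, a < NN w -> forall b, b < NN w ->
     ra w ar p a b -> propg w (tA w f a) p (tA w f b)) /\
  t < KT w /\ vld2 w tr h t.

Definition edge (w : seq bool) (al p a b : nat) : Prop :=
  exists2 p', p' < NN w & exists2 a', a' < NN w & exists2 b', b' < NN w &
    ra w al p' a' b' /\ nmeq w p p' /\ nmeq w a a' /\ nmeq w b b'.

(** The last case is decided by the ABox of K1, because a forest has no other edges between
    individuals. *)
Definition refuted (w : seq bool) (al ar sr phi Ar f t : nat) : Prop :=
  (exists2 a, a < NN w & indR w ar a /\ rk w (rA w Ar a) (tA w f a) < top w) \/
  rk w phi t < top w \/
  (exists2 p, p < NN w & exists2 a, a < NN w & exists2 b, b < NN w &
     ra w ar p a b /\ insig w sr p /\ ~ edge w al p a b).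

Definition arrays (w : seq bool) (al tr h sr At Ar As : nat) : Prop :=
  (forall p, p < NN w -> forall q, q < NN w -> nmeq w p q ->
     tA w At p = tA w At q /\ rA w Ar p = rA w Ar q /\ sA w As p = sA w As q) /\
  (forall p, p < NN w -> forall a, a < NN w -> ca w al p a -> nb w (tA w At a) p) /\
  (forall p, p < NN w -> forall a, a < NN w -> forall b, b < NN w -> ra w al p a b ->
     propg w (tA w At a) p (tA w At b) /\
     Ob w tr h sr (rA w Ar a) (sA w As a) p (rA w Ar b)).

(** The first label is given to the individual names not written in [w], which also denote elements;
    the arrays label the written ones, indexed by position. *)
Definition Crit (w : seq bool) (tl al tr ar sc sr h : nat) : Prop :=
  exists2 phi, phi < NN w &
    (exists2 tau, tau < NN w & exists2 r, r < NN w & exists2 s, s < NN w &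
       ZZ w tl tr h sc sr phi tau r s) /\
    exists2 At, At < NN w & exists2 Ar, Ar < NN w & exists2 As, As < NN w &
      arrays w al tr h sr At Ar As /\
      (forall p, p < NN w -> NPd w p ->
         ZZ w tl tr h sc sr phi (tA w At p) (rA w Ar p) (sA w As p)) /\
      (forall f, f < NN w -> forall t, t < NN w ->
         asg w tr ar h f t -> refuted w al ar sr phi Ar f t).

(** * Definability of the criterion *)

Lemma DT_rk f g : DT f -> DT g -> DT (fun w e => rk w (f w e) (g w e)).
Proof. by rewrite /rk; defs. Qed.
Lemma DT_str f g : DT f -> DT g -> DT (fun w e => str w (f w e) (g w e)).
Proof. by rewrite /str; defs. Qed.
Lemma DT_tA f g : DT f -> DT g -> DT (fun w e => tA w (f w e) (g w e)).
Proof. by rewrite /tA; defs. Qed.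
Lemma DT_rA f g : DT f -> DT g -> DT (fun w e => rA w (f w e) (g w e)).
Proof. by rewrite /rA; defs. Qed.
Lemma DT_sA f g : DT f -> DT g -> DT (fun w e => sA w (f w e) (g w e)).
Proof. by rewrite /sA; defs. Qed.
#[local] Hint Resolve DT_rk DT_str DT_tA DT_rA DT_sA : def.

Lemma Def_vld f : DT f -> Def (fun w R e => vld w (f w e)).
Proof. by apply: (Def_app1 (P := vld)); rewrite /vld; defs. Qed.
#[local] Hint Resolve Def_vld : def.
Lemma Def_vldT f g : DT f -> DT g -> Def (fun w R e => vldT w (f w e) (g w e)).
Proof. by apply: (Def_app2 (P := vldT)); rewrite /vldT; defs. Qed.
#[local] Hint Resolve Def_vldT : def.
Lemma Def_vld2 f g h : DT f -> DT g -> DT h -> Def (fun w R e => vld2 w (f w e) (g w e) (h w e)).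
Proof. by apply: (Def_app3 (P := vld2)); rewrite /vld2; defs. Qed.
#[local] Hint Resolve Def_vld2 : def.
Lemma Def_propg f g h : DT f -> DT g -> DT h ->
  Def (fun w R e => propg w (f w e) (g w e) (h w e)).
Proof. by apply: (Def_app3 (P := propg)); rewrite /propg; defs. Qed.
#[local] Hint Resolve Def_propg : def.
Lemma Def_compat f1 f2 f3 f4 f5 f6 : DT f1 -> DT f2 -> DT f3 -> DT f4 -> DT f5 -> DT f6 ->
  Def (fun w R e => compat w (f1 w e) (f2 w e) (f3 w e) (f4 w e) (f5 w e) (f6 w e)).
Proof. by apply: (Def_app6 (P := compat)); rewrite /compat; defs. Qed.
#[local] Hint Resolve Def_compat : def.
Lemma Def_insig f g : DT f -> DT g -> Def (fun w R e => insig w (f w e) (g w e)).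
Proof. by apply: (Def_app2 (P := insig)); rewrite /insig; defs. Qed.
#[local] Hint Resolve Def_insig : def.
Lemma Def_Ob f1 f2 f3 f4 f5 f6 f7 :
  DT f1 -> DT f2 -> DT f3 -> DT f4 -> DT f5 -> DT f6 -> DT f7 ->
  Def (fun w R e => Ob w (f1 w e) (f2 w e) (f3 w e) (f4 w e) (f5 w e) (f6 w e) (f7 w e)).
Proof. by apply: (Def_app7 (P := Ob)); rewrite /Ob; defs. Qed.
#[local] Hint Resolve Def_Ob : def.
Lemma Def_Just f1 f2 f3 f4 f5 f6 f7 f8 f9 :
  DT f1 -> DT f2 -> DT f3 -> DT f4 -> DT f5 -> DT f6 -> DT f7 -> DT f8 -> DT f9 ->
  Def (fun w R e => Just w (f1 w e) (f2 w e) (f3 w e) (f4 w e) (f5 w e) (f6 w e) (f7 w e)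
    (f8 w e) (f9 w e)).
Proof. by apply: (Def_app9 (P := Just)); rewrite /Just; defs. Qed.
#[local] Hint Resolve Def_Just : def.
Lemma Def_ZZ f1 f2 f3 f4 f5 f6 f7 f8 f9 :
  DT f1 -> DT f2 -> DT f3 -> DT f4 -> DT f5 -> DT f6 -> DT f7 -> DT f8 -> DT f9 ->
  Def (fun w R e => ZZ w (f1 w e) (f2 w e) (f3 w e) (f4 w e) (f5 w e) (f6 w e) (f7 w e)
    (f8 w e) (f9 w e)).
Proof.
apply: (Def_app9 (P := ZZ)); rewrite /ZZ; apply: Def_not.
apply: (@Def_iter (fun w R x y z e => ~ OKl w (e 0) (e 1) (e 2) (e 3) (e 4) (e 5)
  (fun a b c => ~ R a b c) x y z)); try by defs.
by rewrite /OKl; defs.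
Qed.
#[local] Hint Resolve Def_ZZ : def.
Lemma Def_indR f g : DT f -> DT g -> Def (fun w R e => indR w (f w e) (g w e)).
Proof. by apply: (Def_app2 (P := indR)); rewrite /indR; defs. Qed.
#[local] Hint Resolve Def_indR : def.
Lemma Def_asg f1 f2 f3 f4 f5 : DT f1 -> DT f2 -> DT f3 -> DT f4 -> DT f5 ->
  Def (fun w R e => asg w (f1 w e) (f2 w e) (f3 w e) (f4 w e) (f5 w e)).
Proof. by apply: (Def_app5 (P := asg)); rewrite /asg; defs. Qed.
#[local] Hint Resolve Def_asg : def.
Lemma Def_edge f1 f2 f3 f4 : DT f1 -> DT f2 -> DT f3 -> DT f4 ->
  Def (fun w R e => edge w (f1 w e) (f2 w e) (f3 w e) (f4 w e)).
Proof. by apply: (Def_app4 (P := edge)); rewrite /edge; defs. Qed.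
#[local] Hint Resolve Def_edge : def.
Lemma Def_refuted f1 f2 f3 f4 f5 f6 f7 :
  DT f1 -> DT f2 -> DT f3 -> DT f4 -> DT f5 -> DT f6 -> DT f7 ->
  Def (fun w R e => refuted w (f1 w e) (f2 w e) (f3 w e) (f4 w e) (f5 w e) (f6 w e) (f7 w e)).
Proof. by apply: (Def_app7 (P := refuted)); rewrite /refuted; defs. Qed.
#[local] Hint Resolve Def_refuted : def.
Lemma Def_arrays f1 f2 f3 f4 f5 f6 f7 :
  DT f1 -> DT f2 -> DT f3 -> DT f4 -> DT f5 -> DT f6 -> DT f7 ->
  Def (fun w R e => arrays w (f1 w e) (f2 w e) (f3 w e) (f4 w e) (f5 w e) (f6 w e) (f7 w e)).
Proof. by apply: (Def_app7 (P := arrays)); rewrite /arrays; defs. Qed.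
#[local] Hint Resolve Def_arrays : def.
Lemma Def_Crit f1 f2 f3 f4 f5 f6 f7 :
  DT f1 -> DT f2 -> DT f3 -> DT f4 -> DT f5 -> DT f6 -> DT f7 ->
  Def (fun w R e => Crit w (f1 w e) (f2 w e) (f3 w e) (f4 w e) (f5 w e) (f6 w e) (f7 w e)).
Proof. by apply: (Def_app7 (P := Crit)); rewrite /Crit; defs. Qed.
#[local] Hint Resolve Def_Crit : def.

(** * From labellings to interpretations *)

Fixpoint code (K a : nat) (f : nat -> nat) : nat :=
  if a is a'.+1 then f 0 + K * code K a' (fun t => f t.+1) else 0.

Lemma code_lt K a f : (forall t, t < a -> f t < K) -> code K a f < K ^ a.
Proof.
elim: a f => [|a IH] f Hf //=; have := IH (fun t => f t.+1) (fun t lt => Hf t.+1 lt).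
by have := Hf 0 isT; rewrite expnS; nia.
Qed.

Lemma dig_code K a f t : (forall t, t < a -> f t < K) -> t < a -> dig K (code K a f) t = f t.
Proof.
elim: a f t => [|a IH] f [|t] Hf //= lt_t; have f0 := Hf 0 isT; have K_gt : 0 < K by lia.
  by rewrite /dig divn1 addnC mulnC modnMDl modn_small.
rewrite /dig expnS divnMA addnC mulnC divnMDl // [f 0 %/ K]divn_small // addn0.
exact: (IH (fun t => f t.+1) t (fun t lt => Hf t.+1 lt)).
Qed.

Lemma dig_lt K x t : 0 < K -> dig K x t < K.
Proof. exact: ltn_pmod. Qed.

Definition bcode (a : nat) (P : nat -> Prop) : nat := code 2 a (fun i => `[< P i >]).

Lemma bcode_lt a P : bcode a P < 2 ^ a.
Proof. by apply: code_lt => t _; case: asboolP. Qed.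

Lemma inb_bcode a P i : i < a -> (inb (bcode a P) i <-> P i).
Proof.
move=> lt_i; rewrite /inb /bcode dig_code //; last by move=> t _; case: asboolP.
by case: asboolP.
Qed.

Section Types.

Variable w : seq bool.
Let n := size w.

Lemma nn_NN : n + n < NN w.
Proof.
apply: leq_ltn_trans (ltnW (ltn_expl _ (isT : 1 < 2))) _; rewrite -/(KT w).
by case: (bounds_NN w).
Qed.

Lemma nbE t p : p < n -> (nb w t p <-> inb t (n + p)).
Proof.
move=> lt_p; split=> [[q _ [<-]]//|H]; exists (n + p) => //.
by have := nn_NN; lia.
Qed.

Definition tpn (I : interpretation) (d : dom I) : nat :=
  bcode (n + n) (fun i => if i < n then exists2 C, cpt w i C & ext C d
                          else exists2 A, nm w (i - n) A & cint A d).

Variable I : interpretation.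

Lemma tpn_lt (d : dom I) : tpn d < KT w.
Proof. exact: bcode_lt. Qed.

Lemma tpn_inb (d : dom I) i C : cpt w i C -> (inb (tpn d) i <-> ext C d).
Proof.
move=> HC; have lt_i : i < n := cpt_lt HC; rewrite inb_bcode; last lia.
rewrite lt_i; split=> [[D HD]|]; last by exists C.
by rewrite (cpt_inj HC HD).
Qed.

Lemma tpn_nb (d : dom I) p A : nm w p A -> (nb w (tpn d) p <-> cint A d).
Proof.
move=> HA; have lt_p : p < n := nm_lt HA; rewrite nbE // inb_bcode; last lia.
rewrite ltnNge leq_addr /= addKn; split=> [[D HD]|]; last by exists A.
by rewrite (nm_inj HA HD).
Qed.

Lemma tpn_vld (d : dom I) : vld w (tpn d).
Proof.
split=> [i _ /kTop_cpt /tpn_inb ->//|]; split=> [i _ p _ H|].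
  by have [A HA HC] := kNm_cpt H; rewrite (tpn_inb _ HC) (tpn_nb _ HA).
split=> [i _ a _ /kNot_cpt[C HC HD]|]; first by rewrite (tpn_inb _ HC) (tpn_inb _ HD).
split=> [i _ a _ b _ /kAnd_cpt[C [D [HC HD HE]]]|].
  by rewrite (tpn_inb _ HC) (tpn_inb _ HD) (tpn_inb _ HE).
by move=> p _ q _ [A [Hp Hq]]; rewrite (tpn_nb _ Hp) (tpn_nb _ Hq).
Qed.

Lemma tpn_vldT (d : dom I) T s j : seg w s j (enc_list enc_inclusion T) ->
  List.Forall (sat_inclusion I) T -> vldT w s (tpn d).
Proof.
move=> Hs /List.Forall_forall HT; split; first exact: tpn_vld.
move=> a _ b _ /(inc_sound Hs)[C [D [HC HD HCD]]]; rewrite (tpn_inb _ HC) (tpn_inb _ HD).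
exact: HT HCD d.
Qed.

Lemma tpn_propg (d e : dom I) p P : nm w p P -> rint P d e -> propg w (tpn d) p (tpn e).
Proof.
move=> HP Hde j _ q _ a _ /kEx_cpt[Q [C [HQ HC HE]]] [X [Hp Hq]].
rewrite (tpn_inb _ HC) (tpn_inb _ HE) => HCe; exists e => //.
by rewrite (nm_inj HQ Hq) -(nm_inj HP Hp).
Qed.

End Types.

Lemma kEx_lt w j p a : kEx w j p a -> [/\ j < size w, p < size w & a < size w].
Proof.
by move=> /kEx_cpt[P [C [HP HC HE]]]; rewrite (nm_lt HP) (cpt_lt HC) (cpt_lt HE).
Qed.

Lemma lt_NN w i : i < size w -> i < NN w.
Proof. by have := size_NN w; lia. Qed.

Section Forest.

Variables (w : seq bool) (lab : iname * seq nat -> nat) (K : kb) (s js sa ja : nat).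
Hypotheses (Hs : seg w s js (enc_list enc_inclusion (tbox K)))
  (Ha : seg w sa ja (enc_list enc_assertion (abox K))).

Definition child (d : iname * seq nat) (j : nat) : iname * seq nat := (d.1, j :: d.2).

Lemma root_inj : injective (fun a : iname => (a, [::] : seq nat)).
Proof. by move=> a b []. Qed.

(** A node is an individual with a word of positions, and child [j] is the witness for the
    restriction written at [j]. All words are nodes; a child that is not called for gets no edge
    from its parent. *)
Definition forest : interpretation :=
  @Interpretation (iname * seq nat) (fun a => (a, [::])) root_inj
    (fun A d => exists2 p, nm w p A & nb w (lab d) p)
    (fun P d e =>
       (exists j p a, [/\ e = child d j, kEx w j p a, nm w p P & inb (lab d) j]) \/
       [/\ d.2 = [::], e.2 = [::] & List.In (ARole P d.1 e.1) (abox K)]).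

Hypotheses (lab_vld : forall d, vldT w s (lab d))
  (lab_child : forall d j p a, kEx w j p a -> inb (lab d) j ->
     inb (lab (child d j)) a /\ propg w (lab d) p (lab (child d j)))
  (lab_role : forall p a b x y, ra w sa p a b -> nm w a x -> nm w b y ->
     propg w (lab (x, [::])) p (lab (y, [::])))
  (lab_conc : forall p a x, ca w sa p a -> nm w a x -> nb w (lab (x, [::])) p).

Lemma forest_propg P (d e : dom forest) p : nm w p P -> rint P d e ->
  propg w (lab d) p (lab e).
Proof.
move=> HP [[j [q [a [-> Hk Hq /(lab_child Hk)[_ Hpr]]]]]|].
  move=> j' lj' q' lq' a' la' Hk' [A [Hp' Hq']] Hin; apply: (Hpr j' lj' q' lq' a' la') => //.
  by exists A; split=> //; rewrite -(nm_inj HP Hp').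
case: d e => [x u] [y v] /= [-> -> /(ra_complete Ha)[p' [a [b [Hra Hp' Hx Hy]]]]].
move=> j lj q lq a' la' Hk [A [HA Hq]] Hin.
apply: (lab_role Hra Hx Hy lj lq la' Hk) => //.
by exists A; split=> //; rewrite -(nm_inj HP HA).
Qed.

(** An existential restriction in the label is witnessed by its own child; conversely [propg] holds
    along every edge, tree or ABox, and brings a restriction true in the forest back into the
    label. *)
Lemma forest_truth C i (d : dom forest) : cpt w i C -> (inb (lab d) i <-> ext C d).
Proof.
elim: C i d => [A||C IH|C IHC D IHD|P C IH] i d HC; have lt_i := lt_NN (cpt_lt HC);
  have [[v1 [v2 [v3 [v4 v5]]]] _] := lab_vld d.
- have [p Hk Hp] := cpt_kinds HC; have lp := lt_NN (nm_lt Hp).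
  rewrite (v2 _ lt_i _ lp Hk) /=; split=> [H|[q Hq]]; first by exists p.
  by apply: (proj2 (v5 _ lp _ (lt_NN (nm_lt Hq)) _)); exists A.
- by split=> // _; apply: v1 => //; exact: (cpt_kinds HC).
- have [a Hk Hc] := cpt_kinds HC.
  by rewrite (v3 _ lt_i _ (lt_NN (cpt_lt Hc)) Hk) /= (IH _ _ Hc).
- have [a [b [Hk Hc Hd]]] := cpt_kinds HC.
  by rewrite (v4 _ lt_i _ (lt_NN (cpt_lt Hc)) _ (lt_NN (cpt_lt Hd)) Hk) /= (IHC _ _ Hc) (IHD _ _ Hd).
have [p [a [Hk Hp Hc]]] := cpt_kinds HC; have [lj lp la] := kEx_lt Hk; split=> [Hin|[e Hde He]].
  have [H1 _] := lab_child Hk Hin.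
  exists (child d i); first by left; exists i, p, a.
  exact/(IH _ _ Hc).
apply: (forest_propg Hp Hde (lt_NN lj) (lt_NN lp) (lt_NN la) Hk); first by exists P.
exact/(IH _ _ Hc).
Qed.

Lemma forest_model : model forest K.
Proof.
split; apply/List.Forall_forall.
  move=> [C D] /(inc_complete Hs)[a [b [Hi HC HD]]] d /= /(forest_truth _ HC) H.
  apply/(forest_truth _ HD); have [_ Hv] := lab_vld d.
  exact: Hv (lt_NN (cpt_lt HC)) _ (lt_NN (cpt_lt HD)) Hi H.
move=> [P x|P x y] Hin /=; last by right.
by have [p [a [Hca Hp Hx]]] := ca_complete Ha Hin; exists p => //; exact: lab_conc Hca Hx.
Qed.

End Forest.

(** * Reaching the fixpoint in N rounds *)

Section Saturation.

Variables (a b c N : nat) (F : rel3 -> rel3).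
Hypotheses (lt_N : a * b * c < N)
  (F_mono : forall R R' : rel3, (forall x y z, R x y z -> R' x y z) ->
     forall x y z, F R x y z -> F R' x y z)
  (F_out : forall R x y z, ~ (x < a /\ y < b /\ z < c) -> F R x y z).

(** The iterates are compared with those of an operator on subsets of the box of size abc, which are
    stationary after abc rounds. The two sequences interleave with a shift of one, since the empty
    relation lacks the triples outside the box; hence the strict bound abc < N. *)
Lemma iter3_fix x y z : F (iter3 N F) x y z -> iter3 N F x y z.
Proof.
pose T : finType := ('I_a * 'I_b * 'I_c)%type.
pose rel_of (X : {set T}) : rel3 := fun x y z =>
  ~ (x < a /\ y < b /\ z < c) \/
  exists t : T, [/\ t \in X, x = t.1.1, y = t.1.2 & z = t.2].
pose G (X : {set T}) : {set T} := [set t : T | `[< F (rel_of X) t.1.1 t.1.2 t.2 >]].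
have rel_mono (X Y : {set T}) : X \subset Y -> forall x y z, rel_of X x y z -> rel_of Y x y z.
  by move=> /subsetP H x' y' z' [out|[t [/H tY -> -> ->]]]; [left|right; exists t].
have G_mono : {homo G : X Y / X \subset Y}.
  move=> X Y sXY; apply/subsetP => t; rewrite !inE => /asboolP H; apply/asboolP.
  exact: F_mono (rel_mono _ _ sXY) _ _ _ H.
have rel_G X x' y' z' : rel_of (G X) x' y' z' <-> F (rel_of X) x' y' z'.
  split=> [[out|[t [+ -> -> ->]]]|H]; first exact: F_out.
    by rewrite inE => /asboolP.
  case: (pselect (x' < a /\ y' < b /\ z' < c)) => [[lx [ly lz]]|]; last by left.
  by right; exists (Ordinal lx, Ordinal ly, Ordinal lz); split=> //; rewrite inE; apply/asboolP.
pose X s := iter s G set0.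
have Xfix s : #|T| <= s -> X s = fixset G.
  move=> le_s; rewrite -(subnK le_s) /X iterD -/(fixset G).
  by elim: (s - _) => //= k ->; exact: fixsetK.
pose R s : rel3 := iter s F (fun _ _ _ => False).
have upper s : forall x y z, R s x y z -> rel_of (X s) x y z.
  elim: s => [|s IH] x' y' z' //; rewrite /R iterS => H; apply/rel_G.
  exact: F_mono IH _ _ _ H.
have lower s : forall x y z, rel_of (X s) x y z -> R s.+1 x y z.
  elim: s => [|s IH] x' y' z'.
    by case=> [out|[t [+ _ _ _]]]; [exact: F_out|rewrite inE].
  by move/rel_G => H; rewrite /R iterS; apply: F_mono H.
have cT : #|T| = a * b * c by rewrite !card_prod !card_ord.
have [N' EN] : exists N', N = N'.+1 by exists N.-1; lia.
have le_N' : #|T| <= N' by rewrite cT; lia.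
rewrite /iter3 -/(R N) => H.
have {H} : F (rel_of (fixset G)) x y z.
  apply: F_mono H => x' y' z' /upper; rewrite Xfix // EN; exact: leqW.
move/rel_G; rewrite (fixsetK G_mono) -(Xfix N') // EN; exact: lower.
Qed.

End Saturation.

Lemma nmeq_sym w p q : nmeq w p q -> nmeq w q p.
Proof. by move=> [A [Hp Hq]]; exists A. Qed.

Lemma insig_nmeq w s p q : nmeq w p q -> insig w s p -> insig w s q.
Proof.
move=> [A [Hp Hq]] [r lr [Hr [B [Hp' Hr']]]]; exists r => //; split=> //.
by exists A; split=> //; rewrite (nm_inj Hp Hp').
Qed.

Lemma propg_nmeq w t p q t' : nmeq w p q -> propg w t p t' -> propg w t q t'.
Proof.
move=> [A [Hp Hq]] H j lj r lr a la Hk [B [Hq' Hr]]; apply: (H _ lj _ lr _ la Hk).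
by exists A; split=> //; rewrite (nm_inj Hq Hq').
Qed.

Lemma compat_nmeq w s h t p q a t' : nmeq w p q -> compat w s h t p a t' -> compat w s h t q a t'.
Proof. by move=> E [l [v [i pr]]]; do 3 split=> //; exact: propg_nmeq E pr. Qed.

Lemma NP_inj w p a b : NP w p a -> NP w p b -> a = b.
Proof. by move=> [A HA] [B HB]; case: (seg_inj enc_name_prefix HA HB). Qed.

Lemma kEx_inj w j p a p' a' : kEx w j p a -> kEx w j p' a' -> p = p' /\ a = a'.
Proof.
move=> [[u [v [_ Eu Ep]]] [Ha _]] [[u' [v' [_ Eu' Ep']]] [Ha' _]].
by have E : p = p' by [rewrite Ep Ep']; split=> //; rewrite -E in Ha'; exact: NP_inj Ha Ha'.
Qed.

Lemma card_NN w : KT w * WK w * SK w < NN w.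
Proof.
have H1 : KT w * WK w * SK w <= WK w * WK w * WK w by rewrite !leq_mul ?KT_le ?SK_le.
apply: leq_ltn_trans H1 _; rewrite WK_pow -!expnD /NN /dexp ltn_exp2l //.
have -> : 10 * size w + 10 = 2 + (8 * size w + 6 + (2 * size w + 2)) by lia.
rewrite (expnD 2 2) (expnD 2 (8 * size w + 6)); have : 0 < 2 ^ (2 * size w + 2) by rewrite expn_gt0.
have : 0 < 2 ^ (8 * size w + 6) by rewrite expn_gt0.
by move: (2 ^ (8 * _ + 6)) (2 ^ (2 * _ + 2)) => x y; nia.
Qed.

Lemma OKl_mono w tl tr h sc sr phi (Z Z' : rel3) tau r s :
  (forall x y z, Z x y z -> Z' x y z) ->
  OKl w tl tr h sc sr phi Z tau r s -> OKl w tl tr h sc sr phi Z' tau r s.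
Proof.
move=> HZ [H1 [H2 [H3 H4]]]; split=> //; split=> //; split=> // j lj p lp a la Hk Hi.
have [t lt [r' lr [s' ls [Hz H]]]] := H4 _ lj _ lp _ la Hk Hi.
by exists t => //; exists r' => //; exists s' => //; split=> //; exact: HZ.
Qed.

Lemma ZZ_OKl w tl tr h sc sr phi tau r s :
  ZZ w tl tr h sc sr phi tau r s ->
  OKl w tl tr h sc sr phi (ZZ w tl tr h sc sr phi) tau r s.
Proof.
rewrite /ZZ => nZ; apply: contrapT => nO; apply: nZ.
apply: (iter3_fix (card_NN w)) => //.
  by move=> R R' HR x y z nH H; apply: nH; apply: OKl_mono H => a b c nR /HR.
by move=> R x y z out [H _]; apply: out; case: H => ? [].
Qed.

(** Coinduction: no round of the dual iteration ever reaches a triple of [Z]. *)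
Lemma post_ZZ w tl tr h sc sr phi (Z : rel3) :
  (forall x y z, Z x y z -> OKl w tl tr h sc sr phi Z x y z) ->
  forall x y z, Z x y z -> ZZ w tl tr h sc sr phi x y z.
Proof.
move=> HZ; rewrite /ZZ /iter3; elim: (NN w) => [|k IH] x y z Hz //=.
by apply; apply: OKl_mono (HZ _ _ _ Hz) => a b c; exact: IH.
Qed.

(** * The bounded simulation game *)

Section Game.

Variables (w : seq bool) (tr ar sc sr h : nat).

(* [t] is simulated at [e] for [k] rounds; a witness for a role outside Σ may be sought
   anywhere in [I]. *)
Fixpoint Sim (I : interpretation) (k t : nat) (e : dom I) : Prop :=
  if k is k'.+1 then
    (forall p A, nm w p A -> insig w sc p -> nb w t p -> cint A e) /\
    (forall j p a, kEx w j p a -> inb t j ->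
       exists t' e', [/\ compat w tr h t p a t',
         insig w sr p -> forall P, nm w p P -> rint P e e' & Sim k' t' e'])
  else True.

Lemma Sim_le I k k' t (e : dom I) : k' <= k -> Sim k t e -> Sim k' t e.
Proof.
elim: k k' t e => [|k IH] [|k'] t e //= le_k [H1 H2]; split=> // j p a Hk Hj.
by have [t' [e' [Hc He Hs]]] := H2 j p a Hk Hj; exists t', e'; split=> //; exact: IH Hs.
Qed.

Definition refutedI (I : interpretation) (k f t : nat) : Prop :=
  (exists a x, [/\ indR w ar a, nm w a x & ~ Sim k (tA w f a) (ind_of I x)]) \/
  (forall e : dom I, ~ Sim k t e) \/
  (exists p a b P x y, [/\ ra w ar p a b, insig w sr p, nm w p P, nm w a x & nm w b y] /\
     ~ rint P (ind_of I x) (ind_of I y)).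

Definition adv (I : interpretation) (k : nat) : Prop :=
  forall f t, f < NN w -> asg w tr ar h f t -> refutedI I k f t.

End Game.

Lemma ca_nm w s p a : ca w s p a -> exists P x, nm w p P /\ nm w a x.
Proof.
move=> [i _ [k _ [_ [_ [_ [[P HP] /nm_NPd[x Hx]]]]]]]; exists P, x; split=> //; by exists a.
Qed.

Lemma ra_nm w s p a b : ra w s p a b -> exists P x y, [/\ nm w p P, nm w a x & nm w b y].
Proof.
move=> [i _ [k _ [_ [_ [_ [[P HP] [[x Hx] /nm_NPd[y Hy]]]]]]]]; exists P, x, y.
by split=> //; [exists a|exists b].
Qed.

Lemma indR_nm w ar a : indR w ar a -> exists x, nm w a x.
Proof.
move=> [p _ [/ca_nm[_ [x [_ Hx]]]|[b _ [/ra_nm[_ [x [_ [_ Hx _]]]]|/ra_nm[_ [_ [x [_ _ Hx]]]]]]]];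
  by exists x.
Qed.

Lemma name_at w : exists f : nat -> iname, forall p x, nm w p x -> f p = x.
Proof.
have nm_ex p : exists x, forall y, nm w p y -> x = y.
  case: (pselect (exists x, nm w p x)) => [[x Hx]|nx].
    by exists x => y Hy; exact: nm_inj Hx Hy.
  by exists [::] => y Hy; case: nx; exists y.
by have [f Hf] := choice nm_ex; exists f.
Qed.

Lemma KT_gt0 w : 0 < KT w. Proof. by rewrite expn_gt0. Qed.
Lemma WW_gt0 w : 0 < WW w. Proof. by rewrite expn_gt0. Qed.
Lemma tA_lt w f a : tA w f a < KT w. Proof. exact: dig_lt (KT_gt0 w). Qed.

Lemma KT_NN w t : t < KT w -> t < NN w.
Proof. by case: (bounds_NN w) => + _ _ _; lia. Qed.

(** Realizable labels are unfolded into a forest model of K1. Whatever answer is given to the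
    restriction that a label singles out, the rank drops, so a type of finite rank v cannot be
    simulated for v + 1 rounds. *)
Lemma Crit_adv w tl al tr ar sc sr h K jt ja :
  seg w tl jt (enc_list enc_inclusion (tbox K)) ->
  seg w al ja (enc_list enc_assertion (abox K)) ->
  Crit w tl al tr ar sc sr h ->
  exists I k, model I K /\ adv w tr ar sc sr h I k.
Proof.
move=> Ht Ha [phi _ [[t0 _ [r0 _ [s0 _ Z0]]] [At _ [Ar _ [As _ [[Heq [Hca Hra]] [HZ Hf]]]]]]].
pose Z (x : nat * nat * nat) := ZZ w tl tr h sc sr phi x.1.1 x.1.2 x.2.
pose good (x : nat * nat * nat) j (y : nat * nat * nat) := Z y /\
  forall p a, kEx w j p a -> inb x.1.1 j -> [/\ inb y.1.1 a, propg w x.1.1 p y.1.1 &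
    Ob w tr h sr x.1.2 x.2 p y.1.2].
have good_ex (xj : (nat * nat * nat) * nat) : exists y, Z xj.1 -> good xj.1 xj.2 y.
  case: xj => x j /=; case: (pselect (Z x /\ exists p a, kEx w j p a /\ inb x.1.1 j)).
    move=> [Zx [p [a [Hk Hi]]]]; have [lj lp la] := kEx_lt Hk.
    have [_ [_ [_ Hch]]] := ZZ_OKl Zx.
    have [t' _ [r' _ [s' _ [Hz [Hi' [Hp Ho]]]]]] :=
      Hch _ (lt_NN lj) _ (lt_NN lp) _ (lt_NN la) Hk Hi.
    exists (t', r', s') => _; split=> // p' a' Hk' _.
    by have [<- <-] := kEx_inj Hk Hk'.
  move=> nex; exists x => Zx; split=> // p a Hk Hi.
  by case: nex; split=> //; exists p, a.
have [ch Hch] := choice good_ex.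
(* Names not written in [w] get the spare label. *)
have root_ex (x : iname) : exists y, Z y /\
    forall p, nm w p x -> y = (tA w At p, rA w Ar p, sA w As p).
  case: (pselect (exists p, nm w p x)) => [[p Hp]|np]; last first.
    by exists (t0, r0, s0); split=> // p Hp; case: np; exists p.
  exists (tA w At p, rA w Ar p, sA w As p); split.
    by apply: HZ; [exact: lt_NN (nm_lt Hp)|apply/nm_NPd; exists x].
  move=> q Hq; have [|-> [-> ->]] // := Heq _ (lt_NN (nm_lt Hp)) _ (lt_NN (nm_lt Hq)).
  by exists x.
have [root Hroot] := choice root_ex.
pose lab3 (d : iname * seq nat) := foldr (fun j x => ch (x, j)) (root d.1) d.2.
have Zlab d : Z (lab3 d).
  case: d => x u; rewrite /lab3 /=; elim: u => [|j u IH] /=; first by case: (Hroot x).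
  by case: (Hch (foldr (fun j x => ch (x, j)) (root x) u, j) IH).
have glab d j : good (lab3 d) j (lab3 (child d j)) by exact: (Hch (lab3 d, j) (Zlab d)).
pose lab d := (lab3 d).1.1.
have rootE x p : nm w p x -> lab3 (x, [::]) = (tA w At p, rA w Ar p, sA w As p).
  by move=> Hp; rewrite /lab3 /=; case: (Hroot x) => _; exact.
have lab_vld d : vldT w tl (lab d) by case: (ZZ_OKl (Zlab d)) => _ [].
have lab_child d j p a : kEx w j p a -> inb (lab d) j ->
    inb (lab (child d j)) a /\ propg w (lab d) p (lab (child d j)).
  by move=> Hk Hi; have [_ H] := glab d j; case: (H p a Hk Hi).
have lab_role p a b x y : ra w al p a b -> nm w a x -> nm w b y ->
    propg w (lab (x, [::])) p (lab (y, [::])).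
  move=> Hr Hx Hy; rewrite /lab (rootE _ _ Hx) (rootE _ _ Hy) /=.
  have [P [_ [_ [HP _ _ _]]]] := ra_sound Ha Hr.
  by case: (Hra _ (lt_NN (nm_lt HP)) _ (lt_NN (nm_lt Hx)) _ (lt_NN (nm_lt Hy)) Hr).
have lab_conc p a x : ca w al p a -> nm w a x -> nb w (lab (x, [::])) p.
  move=> Hc Hx; rewrite /lab (rootE _ _ Hx) /=.
  have [P [_ [HP _ _]]] := ca_sound Ha Hc.
  exact: Hca _ (lt_NN (nm_lt HP)) _ (lt_NN (nm_lt Hx)) Hc.
pose I := forest w lab K.
have nSim k t (d : dom I) : t < KT w -> vld2 w tr h t -> rk w (lab3 d).1.2 t < top w ->
    rk w (lab3 d).1.2 t <= k -> ~ Sim w tr sc sr h k.+1 t d.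
  elim/ltn_ind: k t d => k IH t d lt_t Hv Hfin Hk [S1 S2].
  have [_ [[[_ [_ [_ [_ v5]]]] _] [H3 _]]] := ZZ_OKl (Zlab d).
  have [_ HJ] := H3 _ (KT_NN lt_t) lt_t Hv.
  case: (HJ Hfin) => [[p lp [Hs [Hn nHn]]]|[j lj [p lp [a la [Hst [Hkx [Hi HJ']]]]]]].
    have [q _ [_ [A [Hp _]]]] := Hs.
    have [p' Hp' Hn'] := S1 p A Hp Hs Hn; apply: nHn.
    by apply: (proj1 (v5 _ (lt_NN (nm_lt Hp')) _ lp _)) => //; exists A.
  have [t' [e [Hc He Hsim]]] := S2 j p a Hkx Hi.
  have [lt_t' [Hv' [_ _]]] := Hc.
  suff Hlt : rk w (lab3 e).1.2 t' < rk w (lab3 d).1.2 t.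
    have k_gt : k.-1 < k by lia.
    apply: (IH k.-1 k_gt t' e lt_t' Hv'); [lia|lia|].
    by rewrite prednK //; lia.
  (* Outside Σ the answer may lie anywhere; there the comparison of its rank with [phi] replaces the
     obligation along an edge. *)
  case: (pselect (insig w sr p)) => [Hsp|nsp]; last first.
    have [_ [_ [H3e _]]] := ZZ_OKl (Zlab e); have [Hle _] := H3e _ (KT_NN lt_t') lt_t' Hv'.
    exact: leq_ltn_trans Hle (HJ' nsp _ (KT_NN lt_t') Hc).
  have [P [C [HP _ _]]] := kEx_cpt Hkx.
  (* The edge may stem from another occurrence [p'] of the same role name. *)
  have obl p' r' : nm w p' P -> Ob w tr h sr (lab3 d).1.2 (lab3 d).2 p' r' ->
      rk w r' t' < rk w (lab3 d).1.2 t.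
    move=> HP' HO; have E : nmeq w p p' by exists P.
    apply: (HO _ (KT_NN lt_t) lt_t Hv Hfin _ lj _ lp _ la Hst Hkx (nmeq_sym E)
      (insig_nmeq E Hsp) _ (KT_NN lt_t')).
    exact: compat_nmeq E Hc.
  case: (He Hsp P HP) => [[j' [p' [a' [-> Hk' HP' Hi']]]]|].
    by have [_ /(_ p' a' Hk' Hi')[_ _ HO]] := glab d j'; exact: obl HP' HO.
  case: d e {IH Hfin Hk S1 S2 v5 H3 HJ HJ' Hst He Hsim} obl => [x u] [y v] /= obl [Eu Ev].
  rewrite Eu Ev in obl *.
  move=> /(ra_complete Ha)[p' [a' [b' [Hr HP' Hx Hy]]]].
  have [_ HO] := Hra _ (lt_NN (nm_lt HP')) _ (lt_NN (nm_lt Hx)) _ (lt_NN (nm_lt Hy)) Hr.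
  by rewrite (rootE _ _ Hx) in obl *; rewrite (rootE _ _ Hy); exact: obl HP' HO.
(* Finite ranks are at most [top w - 1], so [top w] rounds refute them all. *)
exists I, (top w); split; first exact: forest_model Ht Ha lab_vld lab_child lab_role lab_conc.
have nSim' t (d : dom I) : t < KT w -> vld2 w tr h t -> rk w (lab3 d).1.2 t < top w ->
    ~ Sim w tr sc sr h (top w) t d.
  move=> lt_t Hv Hr; rewrite -(prednK (leq_ltn_trans (leq0n _) Hr)).
  by apply: nSim => //; lia.
move=> f t lt_f Has; have [_ [Hv [_ [_ [lt_t Hvt]]]]] := Has.
case: (Hf f lt_f t (KT_NN lt_t) Has) => [[a la [Hi Hr]]|[Hr|[p lp [a la [b lb [Hr [Hs nE]]]]]]].
- have [x Hx] := indR_nm Hi; left; exists a, x; split=> //.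
  by apply: nSim' (tA_lt _ _ _) (Hv _ la Hi) _; rewrite (rootE _ _ Hx).
- right; left => e; apply: nSim' => //; have [_ [_ [H3 _]]] := ZZ_OKl (Zlab e).
  by have [Hle _] := H3 _ (KT_NN lt_t) lt_t Hvt; exact: leq_ltn_trans Hle Hr.
right; right.
have [P [x [y [HP Hx Hy]]]] := ra_nm Hr.
exists p, a, b, P, x, y; split=> //= -[[j [p' [a' [E _]]]]|] //.
move=> [_ _ /(ra_complete Ha)[p' [a' [b' [Hr' HP' Hx' Hy']]]]]; apply: nE.
exists p'; first exact: lt_NN (nm_lt HP').
exists a'; first exact: lt_NN (nm_lt Hx').
exists b'; first exact: lt_NN (nm_lt Hy').
by split=> //; split; [exists P|split; [exists x|exists y]].
Qed.

(** * Compressing ranks *)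

Lemma code_ext K a f g : (forall t, t < a -> f t = g t) -> code K a f = code K a g.
Proof.
elim: a f g => //= a IH f g H; rewrite (H 0) //; congr (_ + _ * _).
by apply: IH => t lt_t; exact: H.
Qed.

(** The value [k.+1] stands for infinity. *)
Definition least (k : nat) (P : nat -> Prop) : nat := find (fun m => `[< P m >]) (iota 0 k.+1).

Lemma least_le k P : least k P <= k.+1.
Proof. by rewrite -[X in _ <= X](size_iota 0 k.+1) find_size. Qed.

Lemma leastP k P : least k P <= k -> P (least k P).
Proof.
move=> le; have Hh : has (fun m => `[< P m >]) (iota 0 k.+1) by rewrite has_find size_iota.
by have := nth_find 0 Hh; rewrite nth_iota // => /asboolP.
Qed.

Lemma least_min k P m : m <= k -> P m -> least k P <= m.
Proof.
move=> le_m Pm; rewrite leqNgt; apply/negP => lt_m.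
by have := before_find 0 lt_m; rewrite nth_iota // add0n; case: asboolP.
Qed.

(** There are [T] types and [T.+1] phases; the product [nsit] lists the components of a situation,
    and the second factor is the length of a phase. *)
Lemma rank_space (n : nat) (T := 2 ^ (n + n)) (nsit := T * T.+1 ^ T * n.+1 ^ T * 2 ^ T * 2 ^ T) :
  T.+1 * (2 * nsit + 3 + n * T) < 2 ^ (2 ^ ((n.+1 + n.+1) + ((n.+1 + n.+1) + (n.+1 + n.+1)))).
Proof.
have T_gt : 0 < T by rewrite expn_gt0.
have T1 : T.+1 <= 2 ^ (n + n).+1 by rewrite expnS; rewrite -/T; lia.
have n1 : n.+1 <= 2 ^ n by exact: ltn_expl.
have nT : n * T <= nsit.
  rewrite /nsit; have H1 : n.+1 <= n.+1 ^ T by rewrite -{1}(expn1 n.+1) leq_pexp2l.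
  have H2 : 0 < T.+1 ^ T by rewrite expn_gt0.
  have H3 : 0 < 2 ^ T by rewrite expn_gt0.
  move: (T.+1 ^ T) (n.+1 ^ T) (2 ^ T) H1 H2 H3 => x y z H1 H2 H3.
  apply: (@leq_trans (T * y)); first by rewrite mulnC leq_mul //; lia.
  by rewrite -!mulnA leq_mul // mulnCA leq_pmulr // muln_gt0 H2 muln_gt0 H3.
have BT : nsit <= 2 ^ ((n + n) + (n + n).+1 * T + n * T + T + T).
  have -> : 2 ^ ((n + n) + (n + n).+1 * T + n * T + T + T)
    = T * (2 ^ (n + n).+1) ^ T * (2 ^ n) ^ T * 2 ^ T * 2 ^ T by rewrite -!expnM /T -!expnD.
  rewrite /nsit; do 2 apply: leq_mul => //.
  by apply: leq_mul; [apply: leq_mul => //|]; rewrite leq_exp2r.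
have B_gt : 0 < nsit by rewrite /nsit !muln_gt0 !expn_gt0 ?T_gt.
apply: (@leq_ltn_trans (2 ^ ((n + n).+1 + (3 + ((n + n) + (n + n).+1 * T + n * T + T + T))))).
  rewrite expnD leq_mul // expnD; apply: (@leq_trans (8 * nsit)); first lia.
  by rewrite leq_mul.
rewrite ltn_exp2l //.
have -> : (n.+1 + n.+1) + ((n.+1 + n.+1) + (n.+1 + n.+1)) = (n + n) + (n + (3 * n + 6)) by lia.
rewrite expnD -/T expnD; have H6 : 2 ^ 6 <= 2 ^ (3 * n + 6) by rewrite leq_exp2l //; lia.
apply: (@leq_trans (T * (2 ^ n * 64))); last by rewrite leq_mul2l leq_mul2l H6 !orbT.
by have : n < 2 ^ n := n1; move: (2 ^ n) => x; nia.
Qed.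

Section Compression.

Variables (w : seq bool) (tl al tr ar sc sr h : nat) (KL : kb) (jt ja : nat).
Hypotheses (Ht : seg w tl jt (enc_list enc_inclusion (tbox KL)))
  (Ha : seg w al ja (enc_list enc_assertion (abox KL))).
Variables (I : interpretation) (k : nat).
Hypothesis (HI : model I KL).

Let n := size w.
Let S := Sim w tr sc sr h.

(** Rounds needed to refute [t] at [e], and for [phi0] at all elements; [k.+1] if [k] rounds do not
    suffice. *)
Definition rho (e : dom I) (t : nat) : nat := least k (fun m => ~ S m t e).
Definition phi0 (t : nat) : nat := least k (fun m => forall e : dom I, ~ S m t e).

Lemma rho_le e t : rho e t <= k -> ~ S (rho e t) t e. Proof. exact: leastP. Qed.
Lemma rho_min e t m : m <= k -> ~ S m t e -> rho e t <= m. Proof. exact: least_min. Qed.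
Lemma phi0_min t m : m <= k -> (forall e : dom I, ~ S m t e) -> phi0 t <= m.
Proof. exact: least_min. Qed.

Lemma rho_phi0 e t : rho e t <= phi0 t.
Proof.
case: (leqP (phi0 t) k) => [le_k|lt]; last exact: leq_trans (least_le _ _) lt.
by apply: rho_min => //; exact: (leastP le_k).
Qed.

Definition mismatch (e : dom I) (t : nat) : Prop :=
  exists p A, [/\ nm w p A, insig w sc p, nb w t p & ~ cint A e].

(** A failure after [m.+1] rounds is due to a concept name, marked by [n], where no concept is
    written, or to one restriction that every answer fails within [m] rounds. The answers range over
    successors for a role in Σ and over all elements otherwise. *)
Lemma strategy : {strat : dom I -> nat -> nat | forall e t, strat e t <= n /\
  (rho e t <= k ->
    (strat e t = n /\ mismatch e t) \/
    exists p a, [/\ kEx w (strat e t) p a, inb t (strat e t) & forall t', compat w tr h t p a t' ->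
      (insig w sr p -> forall e', (forall P, nm w p P -> rint P e e') -> rho e' t' < rho e t) /\
      (~ insig w sr p -> phi0 t' < rho e t)])}.
Proof.
suff H (x : dom I * nat) : exists j, j <= n /\ (rho x.1 x.2 <= k -> (j = n /\ mismatch x.1 x.2) \/
    exists p a, [/\ kEx w j p a, inb x.2 j & forall t', compat w tr h x.2 p a t' ->
      (insig w sr p -> forall e', (forall P, nm w p P -> rint P x.1 e') -> rho e' t' < rho x.1 x.2) /\
      (~ insig w sr p -> phi0 t' < rho x.1 x.2)]).
  by have [strat Hst] := choice H; exists (fun e t => strat (e, t)) => e t; exact: (Hst (e, t)).
case: x => e t /=; case: (leqP (rho e t) k) => [le_k|_]; last by exists 0.
have nS := rho_le le_k; have : 0 < rho e t.
  by rewrite lt0n; apply/eqP => E; apply: nS; rewrite E.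
case E : (rho e t) => [//|m] _; rewrite E in nS le_k.
case: (pselect (mismatch e t)) => [least_bound|nmm]; first by exists n; split=> // _; left.
have : ~ forall j p a, kEx w j p a -> inb t j -> exists t' e',
    [/\ compat w tr h t p a t', insig w sr p -> forall P, nm w p P -> rint P e e' & S m t' e'].
  move=> H; apply: nS; split=> // p A Hp Hs Hn; apply: contrapT => nc.
  by apply: nmm; exists p, A.
move=> /existsNP[j /existsNP[p /existsNP[a nH]]].
have [Hk [Hj nH']] : kEx w j p a /\ inb t j /\ ~ exists t' e', [/\ compat w tr h t p a t',
    insig w sr p -> forall P, nm w p P -> rint P e e' & S m t' e'].
  by split; [|split]; [apply: contrapT => nK; apply: nH|apply: contrapT => nK; apply: nH|
    move=> nK; apply: nH].
exists j; have [lj _ _] := kEx_lt Hk; split=> [|_]; first exact: ltnW.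
right; exists p, a; split=> // t' Hc; split=> [Hs e' He'|ns].
  rewrite ltnS; apply: rho_min; first exact: ltnW.
  by move=> HS; apply: nH'; exists t', e'.
rewrite ltnS; apply: phi0_min; first exact: ltnW.
by move=> e' HS; apply: nH'; exists t', e'.
Qed.

Definition strat := projT1 strategy.

Lemma strat_le e t : strat e t <= n. Proof. by case: (projT2 strategy e t). Qed.

Let KT1 := (KT w).-1.
Let NT := KT1.+1.
Lemma NTE : NT = KT w. Proof. by rewrite /NT /KT1 prednK // KT_gt0. Qed.

Lemma inK u : u < KT w -> (inord u : 'I_NT) = u :> nat.
Proof. by rewrite -NTE; exact: inordK. Qed.

(* The true ranks [rho] are unbounded. A rank [v] is replaced by the lexicographic pair of its
   phase [cph v], the number of types that fail everywhere before [v], and of a position inside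
   the phase. Phases can only increase with the rank, and [phi0] lies at phase boundaries, so
   that only obligations along edges of the model constrain the positions. *)
Definition cph (v : nat) : nat := #|[set t : 'I_NT | phi0 t < v]|.

Lemma cph_le v v' : v <= v' -> cph v <= cph v'.
Proof.
by move=> le_v; apply: subset_leq_card; apply/subsetP => t; rewrite !inE => H; exact: leq_trans le_v.
Qed.

Lemma cph_lt v t : t < KT w -> phi0 t < v -> cph (phi0 t) < cph v.
Proof.
move=> lt_t lt_v; apply: proper_card; apply/properP; split.
  by apply/subsetP => u; rewrite !inE => H; exact: ltn_trans lt_v.
by exists (inord t); rewrite !inE inK // -?leqNgt.
Qed.

Lemma cph_max v : cph v <= NT.
Proof. by apply: leq_trans (max_card _) _; rewrite card_ord. Qed.

(** What a label reveals of an element, apart from positions inside phases: its type and, for each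
    type of K2, the phase of the rank, the strategy, and whether the rank is finite. *)
Definition profile : finType :=
  ('I_NT * {ffun 'I_NT -> 'I_NT.+1} * {ffun 'I_NT -> 'I_n.+1} * {set 'I_NT})%type.
Definition profile_of (e : dom I) : profile :=
  (inord (tpn w e), [ffun t : 'I_NT => inord (cph (rho e t))],
   [ffun t : 'I_NT => inord (strat e t)], [set t : 'I_NT | rho e t <= k]).

Lemma profile_ofE e e' : profile_of e = profile_of e' ->
  tpn w e = tpn w e' /\ forall t, t < KT w ->
    [/\ cph (rho e t) = cph (rho e' t), strat e t = strat e' t & (rho e t <= k) = (rho e' t <= k)].
Proof.
move=> [E1 /ffunP E2 /ffunP E3 /setP E4]; split=> [|t lt_t].
  by have := congr1 val E1; rewrite /= !inK ?tpn_lt.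
have := E2 (inord t); have := E3 (inord t); have := E4 (inord t).
rewrite !inE !ffunE !inK // => -> /(congr1 val) E3' /(congr1 val).
by move: E3'; rewrite /= !inordK ?ltnS ?cph_max ?strat_le // => -> ->.
Qed.

Definition situation : finType := (profile * {set 'I_NT})%type.
(* For a situation, that is a profile with a set [O] of types to be refuted, [least_bound] is
   the least rank by which some element of that profile refutes all of [O]. An element attaining
   it has successors with strictly smaller bounds for the resulting obligations, so the rank of
   [least_bound x] among the finitely many situations serves as position. *)
Definition least_bound (x : situation) : nat :=
  least k (fun v => exists e, profile_of e = x.1 /\ forall t : 'I_NT, t \in x.2 -> rho e t <= v).
Definition nsit : nat := #|{: situation}|.
Definition delay (x : situation) : nat := #|[set x' : situation | least_bound x' < least_bound x]|.
(** Places 0 to [nsit] serve the types in the set of a situation, the next [nsit + 1] the remaining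
    types, and [n * KT w + 1] further ones the individuals; the last place also serves [phi0]. *)
Definition phase_len : nat := 2 * nsit + 3 + n * KT w.

Lemma delay_le x : delay x <= nsit. Proof. exact: max_card. Qed.

Lemma delay_lt x x' : least_bound x < least_bound x' -> delay x < delay x'.
Proof.
move=> lt; apply: proper_card; apply/properP; split; last by exists x; rewrite !inE -?leqNgt.
by apply/subsetP => u; rewrite !inE => H; exact: ltn_trans lt.
Qed.

Lemma phase_len_top : (KT w).+1 * phase_len < WW w.
Proof.
rewrite /phase_len /WW; have -> : nsit = KT w * (KT w).+1 ^ KT w * n.+1 ^ KT w * 2 ^ KT w * 2 ^ KT w.
  rewrite /nsit !card_prod !card_ffun !card_ord -!cardsT -powersetT !card_powerset !cardsT !card_ord.
  by rewrite NTE.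
exact: rank_space.
Qed.

Definition position (x : situation) (t : nat) : nat :=
  if (inord t : 'I_NT) \in x.2 then delay x else nsit + 1 + delay x.

Definition rank_code (e : dom I) (g : nat -> nat) : nat :=
  code (WW w) (KT w) (fun t => if rho e t <= k then cph (rho e t) * phase_len + g t else top w).
Definition strat_code (e : dom I) : nat := code (KS w) (KT w) (strat e).
Definition phi_code : nat :=
  code (WW w) (KT w) (fun t => if phi0 t <= k then cph (phi0 t) * phase_len + phase_len.-1 else top w).

Lemma top_lt : top w < WW w. Proof. by rewrite /top prednK // WW_gt0. Qed.

Lemma val_top v g : g < phase_len -> cph v * phase_len + g < top w.
Proof. by have := phase_len_top; have := cph_max v; rewrite NTE /top; nia. Qed.

Lemma rk_rank_code e g t : (forall t, g t < phase_len) -> t < KT w ->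
  rk w (rank_code e g) t = if rho e t <= k then cph (rho e t) * phase_len + g t else top w.
Proof.
move=> Hg lt_t; rewrite /rk /rank_code dig_code // => u _; case: ifP => _; last exact: top_lt.
exact: ltn_trans (val_top _ (Hg u)) top_lt.
Qed.

Lemma rk_phi_code t : t < KT w ->
  rk w phi_code t = if phi0 t <= k then cph (phi0 t) * phase_len + phase_len.-1 else top w.
Proof.
move=> lt_t; rewrite /rk /phi_code dig_code // => u _; case: ifP => _; last exact: top_lt.
by apply: ltn_trans (val_top _ _) top_lt; rewrite /phase_len; lia.
Qed.

Lemma str_strat_code e t : t < KT w -> str w (strat_code e) t = strat e t.
Proof. by move=> lt_t; rewrite /str /strat_code dig_code // => u _; rewrite ltnS strat_le. Qed.

(** In the first case the element attains the bound of its situation. The second is for the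
    individuals written in [w], whose places lie above all places of the first kind. *)
Definition kind (e : dom I) (g : nat -> nat) : Prop :=
  (exists O : {set 'I_NT}, [/\ forall t : 'I_NT, t \in O -> rho e t <= k,
     forall t : 'I_NT, t \in O -> rho e t <= least_bound (profile_of e, O) & g = position (profile_of e, O)]) \/
  (forall t, 2 * nsit + 2 <= g t < phase_len).

Lemma kind_lt e g t : kind e g -> g t < phase_len.
Proof.
case=> [[O [_ _ ->]]|/(_ t)/andP[] //]; rewrite /position /phase_len; have := delay_le (profile_of e, O).
by case: ifP => _; lia.
Qed.

Definition realized : rel3 := fun tau r s =>
  exists e g, [/\ kind e g, tau = tpn w e, r = rank_code e g & s = strat_code e].

(** The codes depend on the profile only, so an element can be exchanged for one of the same profile
    that attains the least bound. *)
Lemma realized_position e (O : {set 'I_NT}) : (forall t : 'I_NT, t \in O -> rho e t <= k) ->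
  realized (tpn w e) (rank_code e (position (profile_of e, O))) (strat_code e).
Proof.
move=> HO; have le_m : least_bound (profile_of e, O) <= k by apply: least_min => //; exists e.
have [e' [E' He']] := leastP le_m; have [Et Eq] := profile_ofE E'.
exists e', (position (profile_of e', O)); split.
- left; exists O; split=> // t tO; rewrite ?E'; last exact: He'.
  exact: leq_trans (He' t tO) le_m.
- by rewrite Et.
- rewrite E'; apply: code_ext => t lt_t; have [-> _ ->] := Eq t lt_t; by [].
- by apply: code_ext => t lt_t; have [_ -> _] := Eq t lt_t.
Qed.

Lemma position_lt e O t : position (profile_of e, O) t < phase_len.
Proof. by rewrite /position /phase_len; have := delay_le (profile_of e, O); case: ifP => _; lia. Qed.

Definition obl (e : dom I) (p t t' : nat) : Prop :=
  vld2 w tr h t /\ exists p' a, [/\ kEx w (strat e t) p' a, nmeq w p p', insig w sr p &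
    compat w tr h t p a t'].

Lemma obl_rho e e' p P t t' : nm w p P -> rint P e e' -> rho e t <= k -> obl e p t t' ->
  rho e' t' < rho e t.
Proof.
move=> HP Hr le_k [_ [p' [a [Hk E Hs Hc]]]].
case: (projT2 strategy e t) => _ /(_ le_k); rewrite -/(strat e t) => -[[En _]|[q [b [Hk' _ H]]]].
  by have [] := kEx_lt Hk; rewrite En ltnn.
have [Ep Ea] := kEx_inj Hk Hk'; subst q b.
have [] // := H t' (compat_nmeq E Hc).
move=> /(_ (insig_nmeq E Hs)) H' _; apply: H' => Q HQ.
have [A [Hp Hp']] := E; by rewrite (nm_inj HQ Hp') -(nm_inj HP Hp).
Qed.

(** A successor [e'] in the model supplies the required label, up to an exchange for an element of
    the same profile. True ranks drop along obligations, so phases do not increase, and it remains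
    to make positions drop. *)
Lemma realized_OKl x y z : realized x y z -> OKl w tl tr h sc sr phi_code realized x y z.
Proof.
move=> [e [g [Hg -> -> ->]]]; have g_lt t := kind_lt t Hg.
have Hrk t lt_t := @rk_rank_code e g t g_lt lt_t.
split.
  split; first exact: tpn_lt.
  split; apply: code_lt => t _; last by rewrite ltnS strat_le.
  by case: ifP => _; [exact: ltn_trans (val_top _ (g_lt t)) top_lt|exact: top_lt].
split; first exact: tpn_vldT Ht (proj1 HI).
split=> [t _ lt_t Hv|j lj p lp a la Hk Hj].
  rewrite Hrk // rk_phi_code //; split.
    have le := rho_phi0 e t; case: (leqP (phi0 t) k) => [lek|ltk].
      by rewrite (leq_trans le lek) leq_add ?leq_mul ?cph_le //; have := g_lt t; lia.
    by case: ifP => // _; exact: ltnW (val_top _ (g_lt t)).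
  case: ifP => [le_k _|_]; last by rewrite ltnn.
  case: (projT2 strategy e t) => _ /(_ le_k); rewrite -/(strat e t).
  move=> [[_ [p [A [HA Hs Hn nc]]]]|[p [a [Hk Hj H]]]].
    left; exists p; first exact: lt_NN (nm_lt HA).
    by split=> //; split=> //; rewrite (tpn_nb _ HA).
  have [lj lp la] := kEx_lt Hk.
  right; exists (strat e t); first exact: lt_NN.
  exists p; first exact: lt_NN.
  exists a; first exact: lt_NN.
  split; first exact: str_strat_code.
  do 2 split=> //; move=> ns t' _ Hc; have [_ /(_ ns) Hlt] := H t' Hc.
  have lt_t' : t' < KT w by case: Hc.
  rewrite rk_phi_code // Hrk // le_k (leq_trans (ltnW Hlt) le_k).
  (* [t'] fails everywhere before rank [rho e t] and is counted by the later phase only, so even the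
     last place of the earlier phase is smaller. *)
  have := cph_lt lt_t' Hlt; have V_gt : 0 < phase_len by rewrite /phase_len; lia.
  by move: (cph _) (cph _) => u v; nia.
have [P [C [HP HC HE]]] := kEx_cpt Hk.
have [e' Hr He'] := proj1 (tpn_inb e HE) Hj.
(* The types that [e'] must refute on account of the set [O] behind [g]; with the places of an
   individual there is no such set. *)
pose O1 : {set 'I_NT} := match pselect (exists O : {set 'I_NT},
    [/\ forall t : 'I_NT, t \in O -> rho e t <= k,
     forall t : 'I_NT, t \in O -> rho e t <= least_bound (profile_of e, O) & g = position (profile_of e, O)]) with
  | Specif.left H => [set t' : 'I_NT | `[< exists2 t : 'I_NT, t \in sval (cid H) & obl e p t t' >]]
  | Specif.right _ => set0 end.
(* Once nothing is pending, the set starts afresh with all types of finite rank. Its bound may then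
   increase, but all of them move to the lower places. *)
pose O2 := if O1 == set0 then [set t : 'I_NT | rho e' t <= k] else O1.
have HO2 (t : 'I_NT) : t \in O2 -> rho e' t <= k.
  rewrite /O2; case: ifP => _; first by rewrite inE.
  rewrite /O1; case: pselect => [H|_]; last by rewrite inE.
  case: (cid H) => O /= [HO _ _]; rewrite inE => /asboolP[u /HO lu Ho].
  exact: leq_trans (ltnW (obl_rho HP Hr lu Ho)) lu.
exists (tpn w e'); first exact: KT_NN (tpn_lt _ _).
exists (rank_code e' (position (profile_of e', O2))).
  apply: ltn_trans (WK_NN w); apply: code_lt => t _.
  by case: ifP => _; [exact: ltn_trans (val_top _ (position_lt _ _ _)) top_lt|exact: top_lt].
exists (strat_code e').
  case: (bounds_NN w) => _ _ + _; apply: leq_trans; rewrite ltnS ltnW //.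
  by apply: code_lt => t _; rewrite ltnS strat_le.
split; first exact: realized_position.
split; first exact/(tpn_inb e' HC).
split; first exact: tpn_propg HP Hr.
move=> t _ lt_t Hv; rewrite Hrk // => + j' _ p' _ b _ Ej' Hk' Enm Hs t' _ Hc.
case: ifP => [le_k _|_]; last by rewrite ltnn.
rewrite str_strat_code // in Ej'; rewrite -Ej' in Hk'.
have Ho : obl e p t t' by split=> //; exists p', b.
have Hlt := obl_rho HP Hr le_k Ho.
have lt_t' : t' < KT w by case: Hc.
rewrite rk_rank_code //; last by move=> u; exact: position_lt.
rewrite (leq_trans (ltnW Hlt) le_k).
have Hcp := cph_le (ltnW Hlt).
suff Hg' : position (profile_of e', O2) t' < g t.
  by rewrite -addnS; apply: leq_add => //; rewrite leq_mul.
rewrite /position /=; have ley := delay_le (profile_of e', O2).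
move: Hg; case; last by move=> /(_ t)/andP[]; case: ifP => _; move: ley; move: (delay _) nsit => y0 b0; lia.
move=> Hex; have EO1 : O1 = [set t' : 'I_NT | `[< exists2 t : 'I_NT, t \in sval (cid Hex) & obl e p t t' >]].
  by rewrite /O1; case: pselect => // H; rewrite (Prop_irrelevance H Hex).
case: (cid Hex) EO1 => O /= [HO Hm Eg] EO1; rewrite Eg /position /=.
(* All of [O1] is refuted at [e'] before the bound for [O], so the bound of the new situation is
   strictly smaller. *)
have key : O1 != set0 -> delay (profile_of e', O2) < delay (profile_of e, O).
  move=> nO; rewrite /O2 (negbTE nO); apply: delay_lt.
  have [u uO1] := set0Pn _ nO; have := uO1; rewrite {1}EO1 inE => /asboolP[v vO Hv'].
  have := obl_rho HP Hr (HO v vO) Hv'; have := Hm v vO.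
  have : least_bound (profile_of e, O) <= k by apply: least_min => //; exists e.
  case Em : (least_bound (profile_of e, O)) => [|m'] le_m le_v lt_v; first lia.
  rewrite ltnS; apply: least_min; first exact: ltnW.
  exists e'; split=> // u'; rewrite EO1 inE => /asboolP[v' v'O Hv''].
  have := obl_rho HP Hr (HO v' v'O) Hv''; have := Hm v' v'O; rewrite Em; lia.
(* A type in [O] passes its obligation on to [O2], where the delay drops. From a type outside [O],
   either [t'] lands on the lower places, or [O1] is nonempty and the delay drops on the upper
   ones. *)
case: ifP => tO2; case: ifP => tO; try by move: ley; move: (delay _) (delay _) nsit => y0 y1 b0; lia.
- apply: key; apply/set0Pn; exists (inord t'); rewrite EO1 inE; apply/asboolP.
  by exists (inord t) => //; rewrite !inK.
- have [] : False; move/negbT: tO2; rewrite /O2.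
  have nO : O1 != set0.
    apply/set0Pn; exists (inord t'); rewrite EO1 inE; apply/asboolP.
    by exists (inord t) => //; rewrite !inK.
  rewrite (negbTE nO) EO1 inE; move/negP; apply; apply/asboolP.
  by exists (inord t) => //; rewrite !inK.
rewrite ltn_add2l; apply: key; apply/negP => O1e; move: tO2; rewrite /O2 O1e inE inK //.
by rewrite (leq_trans (ltnW Hlt) le_k).
Qed.

Lemma adv_Crit : adv w tr ar sc sr h I k -> Crit w tl al tr ar sc sr h.
Proof.
move=> Hadv.
have [nmf Hnm] := name_at w.
pose elt p : dom I := ind_of I (nmf p).
(* The individuals written in [w] are finitely many, so their true ranks can be sorted directly,
   over all pairs of a position and a type. *)
pose gA (p t : nat) := 2 * nsit + 2 + #|[set x : 'I_n * 'I_NT | rho (elt x.1) x.2 < rho (elt p) t]|.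
have gA_kind p : kind (elt p) (gA p).
  right => t; rewrite /gA leq_addr /=; have := max_card [set x : 'I_n * 'I_NT | rho (elt x.1) x.2 < rho (elt p) t].
  by rewrite card_prod !card_ord NTE /phase_len; move: #|_| nsit => x0 b0; lia.
have gA_lt p t := kind_lt t (gA_kind p).
pose At := code (KT w) n.+1 (fun p => tpn w (elt p)).
pose Ar := code (WK w) n.+1 (fun p => rank_code (elt p) (gA p)).
pose As := code (SK w) n.+1 (fun p => strat_code (elt p)).
have rank_code_lt e g : (forall t, g t < phase_len) -> rank_code e g < WK w.
  move=> g_lt; apply: code_lt => t _.
  by case: ifP => _; [exact: ltn_trans (val_top _ (g_lt t)) top_lt|exact: top_lt].
have strat_code_lt e : strat_code e < SK w by apply: code_lt => t _; rewrite ltnS strat_le.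
have AtE p : p < n -> tA w At p = tpn w (elt p).
  by move=> lp; rewrite /tA dig_code //; [move=> t _; exact: tpn_lt|exact: ltnW].
have ArE p : p < n -> rA w Ar p = rank_code (elt p) (gA p).
  by move=> lp; rewrite /rA dig_code //; [move=> t _; exact: rank_code_lt|exact: ltnW].
have AsE p : p < n -> sA w As p = strat_code (elt p).
  by move=> lp; rewrite /sA dig_code //; exact: ltnW.
have eltE p x : nm w p x -> elt p = ind_of I x by move=> Hx; rewrite /elt (Hnm _ _ Hx).
have arr_lt K x : K <= WK w -> x < K ^ n.+1 -> x < NN w.
  by move=> le_K lt; apply: ltn_trans (arr_NN w); apply: leq_trans lt _; rewrite leq_exp2r.
have [_ /List.Forall_forall HIa] := HI.
exists phi_code.
  apply: ltn_trans (WK_NN w); apply: code_lt => t _; case: ifP => _; last exact: top_lt.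
  by apply: ltn_trans (val_top _ _) top_lt; rewrite /phase_len; lia.
have HZ := @post_ZZ w tl tr h sc sr phi_code realized realized_OKl.
split.
  pose e := ind_of I [::]; exists (tpn w e); first exact: KT_NN (tpn_lt _ _).
  exists (rank_code e (position (profile_of e, set0))).
    by apply: ltn_trans (WK_NN w); apply: rank_code_lt => t; exact: position_lt.
  exists (strat_code e); first by case: (bounds_NN w) => _ _ + _; apply: leq_trans; rewrite ltnS ltnW.
  by apply: HZ; apply: realized_position => t; rewrite inE.
exists At.
  by apply: arr_lt (KT_le w) _; apply: code_lt => t _; exact: tpn_lt.
exists Ar; first by apply: arr_lt (leqnn _) _; apply: code_lt => t _; exact: rank_code_lt.
exists As; first by apply: arr_lt (SK_le w) _; apply: code_lt => t _; exact: strat_code_lt.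
split.
  split=> [p _ q _ [A [Hp Hq]]|].
    have lp := nm_lt Hp; have lq := nm_lt Hq.
    have E : nmf p = nmf q by rewrite (Hnm _ _ Hp) (Hnm _ _ Hq).
    by rewrite !AtE // !ArE // !AsE // /rank_code /gA /elt E.
  split=> [p _ a _ Hc|p _ a _ b _ Hr].
    have [P [x [HP Hx Hin]]] := ca_sound Ha Hc.
    by rewrite (AtE _ (nm_lt Hx)) (tpn_nb _ HP) (eltE _ _ Hx); exact: HIa Hin.
  have [P [x [y [HP Hx Hy Hin]]]] := ra_sound Ha Hr.
  have la := nm_lt Hx; have lb := nm_lt Hy.
  have Hrint : rint P (elt a) (elt b) by rewrite (eltE _ _ Hx) (eltE _ _ Hy); exact: HIa Hin.
  rewrite !AtE // !ArE // !AsE //; split; first exact: tpn_propg HP Hrint.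
  move=> t _ lt_t Hv; rewrite rk_rank_code // => + j' _ p' _ c _ Ej' Hk' Enm Hs t' _ Hc.
  case: ifP => [le_k _|_]; last by rewrite ltnn.
  rewrite str_strat_code // in Ej'; rewrite -Ej' in Hk'.
  have Ho : obl (elt a) p t t' by split=> //; exists p', c.
  have Hlt := obl_rho HP Hrint le_k Ho.
  have lt_t' : t' < KT w by case: Hc.
  rewrite rk_rank_code // (leq_trans (ltnW Hlt) le_k) -addnS leq_add ?leq_mul ?(cph_le (ltnW Hlt)) //.
  rewrite /gA ltn_add2l; apply: proper_card; apply/properP; split.
    by apply/subsetP => u; rewrite !inE => H; exact: ltn_trans Hlt.
  by exists (Ordinal lb, inord t'); rewrite !inE /= inK // -?leqNgt.
split=> [p _ /nm_NPd[x Hx]|f lt_f t lt_t Has].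
  have lp := nm_lt Hx; rewrite AtE // ArE // AsE //; apply: HZ.
  by exists (elt p), (gA p); split.
have [_ [_ [_ [_ [lt_t' _]]]]] := Has.
case: (Hadv f t lt_f Has) => [[a [x [Hi Hx nS]]]|[nS|[p [a [b [P [x [y [[Hr Hs HP Hx Hy] nR]]]]]]]]].
- left; exists a; [exact: lt_NN (nm_lt Hx)|split=> //].
  by rewrite ArE ?(nm_lt Hx) // rk_rank_code ?tA_lt // (eltE _ _ Hx) (rho_min (leqnn k) nS) val_top ?gA_lt.
- right; left; rewrite rk_phi_code //; suff -> : phi0 t <= k by apply: val_top; rewrite /phase_len; lia.
  exact: phi0_min.
right; right; exists p; first exact: lt_NN (nm_lt HP).
exists a; first exact: lt_NN (nm_lt Hx).
exists b; first exact: lt_NN (nm_lt Hy).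
do 2 split=> //; move=> [p' _ [a' _ [b' _ [Hr' [[Q [HQ HQ']] [[u [Hu Hu']] [v [Hv Hv']]]]]]]].
apply: nR; have [P' [x' [y' [HP' Hx' Hy' Hin]]]] := ra_sound Ha Hr'.
rewrite (nm_inj HP HQ) (nm_inj Hx Hu) (nm_inj Hy Hv) (nm_inj HQ' HP') (nm_inj Hu' Hx').
by rewrite (nm_inj Hv' Hy'); exact: HIa Hin.
Qed.

End Compression.

(** * Queries and the bounded game *)

Lemma Forall_all T (P : T -> Prop) s : List.Forall P s <-> all (fun x => `[< P x >]) s.
Proof.
elim: s => [|x s IH]; first by split.
split=> [H|/= /andP[/asboolP Hx /IH Hs]]; last by constructor.
by inversion_clear H; rewrite /=; apply/andP; split; [apply/asboolP|apply/IH].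
Qed.

Lemma Exists_has T (P : T -> Prop) s : List.Exists P s <-> has (fun x => `[< P x >]) s.
Proof.
elim: s => [|x s IH]; first by split=> // H; inversion H.
split=> [H|/= /orP[/asboolP Hx|/IH Hs]]; [|by constructor|by constructor 2].
by inversion_clear H; rewrite /=; apply/orP; [left; apply/asboolP|right; apply/IH].
Qed.

Lemma insigP w s j l p A : seg w s j (enc_list enc_name l) -> nm w p A ->
  (insig w s p <-> A \in l).
Proof.
move=> Hs Hp; split=> [[q _ [/(nin_sound Hs)[B HB Bl] [X [HX HX']]]]|/(nin_complete Hs)[q Hq HA]].
  by rewrite (nm_inj Hp HX) (nm_inj HX' HB).
by exists q; [exact: lt_NN (nm_lt HA)|split=> //; exists A].
Qed.

Lemma mem_ind K x : x \in ind K <->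
  exists al, List.In al (abox K) /\ x \in ind_assertion al.
Proof.
rewrite /ind; elim: (abox K) => [|al s IH] /=; first by split=> // -[? []].
rewrite mem_cat; split=> [/orP[H|/IH[b [Hb Hx]]]|[b [[<-|Hb] Hx]]].
- by exists al; split=> //; left.
- by exists b; split=> //; right.
- by rewrite Hx.
by apply/orP; right; apply/IH; exists b.
Qed.

Lemma indP w s j K x : seg w s j (enc_list enc_assertion (abox K)) ->
  (x \in ind K <-> exists2 a, indR w s a & nm w a x).
Proof.
move=> Hs; rewrite mem_ind; split=> [[[P y|P y z] [Hin]]|[a [p lp [Hc|[b lb [Hr|Hr]]]] Hx]] /=.
- have [p [a [Hc Hp Ha]]] := ca_complete Hs Hin; rewrite inE => /eqP->; exists a => //.
  by exists p; [exact: lt_NN (nm_lt Hp)|left].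
- have [p [a [b [Hr Hp Ha Hb]]]] := ra_complete Hs Hin; rewrite !inE => /orP[]/eqP->.
    exists a => //; exists p; first exact: lt_NN (nm_lt Hp).
    by right; exists b; [exact: lt_NN (nm_lt Hb)|left].
  exists b => //; exists p; first exact: lt_NN (nm_lt Hp).
  by right; exists a; [exact: lt_NN (nm_lt Ha)|right].
- have [P [y [_ Hy Hin]]] := ca_sound Hs Hc.
  by exists (AConcept P y); split=> //=; rewrite (nm_inj Hx Hy) inE.
- have [P [y [z [_ Hy _ Hin]]]] := ra_sound Hs Hr.
  by exists (ARole P y z); split=> //=; rewrite (nm_inj Hx Hy) inE eqxx.
have [P [y [z [_ _ Hz Hin]]]] := ra_sound Hs Hr.
by exists (ARole P y z); split=> //=; rewrite (nm_inj Hx Hz) !inE eqxx orbT.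
Qed.

Fixpoint words (n m : nat) : seq (seq nat) :=
  if m is m'.+1 then [::] :: [seq j :: u | j <- iota 0 n, u <- words n m'] else [:: [::]].

Lemma mem_words n m u : (u \in words n m) = (size u <= m) && all (fun j => j < n) u.
Proof.
elim: m u => [|m IH] [|j u] //=; rewrite inE /= ltnS.
apply/allpairsP/idP => [[[i v] /= [Hi Hv [-> ->]]]|/and3P[Hs Hj Hu]].
  by move: Hi Hv; rewrite mem_iota IH add0n /= => -> /andP[-> ->].
by exists (j, u); rewrite /= mem_iota IH Hs.
Qed.

Section Queries.

Variables (w : seq bool) (tr ar sc sr : nat) (K : kb) (S : signature) (jt ja jc jr : nat).
Hypotheses (Ht : seg w tr jt (enc_list enc_inclusion (tbox K)))
  (Ha : seg w ar ja (enc_list enc_assertion (abox K)))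
  (Hc : seg w sc jc (enc_list enc_name (sig_c S)))
  (Hr : seg w sr jr (enc_list enc_name (sig_r S))).

Let n := size w.
Let a := in_tuple (ind K).
Definition node : Type := (option iname * seq nat)%type.

(** The roots that are individuals of K2 become answer variables, which fixes their images; all
    other nodes are quantified and named by their code. *)
Definition nvar (d : node) : qvar (size (ind K)) :=
  if d is (Some x, [::]) then
    if insub (index x (ind K)) is Some i then Ans i else Ex _ (pickle d)
  else Ex _ (pickle d).

Lemma nvar_ind I (f : nat -> dom I) x : x \in ind K ->
  qvar_val a f (nvar (Some x, [::])) = ind_of I x.
Proof.
move=> Hx; rewrite /nvar; case: insubP => [i _ Ei|]; last by rewrite index_mem Hx.
by rewrite /= (tnth_nth [::]) Ei nth_index.
Qed.

Definition nodes (k : nat) : seq node :=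
  [seq (r, u) | r <- None :: map Some (ind K), u <- words n k].

Definition atoms (k : nat) : cq (size (ind K)) :=
  [seq QConcept A (nvar d) | A <- sig_c S, d <- nodes k] ++
  [seq QRole P (nvar z.1) (nvar z.2) | P <- sig_r S, z <- [seq (x, y) | x <- nodes k, y <- nodes k]].

Lemma all_atoms k (p : pred (qatom (size (ind K)))) : all p (atoms k) <->
  (forall A d, A \in sig_c S -> d \in nodes k -> p (QConcept A (nvar d))) /\
  (forall P d d', P \in sig_r S -> d \in nodes k -> d' \in nodes k -> p (QRole P (nvar d) (nvar d'))).
Proof.
rewrite all_cat; split=> [/andP[/all_allpairsP H1 /all_allpairsP H2]|[H1 H2]].
  split=> [A d HA Hd|P d d' HP Hd Hd']; first exact: H1.
  by apply: (H2 P (d, d')) => //; apply/allpairsP; exists (d, d').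
apply/andP; split; first by apply/all_allpairsP => A d; exact: H1.
apply/all_allpairsP => P z HP; case/allpairsP=> -[d d'] [/= Hd Hd' ->]; exact: H2.
Qed.

(* The query describes the unravelling of [I2] up to depth [k] from its individuals and from
   one anonymous root; a match in [I] would be a strategy in the bounded game. *)
Lemma adv_cq I I2 k : adv w tr ar sc sr 0 I k -> model I2 K ->
  exists f2, ~ sat_cq I a [seq at_ <- atoms k | `[< sat_atom (I := I2) a f2 at_ >]].
Proof.
move=> Hadv HI2; have [_ /List.Forall_forall HIa] := HI2.
have Hv (d : dom I2) : vld2 w tr 0 (tpn w d) by split=> [//|]; exact: (tpn_vldT d Ht (proj1 HI2)).
have step_ex (x : dom I2 * nat) : exists e, forall p c, kEx w x.2 p c ->
    inb (tpn w x.1) x.2 -> (forall P, nm w p P -> rint P x.1 e) /\ inb (tpn w e) c.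
  case: (pselect (exists p c, kEx w x.2 p c /\ inb (tpn w x.1) x.2)); last first.
    by move=> nex; exists x.1 => p c Hk Hi; case: nex; exists p, c.
  move=> [p [c [Hk Hi]]]; have [P [C [HP HC HE]]] := kEx_cpt Hk.
  have [e He He'] := proj1 (tpn_inb x.1 HE) Hi; exists e => p' c' Hk' _.
  have [<- <-] := kEx_inj Hk Hk'; split=> [Q HQ|]; first by rewrite (nm_inj HQ HP).
  exact/(tpn_inb e HC).
have [stp Hst] := choice step_ex.
pose val2 (d : node) := foldr (fun j e => stp (e, j))
  (if d.1 is Some x then ind_of I2 x else ind_of I2 [::]) d.2.
pose f2 m := if unpickle m is Some d then val2 d else ind_of I2 [::].
exists f2 => -[f1 /Forall_all]; rewrite all_filter => /all_atoms[HC HR].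
have v2 d : qvar_val a f2 (nvar d) = val2 d.
  case: d => [[x|] [|j u]] /=; try by rewrite /f2 pickleK.
  case: insubP => [i lt_i Ei|_] /=; last by rewrite /f2 pickleK.
  by rewrite (tnth_nth [::]) Ei nth_index // -index_mem.
pose val1 d := qvar_val a f1 (nvar d).
have {}HC A d : A \in sig_c S -> d \in nodes k -> cint A (val2 d) -> cint A (val1 d).
  by move=> HA Hd Hvd; have /implyP := HC A d HA Hd; rewrite !asboolE /= v2; exact.
have {}HR P d d' : P \in sig_r S -> d \in nodes k -> d' \in nodes k ->
    rint P (val2 d) (val2 d') -> rint P (val1 d) (val1 d').
  by move=> HP Hd Hd' Hvd; have /implyP := HR P d d' HP Hd Hd'; rewrite !asboolE /= !v2; exact.
have in_nodes r u : (r \in None :: map Some (ind K)) -> size u <= k -> all (fun j => j < n) u ->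
    (r, u) \in nodes k.
  by move=> Hr' Hs Hu; apply/allpairsP; exists (r, u); rewrite mem_words Hs.
(* The match answers a restriction by the image of the child; for a role outside Σ no edge to that
   image is asked for, which is the restart. *)
have HSim m r u : r \in None :: map Some (ind K) -> all (fun j => j < n) u -> size u + m = k ->
    Sim w tr sc sr 0 m (tpn w (val2 (r, u))) (val1 (r, u)).
  elim: m u => [//|m IH] u Hr' Hu Hk; have Hd : (r, u) \in nodes k by apply: in_nodes => //; lia.
  split=> [p A Hp /(insigP Hc Hp) HA|j p c Hkx Hi].
    by rewrite (tpn_nb _ Hp); exact: HC.
  have [lj _ _] := kEx_lt Hkx; have Hju : all (fun j => j < n) (j :: u) by rewrite /= lj.
  have [P [C [HP _ _]]] := kEx_cpt Hkx; have [Hs1 Hs2] := Hst (val2 (r, u), j) p c Hkx Hi.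
  exists (tpn w (val2 (r, j :: u))), (val1 (r, j :: u)); split.
  - split; first exact: tpn_lt.
    split; first exact: Hv.
    by split=> //; exact: tpn_propg HP (Hs1 P HP).
  - move=> Hs Q HQ; apply: HR => //; first exact/(insigP Hr HQ).
      by apply: in_nodes => //=; lia.
    exact: Hs1.
  by apply: IH => //=; lia.
have [nmf Hnm] := name_at w.
pose f := code (KT w) n.+1 (fun p => tpn w (ind_of I2 (nmf p))).
have fE p x : nm w p x -> tA w f p = tpn w (ind_of I2 x).
  move=> Hp; rewrite /tA dig_code ?(Hnm _ _ Hp) //; first by move=> t _; exact: tpn_lt.
  exact: ltnW (nm_lt Hp).
have lt_f : f < NN w.
  apply: ltn_trans (arr_NN w); apply: (@leq_trans (KT w ^ n.+1)); last by rewrite leq_exp2r ?KT_le.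
  by apply: code_lt => t _; exact: tpn_lt.
have Has : asg w tr ar 0 f (tpn w (val2 (None, [::]))).
  split; first by move=> p _ q _ [x [Hp Hq]]; rewrite (fE _ _ Hp) (fE _ _ Hq).
  split; first by move=> p _ /indR_nm[x Hx]; rewrite (fE _ _ Hx).
  split.
    move=> p _ b _ /(ca_sound Ha)[P [x [HP Hx Hin]]]; rewrite (fE _ _ Hx) (tpn_nb _ HP).
    exact: HIa Hin.
  split; last by split; [exact: tpn_lt|].
  move=> p _ b _ c _ /(ra_sound Ha)[P [x [y [HP Hx Hy Hin]]]].
  by rewrite (fE _ _ Hx) (fE _ _ Hy); apply: tpn_propg HP _; exact: HIa Hin.
have some_in x : x \in ind K -> Some x \in None :: map Some (ind K).
  by move=> Hx; rewrite inE map_f ?orbT.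
case: (Hadv f _ lt_f Has) => [[b [x [Hi Hx nS]]]|[nS|[p [b [c [P [x [y [[Hrx Hs HP Hx Hy] nR]]]]]]]]].
- have Hxi : x \in ind K by apply/(indP _ Ha); exists b.
  by apply: nS; rewrite (fE _ _ Hx) -(nvar_ind f1 Hxi); apply: (HSim k (Some x) [::]); rewrite ?some_in.
- exact: (nS (val1 (None, [::]))) (HSim k None [::] isT isT erefl).
have [P' [x' [y' [HP' Hx' Hy' Hin]]]] := ra_sound Ha Hrx.
rewrite -(nm_inj HP HP') -(nm_inj Hx Hx') -(nm_inj Hy Hy') in Hin.
have Hxi : x \in ind K by apply/mem_ind; exists (ARole P x y); rewrite !inE eqxx.
have Hyi : y \in ind K by apply/mem_ind; exists (ARole P x y); rewrite !inE eqxx orbT.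
apply: nR; rewrite -(nvar_ind f1 Hxi) -(nvar_ind f1 Hyi); apply: HR.
- exact/(insigP Hr HP).
- exact: in_nodes (some_in _ Hxi) _ _.
- exact: in_nodes (some_in _ Hyi) _ _.
exact: HIa Hin.
Qed.

(** The disjuncts are the sets of atoms, as bit masks, that fail in [I]; in any model of K2 the set
    of atoms true under the unravelling is one of them. Consistency makes the disjunction nonempty,
    and the empty conjunction is no disjunct because it holds in [I]. *)
Lemma adv_query I k : consistent K -> adv w tr ar sc sr 0 I k ->
  exists q : ucq (size (ind K)),
    [/\ ucq_wf q, ucq_over S q, entails K q a & ~ sat_ucq I a q].
Proof.
move=> [I0 HI0] Hadv; pose sub (m : (size (atoms k)).-tuple bool) := mask m (atoms k).
pose q : ucq (size (ind K)) := map sub [seq m <- enum {: (size (atoms k)).-tuple bool} | `[< ~ sat_cq I a (sub m) >]].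
have Hent : entails K q a.
  move=> I2 /(adv_cq Hadv)[f2 Hf2]; apply/Exists_has; rewrite has_map; apply/hasP.
  pose b := [tuple of map (fun at_ => `[< sat_atom (I := I2) a f2 at_ >]) (in_tuple (atoms k))].
  have Eb : sub b = [seq at_ <- atoms k | `[< sat_atom (I := I2) a f2 at_ >]].
    by rewrite filter_mask.
  exists b; first by rewrite mem_filter mem_enum andbT; apply/asboolP; rewrite Eb.
  apply/asboolP; rewrite Eb; exists f2; apply/Forall_all; rewrite all_filter.
  by rewrite (eq_all (a2 := predT)) ?all_predT // => x /=; exact: implybb.
exists q; split=> //.
- apply/andP; split.
    by move/Exists_has: (Hent I0 HI0); case: (q).
  rewrite all_map all_filter; apply/allP => m _; apply/implyP => /asboolP nS /=.
  rewrite lt0n; apply/negP => /eqP/size0nil E; apply: nS; rewrite E.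
  by exists (fun=> ind_of I [::]).
- rewrite /ucq_over all_map; apply/allP => m _ /=.
  have : all (@atom_over S (size (ind K))) (atoms k) by apply/all_atoms; split.
  move=> H; rewrite /sub; elim: (atoms k) (m : bitseq) H => [|x s IH] [|[] m'] //= /andP[Hx Hs].
    by rewrite Hx IH.
  exact: IH.
move/Exists_has; rewrite has_map => /hasP[m]; rewrite mem_filter => /andP[/asboolP nS _].
by move/asboolP.
Qed.

End Queries.

(** * Compactness *)

Lemma eventually_all B (Q : nat -> nat -> Prop) :
  (forall c, c < B -> exists N, forall k, N <= k -> Q c k) ->
  exists N, forall k, N <= k -> forall c, c < B -> Q c k.
Proof.
elim: B => [|B IH] H; first by exists 0.
have [c lt_c|N1 H1] := IH; first by apply: H; exact: ltnW.
have [N2 H2] := H B (leqnn _); exists (maxn N1 N2) => k le_k c.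
rewrite ltnS leq_eqVlt => /orP[/eqP->|lt_c]; first by apply: H2; lia.
by apply: H1 => //; lia.
Qed.

(* Compactness: a limit of the [f k] along successive infinite subsequences. *)
Lemma diagonal (D : countType) B (f : nat -> D -> nat) : (forall k d, f k d < B) ->
  exists l : D -> nat, forall (s : seq D) N, exists k, N <= k /\ forall d, d \in s -> f k d = l d.
Proof.
move=> Hf; pose inf (P : nat -> Prop) := forall N, exists k, N <= k /\ P k.
pose agree m c k := forall d, unpickle m = Some d -> f k d = c.
have next_ex (y : (nat -> Prop) * nat) : exists c, inf y.1 -> inf (fun k => y.1 k /\ agree y.2 c k).
  case: y => P m /=; case E : (unpickle m) => [d|]; last by exists 0 => HP N; have [k [? ?]] := HP N;
    exists k; do 2 split=> //; move=> d; rewrite E.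
  apply: contrapT => /forallNP nc.
  have [c lt_c|N HN] := @eventually_all B (fun c k => ~ (P k /\ f k d = c)).
    have /not_implyP[_ /existsNP[N HN]] := nc c; exists N => k le_k [Pk Ek]; apply: HN.
    by exists k; do 2 split=> //; move=> d'; rewrite E => -[<-].
  have /not_implyP[HP _] := nc 0; have [k [le_k Pk]] := HP N.
  exact: (HN k le_k (f k d) (Hf k d)).
have [next Hnext] := choice next_ex.
(* [C m] is an infinite set of indices on which the first [m] coordinates are constant. *)
pose C := fix C m : nat -> Prop :=
  if m is m'.+1 then fun k => C m' k /\ agree m' (next (C m', m')) k else fun=> True.
have C_inf m : inf (C m).
  elim: m => [|m IH] N; first by exists N.
  exact: (Hnext (C m, m) IH N).
have C_le m m' k : m <= m' -> C m' k -> C m k.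
  by move=> /subnK <-; elim: (m' - m) => [//|i IH] /= [/IH].
exists (fun d => next (C (pickle d), pickle d)) => s N.
have [M HM] : exists M, forall d, d \in s -> pickle d < M.
  elim: s => [|d s [M IH]]; first by exists 0.
  exists (maxn (pickle d).+1 M) => d'; rewrite inE => /orP[/eqP->|/IH]; lia.
have [k [le_k HC]] := C_inf M N; exists k; split=> // d ds.
by have [_] := C_le _ _ _ (HM d ds) HC; apply; rewrite pickleK.
Qed.

Lemma all_In T (P : pred T) l x : all P l -> List.In x l -> P x.
Proof. by elim: l => //= y l IH /andP[Py Hl] [<-|/(IH Hl)]. Qed.

Lemma refutedI_le w ar sc sr h tr I k k' f t : k' <= k ->
  refutedI w tr ar sc sr h I k' f t -> refutedI w tr ar sc sr h I k f t.
Proof.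
move=> le_k [[a [x [Hi Hx nS]]]|[nS|H]]; last by right; right.
- by left; exists a, x; split=> // /(Sim_le le_k).
- by right; left => e /(Sim_le le_k); exact: nS.
Qed.

Section Entailed.

Variables (w : seq bool) (tr ar sc sr : nat) (K : kb) (S : signature) (jt ja jc jr : nat).
Hypotheses (Ht : seg w tr jt (enc_list enc_inclusion (tbox K)))
  (Ha : seg w ar ja (enc_list enc_assertion (abox K)))
  (Hc : seg w sc jc (enc_list enc_name (sig_c S)))
  (Hr : seg w sr jr (enc_list enc_name (sig_r S))).
Variable I : interpretation.

Let sim := @Sim w tr sc sr 0 I.

(** For each [k], surviving [k] rounds labels the forest and maps it into [I]; beyond depth [k] only
    the validity of the types is kept. The types of the roots are the same for all [k], and names
    outside K2 get type [t]. *)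
Lemma play (f t : nat) : asg w tr ar 0 f t -> (forall k, ~ refutedI w tr ar sc sr 0 I k f t) ->
  exists (lab : nat -> iname * seq nat -> nat) (h : nat -> iname * seq nat -> dom I)
         (rt : iname -> nat),
  [/\ forall k d, lab k d < KT w /\ vldT w tr (lab k d),
      forall k (d : iname * seq nat), size d.2 <= k -> sim (k - size d.2) (lab k d) (h k d),
      forall k (d : iname * seq nat) j p c, size d.2 < k -> kEx w j p c -> inb (lab k d) j ->
        [/\ inb (lab k (child d j)) c, propg w (lab k d) p (lab k (child d j)) &
            insig w sr p -> forall P, nm w p P -> rint P (h k d) (h k (child d j))],
      forall k x, lab k (x, [::]) = rt x &
      (forall b x, indR w ar b -> nm w b x -> rt x = tA w f b) /\
      forall k x, x \in ind K -> h k (x, [::]) = ind_of I x].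
Proof.
move=> [Heq [Hv [_ [_ [lt_t [_ Hvt]]]]]] nR.
have Sa k b x : indR w ar b -> nm w b x -> sim k (tA w f b) (ind_of I x).
  by move=> Hi Hx; apply: contrapT => nS; apply: (nR k); left; exists b, x; split.
have Se k : exists e, sim k t e.
  by apply: contrapT => nS; apply: (nR k); right; left => e He; apply: nS; exists e.
have [ek Hek] := choice Se.
have rt_ex (x : iname) : exists tau, [/\ tau < KT w, vldT w tr tau,
    forall b, indR w ar b -> nm w b x -> tau = tA w f b & x \notin ind K -> tau = t].
  case: (boolP (x \in ind K)) => [/(indP _ Ha)[b Hi Hx]|nx].
    exists (tA w f b); split=> //; first exact: tA_lt.
      by have [_] := Hv b (lt_NN (nm_lt Hx)) Hi.
    by move=> b' _ Hx'; apply: Heq; [exact: lt_NN (nm_lt Hx)|exact: lt_NN (nm_lt Hx')|exists x].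
  by exists t; split=> // b Hi Hx; case/negP: nx; apply/(indP _ Ha); exists b.
have [rt Hrt] := choice rt_ex.
pose re k x := if x \in ind K then ind_of I x else ek k.
have Hre k x : sim k (rt x) (re k x).
  have [_ _ H1 H2] := Hrt x; rewrite /re; case: ifP => [/(indP _ Ha)[b Hi Hx]|/negbT nx].
    by rewrite (H1 b Hi Hx); exact: Sa.
  by rewrite H2.
pose hit (y : nat * (nat * dom I) * nat) := sim y.1.1.+1 y.1.2.1 y.1.2.2 /\
  exists p c, kEx w y.2 p c /\ inb y.1.2.1 y.2.
have ch_ex (y : nat * (nat * dom I) * nat) : exists z : nat * dom I,
    y.1.2.1 < KT w -> vldT w tr y.1.2.1 -> (z.1 < KT w /\ vldT w tr z.1) /\
    (sim y.1.1.+1 y.1.2.1 y.1.2.2 -> sim y.1.1 z.1 z.2 /\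
      forall p c, kEx w y.2 p c -> inb y.1.2.1 y.2 -> [/\ inb z.1 c, propg w y.1.2.1 p z.1 &
        insig w sr p -> forall P, nm w p P -> rint P y.1.2.2 z.2]).
  case: (pselect (hit y)) => [[[_ HS] [p [c [Hk Hi]]]]|nh].
    have [t' [e' [[lt' [[_ Hv'] [Hi' Hp]]] He' HS']]] := HS _ p c Hk Hi.
    exists (t', e') => _ _; split=> //; split=> // p' c' Hk' _.
    by have [<- <-] := kEx_inj Hk Hk'.
  exists y.1.2 => ? ?; split=> //; split; first exact: Sim_le (leqnSn _) _.
  by move=> p c Hk Hi; case: nh; split=> //; exists p, c.
have [ch Hch] := choice ch_ex.
pose st k x := fix st (u : seq nat) : nat * dom I :=
  if u is j :: u' then ch (k - (size u').+1, st u', j) else (rt x, re k x).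
have st_vld k x u : (st k x u).1 < KT w /\ vldT w tr (st k x u).1.
  elim: u => [|j u [H1 H2]]; first by have [] := Hrt x.
  exact: (proj1 (Hch (k - (size u).+1, st k x u, j) H1 H2)).
have st_step k x u j : size u < k -> sim (k - size u) (st k x u).1 (st k x u).2 ->
    sim (k - (size u).+1) (st k x (j :: u)).1 (st k x (j :: u)).2 /\
      forall p c, kEx w j p c -> inb (st k x u).1 j -> [/\ inb (st k x (j :: u)).1 c,
        propg w (st k x u).1 p (st k x (j :: u)).1 &
        insig w sr p -> forall P, nm w p P -> rint P (st k x u).2 (st k x (j :: u)).2].
  move=> lt_u; have -> : k - size u = (k - (size u).+1).+1 by lia.
  have [H1 H2] := st_vld k x u.
  exact: (proj2 (Hch (k - (size u).+1, st k x u, j) H1 H2)).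
have st_sim k x u : size u <= k -> sim (k - size u) (st k x u).1 (st k x u).2.
  elim: u => [|j u IH] le_u; first by rewrite subn0; exact: Hre.
  by apply: (proj1 (st_step k x u j le_u _)); apply: IH; exact: ltnW.
exists (fun k d => (st k d.1 d.2).1), (fun k d => (st k d.1 d.2).2), rt; split=> //.
- by move=> k [x u] /=; exact: st_sim.
- move=> k [x u] j p c /= lt_u; apply: (proj2 (st_step k x u j lt_u _)).
  by apply: st_sim; exact: ltnW.
split=> [b x Hi Hx|k x Hx]; first by have [_ _ H _] := Hrt x; exact: H.
by rewrite /= /re Hx.
Qed.

(** As there are finitely many types, the labellings have a limit; the maps into [I] need not have
    one. The limit is enough: a match of [q] in the limit forest uses finitely many nodes, on which
    some labelling [lab k] agrees with the limit, and [h k] carries the match into [I]. *)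
Lemma entails_sat (f t : nat) m (q : ucq m) (a : m.-tuple iname) :
  asg w tr ar 0 f t -> (forall k, ~ refutedI w tr ar sc sr 0 I k f t) ->
  {subset a <= ind K} -> ucq_over S q -> entails K q a -> sat_ucq I a q.
Proof.
move=> Has nR sub_a over_q Hent; have [_ [_ [Hca [Hra _]]]] := Has.
have [lab [h [rt [H_vld H_sim H_ch H_rt [H_rtA H_ind]]]]] := play Has nR.
have [l Hl] := diagonal (fun k d => proj1 (H_vld k d)).
have l_rt x : l (x, [::]) = rt x.
  by have [k [_ E]] := Hl [:: (x, [::])] 0; rewrite -E ?inE ?H_rt.
have lab_vld d : vldT w tr (l d).
  have [k [_ E]] := Hl [:: d] 0; rewrite -E ?inE //; exact: (proj2 (H_vld k d)).
have lab_child d j p c : kEx w j p c -> inb (l d) j ->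
    inb (l (child d j)) c /\ propg w (l d) p (l (child d j)).
  have [k [le_k E]] := Hl [:: d; child d j] (size d.2).+1.
  rewrite -!E ?inE ?eqxx ?orbT // => Hk Hi.
  by have [] := H_ch k d j p c le_k Hk Hi.
have lab_role p b c x y : ra w ar p b c -> nm w b x -> nm w c y ->
    propg w (l (x, [::])) p (l (y, [::])).
  move=> Hx Hb Hy; have [P [_ [_ [HP _ _ _]]]] := ra_sound Ha Hx; rewrite !l_rt.
  rewrite (H_rtA b x _ Hb) ?(H_rtA c y _ Hy).
  - exact: Hra _ (lt_NN (nm_lt HP)) _ (lt_NN (nm_lt Hb)) _ (lt_NN (nm_lt Hy)) Hx.
  - exists p; first exact: lt_NN (nm_lt HP).
    by right; exists b; [exact: lt_NN (nm_lt Hb)|right].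
  exists p; first exact: lt_NN (nm_lt HP).
  by right; exists c; [exact: lt_NN (nm_lt Hy)|left].
have lab_conc p b x : ca w ar p b -> nm w b x -> nb w (l (x, [::])) p.
  move=> Hx Hb; have [P [_ [HP _ _]]] := ca_sound Ha Hx; rewrite l_rt.
  rewrite (H_rtA b x _ Hb); first exact: Hca _ (lt_NN (nm_lt HP)) _ (lt_NN (nm_lt Hb)) Hx.
  by exists p; [exact: lt_NN (nm_lt HP)|left].
have /List.Exists_exists[p [Hp [g /List.Forall_forall Hg]]] :=
  Hent _ (forest_model Ht Ha lab_vld lab_child lab_role lab_conc).
have over_p := all_In over_q Hp.
pose val : qvar m -> iname * seq nat := qvar_val (I := forest w l K) a g.
pose nds at_ := match at_ with QConcept _ z => [:: val z] | QRole _ z z' => [:: val z; val z'] end.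
have [F HF] : exists F : seq (iname * seq nat), forall at_, List.In at_ p -> {subset nds at_ <= F}.
  elim: (p) => [|at0 p' [F IH]]; first by exists [::].
  exists (nds at0 ++ F) => at_ [<-|/IH H] d Hd; first by rewrite mem_cat Hd.
  by rewrite mem_cat H ?orbT.
have [N HN] : exists N, forall d, d \in F -> size d.2 < N.
  elim: (F) => [|d F' [N IH]]; first by exists 0.
  exists (maxn (size d.2).+1 N) => d'; rewrite inE leq_max => /orP[/eqP->|/IH->]; by rewrite ?leqnn ?orbT.
have [k [le_k E]] := Hl F N.
apply/List.Exists_exists; exists p; split=> //; exists (fun j => h k (g j)).
have valE z : qvar_val a (fun j => h k (g j)) z = h k (val z).
  by case: z => [i|j] //=; rewrite H_ind //; apply: sub_a; exact: mem_tnth.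
apply/List.Forall_forall => at_ Hat; have := Hg _ Hat; have := HF _ Hat.
have := all_In over_p Hat; case: at_ {Hat} => [A z|P z z'] /= HS Hsub.
  move=> [b HA Hb]; rewrite valE; have Hz : val z \in F by apply: Hsub; rewrite inE.
  have lt_z := leq_trans (HN _ Hz) le_k; have := H_sim k (val z) (ltnW lt_z).
  rewrite -(subnSK lt_z).
  move=> [H _]; apply: (H _ _ HA); first exact/(insigP Hc HA).
  by rewrite E.
have Hz : val z \in F by apply: Hsub; rewrite inE eqxx.
have Hz' : val z' \in F by apply: Hsub; rewrite !inE eqxx orbT.
rewrite !valE; case=> [[j [b [c [Ez Hk HP Hi]]]]|[Ez Ez' Hin]].
  have lt_z := leq_trans (HN _ Hz) le_k; rewrite -/(val z) -/(val z') in Ez Hi.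
  have [|_ _] := H_ch k (val z) j b c lt_z Hk; first by rewrite E.
  by rewrite Ez; apply=> //; exact/(insigP Hr HP).
rewrite -/(val z) -/(val z') in Ez Ez' Hin.
case: (val z) (val z') Ez Ez' Hin => [x u] [y v] /= -> -> Hin.
rewrite !H_ind; first last.
- by apply/mem_ind; exists (ARole P x y); rewrite !inE eqxx.
- by apply/mem_ind; exists (ARole P x y); rewrite !inE eqxx orbT.
have [b [c [d [Hx Hb Hc' Hd]]]] := ra_complete Ha Hin.
(* A missing Σ-edge between individuals would be a refutation with 0 rounds. *)
apply: contrapT => nr; apply: (nR 0); right; right; exists b, c, d, P, x, y.
by do 2 split=> //; exact/(insigP Hr Hb).
Qed.

(** A refuted assignment stays refuted for larger [k], and there are finitely many assignments, so
    one [k] works for all. *)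
Lemma query_adv m (q : ucq m) (a : m.-tuple iname) :
  {subset a <= ind K} -> ucq_over S q -> entails K q a -> ~ sat_ucq I a q ->
  exists k, adv w tr ar sc sr 0 I k.
Proof.
move=> sub_a over_q Hent nS; have NNP f t : asg w tr ar 0 f t ->
    exists N, forall k, N <= k -> refutedI w tr ar sc sr 0 I k f t.
  move=> Has; apply: contrapT => /forallNP nN; apply: nS.
  apply: (entails_sat Has) => // k Hk; apply: (nN k) => k' le_k; exact: refutedI_le le_k Hk.
have [f _|N HN] := @eventually_all (NN w)
    (fun f k => forall t, t < NN w -> asg w tr ar 0 f t -> refutedI w tr ar sc sr 0 I k f t).
  have [t _|N HN] := @eventually_all (NN w)
      (fun t k => asg w tr ar 0 f t -> refutedI w tr ar sc sr 0 I k f t).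
    case: (pselect (asg w tr ar 0 f t)) => [/NNP[N HN]|nA]; last by exists 0.
    by exists N => k le_k _; exact: HN.
  by exists N.
exists N => f t lt_f Has; apply: HN => //.
by have [_ [_ [_ [_ [lt_t _]]]]] := Has; exact: KT_NN.
Qed.

End Entailed.

(** * The decision procedure *)

Lemma consistentP w tl al sc sr K jt ja :
  seg w tl jt (enc_list enc_inclusion (tbox K)) ->
  seg w al ja (enc_list enc_assertion (abox K)) ->
  (consistent K <-> Crit w tl al tl al sc sr 1).
Proof.
move=> Ht Ha; split=> [[I HI]|/(Crit_adv Ht Ha)[I [_ [HI _]]]]; last by exists I.
by apply: (adv_Crit Ht Ha HI (k := 0)) => f t _ [_ [_ [_ [_ [_ []]]]]].
Qed.

Definition sub_indR w a1 a2 : Prop := forall a, a < NN w -> indR w a2 a ->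
  exists2 b, b < NN w & indR w a1 b /\ nmeq w a b.

(* If some individual of K2 is not in K1, any query entailed by K2 is a counterexample, and the
   left-hand KB is replaced by the empty one, encoded by the last bit of [w]. *)
Definition counterexample w a1 t2 a2 sc sr : Prop :=
  sub_indR w a1 a2 /\ Crit w 0 a1 t2 a2 sc sr 0 \/
  ~ sub_indR w a1 a2 /\ exists2 i, i < NN w & i.+1 = size w /\ Crit w i i t2 a2 sc sr 0.

Definition accepted w : Prop :=
  exists2 a1, a1 < NN w & exists2 t2, t2 < NN w & exists2 a2, a2 < NN w &
  exists2 sc, sc < NN w & exists2 sr, sr < NN w &
  LEI w 0 a1 /\ LEA w a1 t2 /\ LEI w t2 a2 /\ LEA w a2 sc /\ LEN w sc sr /\ LEN w sr (size w) /\
  Crit w 0 a1 0 a1 sc sr 1 /\ Crit w t2 a2 t2 a2 sc sr 1 /\ ~ counterexample w a1 t2 a2 sc sr.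

Section Decision.

Variables (w : seq bool) (a1 t2 a2 sc sr : nat) (K1 K2 : kb) (S : signature).
Hypotheses (Ht1 : seg w 0 a1 (enc_list enc_inclusion (tbox K1)))
  (Ha1 : seg w a1 t2 (enc_list enc_assertion (abox K1)))
  (Ht2 : seg w t2 a2 (enc_list enc_inclusion (tbox K2)))
  (Ha2 : seg w a2 sc (enc_list enc_assertion (abox K2)))
  (Hc : seg w sc sr (enc_list enc_name (sig_c S)))
  (Hr : seg w sr (size w) (enc_list enc_name (sig_r S)))
  (con2 : consistent K2).

Lemma sub_indP : sub_indR w a1 a2 <-> {subset ind K2 <= ind K1}.
Proof.
split=> [H x /(indP _ Ha2)[a Hi Hx]|H a la Hi].
  have [b _ [Hb [y [Ha Hb']]]] := H a (lt_NN (nm_lt Hx)) Hi.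
  by apply/(indP _ Ha1); exists b => //; rewrite (nm_inj Hx Ha).
have [x Hx] := indR_nm Hi; have /H/(indP _ Ha1)[b Hb Hb'] : x \in ind K2 by apply/(indP _ Ha2); exists a.
by exists b; [exact: lt_NN (nm_lt Hb')|split=> //; exists x].
Qed.

(** The code of the signature ends with the terminator of a list, which alone encodes the empty
    list. *)
Lemma last_bit : exists i, [/\ i < NN w, i.+1 = size w & seg w i (size w) [:: false]].
Proof.
move: Hr; rewrite enc_listE => /seg_cat[i [_ Hi]]; have [li _] := seg_NN Hi.
by exists i; split=> //; have /seg1[] := Hi.
Qed.

Lemma counterexampleP : ~ counterexample w a1 t2 a2 sc sr <-> ucq_entails S K1 K2.
Proof.
split=> [nC n q a wf_q over_q sub_a Hent|Hent [[Hs HC]|[ns [i _ [Ei HC]]]]].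
- case: (pselect (sub_indR w a1 a2)) => Hs.
    split=> [x /sub_a|I HI]; first exact: (proj1 sub_indP Hs).
    apply: contrapT => nS; apply: nC; left; split=> //.
    have [k Hk] := query_adv Ht2 Ha2 Hc Hr sub_a over_q Hent nS.
    exact: (adv_Crit Ht1 Ha1 HI Hk).
  (* With all relations empty no atom holds, and no disjunct of a query is empty. *)
  pose I : interpretation := @Interpretation iname id (fun _ _ => id) (fun _ _ => False) (fun _ _ _ => False).
  case: nC; right; split=> //; have [i [li Ei Hi]] := last_bit; exists i => //; split=> //.
  have HI : model I (KB [::] [::]) by [].
  have [|k Hk] := query_adv Ht2 Ha2 Hc Hr (I := I) sub_a over_q Hent.
    move=> /List.Exists_exists[p [/(all_In (proj2 (andP wf_q)))]].
    by case: p => // at_ p _ [f H]; inversion_clear H; case: at_ H0.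
  exact: (adv_Crit (KL := KB [::] [::]) Hi Hi HI Hk).
- have [I [k [HI Hk]]] := Crit_adv Ht1 Ha1 HC.
  have [q [wf_q over_q Hq nS]] := adv_query Ht2 Ha2 Hc Hr con2 Hk.
  have [|_ H] := Hent _ q (in_tuple (ind K2)) wf_q over_q _ Hq; first by move=> x.
  exact: nS (H I HI).
have [i' [_ Ei' Hi]] := last_bit; have E : i = i' by lia.
subst i'; have [I [k [_ Hk]]] := Crit_adv (K := KB [::] [::]) Hi Hi HC.
have [q [wf_q over_q Hq nS]] := adv_query Ht2 Ha2 Hc Hr con2 Hk.
(* The tuple lists all individuals of K2, so entailment would place them all in K1. *)
have [|H _] := Hent _ q (in_tuple (ind K2)) wf_q over_q _ Hq; first by move=> x.
by apply: ns; apply/sub_indP => x Hx; exact: H.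
Qed.

End Decision.

Lemma seg_full w s : seg w 0 (size w) s -> w = s.
Proof.
move=> [u [v [E /size0nil Eu]]]; rewrite {1}E Eu /= size_cat add0n => Ev.
have /size0nil Ev' : size v = 0 by lia.
by rewrite E Eu Ev' cats0.
Qed.

Lemma acceptedP w : (exists (K1 K2 : kb) (S : signature),
    [/\ w = enc_input K1 K2 S, consistent K1, consistent K2 & ucq_entails S K1 K2]) <-> accepted w.
Proof.
split=> [[K1 [K2 [S [E c1 c2 HE]]]]|].
  have : seg w 0 (size w) (enc_input K1 K2 S) by exists [::], [::]; rewrite cats0 /= E.
  rewrite /enc_input seg_cat => -[t2 [/seg_cat[a1 [Ht1 Ha1]]]].
  rewrite seg_cat => -[sc [/seg_cat[a2 [Ht2 Ha2]] /seg_cat[sr [Hc Hr]]]].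
  exists a1; first by case: (seg_NN Ha1).
  exists t2; first by case: (seg_NN Ht2).
  exists a2; first by case: (seg_NN Ha2).
  exists sc; first by case: (seg_NN Hc).
  exists sr; first by case: (seg_NN Hr).
  split; first by exists (tbox K1).
  split; first by exists (abox K1).
  split; first by exists (tbox K2).
  split; first by exists (abox K2).
  split; first by exists (sig_c S).
  split; first by exists (sig_r S).
  split; first exact/(consistentP sc sr Ht1 Ha1).
  split; first exact/(consistentP sc sr Ht2 Ha2).
  exact/(counterexampleP Ht1 Ha1 Ht2 Ha2 Hc Hr c2).
move=> [a1 _ [t2 _ [a2 _ [sc _ [sr _ [[T1 Ht1] [[A1 Ha1] [[T2 Ht2] [[A2 Ha2] [[c Hc] [[r Hr] [C1 [C2 nC]]]]]]]]]]]]].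
have c2 : consistent (KB T2 A2) by apply/(consistentP (K := KB T2 A2) sc sr Ht2 Ha2).
exists (KB T1 A1), (KB T2 A2), (Signature c r); split=> //.
- apply: seg_full; apply/seg_cat; exists t2; split; first by apply/seg_cat; exists a1.
  apply/seg_cat; exists sc; split; first by apply/seg_cat; exists a2.
  by apply/seg_cat; exists sr.
- exact/(consistentP (K := KB T1 A1) sc sr Ht1 Ha1).
exact/(counterexampleP (K1 := KB T1 A1) (K2 := KB T2 A2) (S := Signature c r)
  Ht1 Ha1 Ht2 Ha2 Hc Hr c2).
Qed.


Lemma Def_sub_indR f g : DT f -> DT g -> Def (fun w R e => sub_indR w (f w e) (g w e)).
Proof. by apply: (Def_app2 (P := sub_indR)); rewrite /sub_indR; defs. Qed.
#[local] Hint Resolve Def_sub_indR : def.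

Lemma Def_counterexample f1 f2 f3 f4 f5 : DT f1 -> DT f2 -> DT f3 -> DT f4 -> DT f5 ->
  Def (fun w R e => counterexample w (f1 w e) (f2 w e) (f3 w e) (f4 w e) (f5 w e)).
Proof. by apply: (Def_app5 (P := counterexample)); rewrite /counterexample; defs. Qed.
#[local] Hint Resolve Def_counterexample : def.

Lemma Def_accepted : Def (fun w R e => accepted w).
Proof. by rewrite /accepted; defs. Qed.

Lemma wff_exists phi : exists d, forall d', d <= d' -> wff phi d' true.
Proof.
elim: phi => [i j|b i|i j k|phi [d H]|phi [d H] psi [d' H']|phi [d H]|phi [d H] i j k] /=.
- by exists (maxn i j).+1 => d'; rewrite gtn_max => /andP[-> ->].
- by exists i.+1.
- by exists (maxn i (maxn j k)).+1 => d'; rewrite !gtn_max andbA => /andP[/andP[-> ->] ->].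
- by exists d.
- by exists (maxn d d') => e; rewrite geq_max => /andP[/H -> /H' ->].
- by exists d => e le; apply: H; exact: leqW.
exists (maxn d (maxn i (maxn j k)).+1) => e; rewrite geq_max !gtn_max => /andP[le /and3P[-> -> ->]].
by rewrite H //; lia.
Qed.

(** A defining formula may have free variables and mention the relation symbol, though its truth
    depends on neither. Quantifiers bind the former, one [FIter] the latter, and a last quantifier
    the arguments of [FIter]. *)
Lemma Def_in_2EXPTIME (P : seq bool -> Prop) : Def (fun w R e => P w) -> in_2EXPTIME P.
Proof.
move=> [phi Hphi]; have [d Hd] := wff_exists phi.
have ex_phi w R e m : valid w e -> (P w <-> holds w (NN w) (iter m FEx phi) R e).
  have N_gt : 0 < NN w by have := NN_gt w; lia.
  elim: m e => [|m IH] e He; first exact: Hphi.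
  rewrite (IH (scons 0 e)); last exact: valid_scons.
  split=> [H|[a lt_a H]]; first by exists 0.
  apply/(IH (scons 0 e)); first exact: valid_scons.
  by apply/(IH (scons a e)) => //; exact: valid_scons.
apply: (form_in_2EXPTIME (phi := FEx (FIter (iter d FEx phi) 0 0 0)) (R := fun _ _ _ => False)
  (e := fun=> 0)).
  have wff_iter m c : wff (iter m FEx phi) c true = wff phi (m + c) true.
    by elim: m c => //= m IH c; rewrite IH addnS.
  by rewrite /= wff_iter Hd // leq_addr.
move=> w; have [N EN] : exists N, NN w = N.+1 by exists (NN w).-1; have := NN_gt w; lia.
have v0 : valid w (fun=> 0) by move=> i; rewrite EN.
rewrite -/(NN w) /= /iter3; split=> [HP|[a lt_a]].
  exists 0; first by rewrite EN.
  rewrite {1}EN /=; apply/ex_phi => //.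
  by do 4 (apply: valid_scons; first by rewrite EN).
rewrite {1}EN /= => /ex_phi; apply.
by do 4 (apply: valid_scons; first by []).
Qed.

Theorem theorem5 :
  in_2EXPTIME (fun w : seq bool =>
    exists (K1 K2 : kb) (S : signature),
      [/\ w = enc_input K1 K2 S, consistent K1, consistent K2
        & ucq_entails S K1 K2]).
Proof.
apply: Def_in_2EXPTIME; apply: (Def_ext (Q := fun w R e => accepted w)); last exact: Def_accepted.
by move=> w R e _; exact: acceptedP.
Qed.
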